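(* Let $\mathcal T_h$ be an admissible adjusted cut mesh produced by the tubular offset shell construction, with $h$ sufficiently small. Let $T$ be a tetrahedron with a four-edge (quadrilateral) cut, let $K_h$ be either of the two triangles in the split of the quadrilateral cut, and let $Y(\boldsymbol\xi)=\Phi_T(X(\boldsymbol\xi))$, where $X:\widehat K\to K_h$ is the affine map from the reference triangle. Let $g(\boldsymbol s)$ be a smooth local coordinate chart of $\Gamma$ such that $Y(\boldsymbol\xi)=g(\boldsymbol s(\boldsymbol\xi))$. Then for every multi-index $\boldsymbol\alpha$ with $|\boldsymbol\alpha|=n\ge1$, $$|D_{\boldsymbol\xi}^{\boldsymbol\alpha}\boldsymbol s|\le C h^{\lfloor n/2\rfloor+1}.$$ Equivalently, in physical coordinates on $K_h$, $$|D_X^{\boldsymbol\alpha}\boldsymbol s|\le C h^{-\lfloor (n-1)/2\rfloor}.$$ Here $C$ is independent of $h$ and of the position of the cut.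
   Context: Setting. $U\subset\mathbb R^3$ is a fixed polygonal (polyhedral) bulk domain, $\Gamma=\{x\in U:F(x)=0\}$ is a smooth closed connected surface, $F\in C^{m+2}(U)$, and $\nabla F\neq 0$ on a tubular neighborhood of $\Gamma$; the derivative orders $n$ considered satisfy $n\le m$, and $C$ may depend on $n$. Local charts of $\Gamma$ have uniformly bounded derivatives. $d$ is the signed distance function to $\Gamma$, $\mathbf n=\nabla d$ the unit normal, $r_\Gamma$ the reach of $\Gamma$. $\mathcal T_h$ is a tetrahedral mesh with mesh size $h=\max_{T\in\mathcal T_h}\operatorname{diam}(T)$; one considers a family of such meshes as $h\to0$. Constants are independent of $h$ and of the particular cut tetrahedron. Admissible adjusted cut mesh: for all sufficiently small $h$, (i) $\mathcal T_h$ is uniformly shape regular; (ii) no vertex lies on $\Gamma$, and every vertex $A$ of a cut tetrahedron (one intersected by $\Gamma$) satisfies $|d(A)|\ge\eta h$ for a fixed $\eta>0$; (iii) if $A_i,A_j$ are two vertices of a tetrahedron then $|d(A_i)|-|d(A_j)|=O(h^2)$. Tubular offset shell construction: take a quasi-uniform, shape-regular surface triangulation $\mathcal S_h$ of $\Gamma$ with vertices $p_i\in\Gamma$ and maximal element diameter $h_\Gamma$ (comparable to $h$); fix $\rho>0$ with $\rho h_\Gamma<r_\Gamma/4$; set $p_i^\pm=p_i\pm\rho h_\Gamma\mathbf n(p_i)$ (or place these two layers by solving along the normal/gradient line for $F=\pm\sigma h_\Gamma$); for each triangle $[p_1,p_2,p_3]$ of $\mathcal S_h$ form the prism with vertices $p_1^-,p_2^-,p_3^-,p_1^+,p_2^+,p_3^+$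 and split it by a fixed shape-regular, globally consistent prism subdivision, e.g. into $\operatorname{conv}\{p_1^-,p_2^-,p_3^-,p_1^+\}$, $\operatorname{conv}\{p_2^-,p_3^-,p_1^+,p_2^+\}$, $\operatorname{conv}\{p_3^-,p_1^+,p_2^+,p_3^+\}$. The union of these tetrahedra is the active mesh (optionally completed outside the shell by a uniformly shape-regular mesh). Four-edge cut: $T=\operatorname{conv}\{x_0,x_1,x_2,x_3\}$ with, after relabeling, $F(x_0),F(x_2)>0$ and $F(x_1),F(x_3)<0$. Put $M(u)=(1-u)x_0+ux_2$, $N(v)=(1-v)x_1+vx_3$, $0\le u,v\le1$. For each $(u,v)\in[0,1]^2$ there is a unique $w(u,v)\in(0,1)$ with $Y(u,v)=(1-w(u,v))M(u)+w(u,v)N(v)\in\Gamma$. $P_{ij}$ is the zero of $F$ on the edge $x_ix_j$; the two split triangles are $\triangle P_{01}P_{12}P_{30}$ and $\triangle P_{12}P_{23}P_{30}$. For $X$ in either triangle with barycentric coordinates $(\alpha,\beta,\gamma,\delta)$ relative to $(x_0,x_1,x_2,x_3)$ put $u(X)=\gamma/(\alpha+\gamma)$, $v(X)=\delta/(\beta+\delta)$ and $\Phi_T(X)=Y(u(X),v(X))$. Physical coordinates on $K_h$ are Cartesian coordinates in the plane of $K_h$.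
   Formalization: The local charts g are assumed to have, besides uniformly bounded derivatives, uniformly bounded inverse differentials (|v| ≤ B|Dg v|); without this, rescaled or edge-degenerate charts violate the bound. *)

(* Defs.v *)
From HB Require Import structures.
From mathcomp Require Import all_boot all_order all_algebra.
From mathcomp Require Import all_classical all_reals all_analysis.

Set Implicit Arguments.
Unset Strict Implicit.
Unset Printing Implicit Defensive.

Import Order.TTheory GRing.Theory Num.Theory.
Import numFieldNormedType.Exports.

Local Open Scope classical_set_scope.
Local Open Scope ring_scope.

Section Euclidean.
Context {R : realType} {d : nat}.
Implicit Types (x y : 'rV[R]_d) (A : set 'rV[R]_d).

(* The canonical norm `|x| on row vectors is the maximum norm. *)
Definition enorm x : R := Num.sqrt (\sum_i x 0 i ^+ 2).

Definition dist x A : R := inf [set enorm (x - y) | y in A].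

Definition diam A : R := sup [set enorm (p.1 - p.2) | p in A `*` A].

Definition reach A : \bar R :=
  ereal_sup [set r%:E | r in [set r : R | 0 <= r /\
    forall x, dist x A < r -> exists! y, A y /\ enorm (x - y) = dist x A]].

End Euclidean.

Section Derivatives.
Context {R : realType} {d : nat} {W : normedModType R}.
Implicit Types (f : 'rV[R]_d -> W) (a : 'I_d -> nat).

Fixpoint Ck (k : nat) (O : set 'rV[R]_d) f : Prop :=
  if k is k'.+1 then
    (forall x, O x -> differentiable f x) /\ forall v, Ck k' O ('D_v f)
  else forall x, O x -> {for x, continuous f}.

Definition mderiv a f : 'rV[R]_d -> W :=
  foldr (fun i f' => iter (a i) (fun f'' => 'D_(delta_mx 0 i) f'') f')
        f (enum 'I_d).

End Derivatives.

Definition grad {R : realType} {d : nat} (f : 'rV[R]_d -> R) (x : 'rV[R]_d)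
  : 'rV[R]_d := \row_i 'D_(delta_mx 0 i) f x.

Section Simplices.
Context {R : realType} {d : nat}.
Implicit Types (s : seq 'rV[R]_d) (y : 'rV[R]_d).

Definition aff s : set 'rV[R]_d :=
  [set y | exists l : 'I_(size s) -> R,
     \sum_i l i = 1 /\ y = \sum_i l i *: s`_i].

Definition hull s : set 'rV[R]_d :=
  [set y | exists l : 'I_(size s) -> R,
     [/\ forall i, 0 <= l i, \sum_i l i = 1 & y = \sum_i l i *: s`_i]].

Definition affine_free s : Prop :=
  forall l : 'I_(size s) -> R,
    \sum_i l i = 0 -> \sum_i l i *: s`_i = 0 -> forall i, l i = 0.

(* The inscribed ball is taken relative to the affine hull, so that this also
   applies to triangles in space. *)
Definition shape_regular (kappa : R) s : Prop :=
  affine_free s /\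
  exists r c, [/\ 0 < r, diam (hull s) <= kappa * r, aff s c &
    forall y, aff s y -> enorm (y - c) <= r -> hull s y].

(* Simplices are listed by their vertices, in an arbitrary order. *)
Definition conforming k (S : seq (k.-tuple 'rV[R]_d)) : Prop :=
  forall s t : k.-tuple 'rV[R]_d, s \in S -> t \in S ->
    hull s `&` hull t = hull [seq p <- s | p \in tval t].

Definition carrier k (S : seq (k.-tuple 'rV[R]_d)) : set 'rV[R]_d :=
  [set y | exists2 s : k.-tuple 'rV[R]_d, s \in S & hull s y].

Definition mesh_size k (S : seq (k.-tuple 'rV[R]_d)) : R :=
  \big[Num.max/0]_(s <- S) diam (hull s).

End Simplices.

Section Geometry.
Context {R : realType}.
Local Notation pt := 'rV[R]_3.
Local Notation mesh := (seq (4.-tuple pt)).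
Local Notation surface_mesh := (seq (3.-tuple pt)).
Implicit Types (U Gamma : set pt) (F : pt -> R) (M : mesh) (S : surface_mesh).

Definition polyhedral_domain U : Prop :=
  connected U /\
  exists2 M : mesh, (forall T, T \in M -> affine_free T) & U = (carrier M)°.

Definition level_set U F : set pt := [set x | U x /\ F x = 0].

(* A compact zero set of F inside the open set U, on which the gradient of F
   does not vanish, is a closed surface as smooth as F. *)
Definition closed_level_surface U F : Prop :=
  let Gamma := level_set U F in
  [/\ compact Gamma, connected Gamma, Gamma !=set0 &
      exists2 delta : R, 0 < delta &
        forall x, dist x Gamma < delta -> U x /\ grad F x != 0].

(* Oriented by the sign of F. *)
Definition sdist U F (x : pt) : R :=
  if F x < 0 then - dist x (level_set U F) else dist x (level_set U F).

Definition unit_normal U F (p : pt) : pt := grad (sdist U F) p.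

Definition tetrahedral_mesh U M : Prop :=
  [/\ forall T, T \in M -> affine_free T,
      conforming M & carrier M `<=` closure U].

Definition is_cut U F (T : 4.-tuple pt) : Prop :=
  hull T `&` level_set U F !=set0.

(* The last condition only makes sense on the cut cells: away from the surface
   the distance varies by O(h) over a cell. *)
Definition admissible U F (J : Type) (Th : J -> mesh) : Prop :=
  exists kappa eta c h0 : R, [/\ 0 < eta, 0 < h0 &
    forall j, mesh_size (Th j) <= h0 ->
    forall T, T \in Th j ->
      [/\ shape_regular kappa T,
          forall A, A \in T -> ~ level_set U F A,
          is_cut U F T -> forall A, A \in T ->
            eta * mesh_size (Th j) <= `|sdist U F A| &
          is_cut U F T -> forall A B, A \in T -> B \in T ->
            `| `|sdist U F A| - `|sdist U F B| | <= c * mesh_size (Th j) ^+ 2]].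

Definition surface_triangulation Gamma S : Prop :=
  [/\ forall t, t \in S -> affine_free t,
      conforming S,
      forall t p, t \in S -> p \in t -> Gamma p &
      exists phi : pt -> pt,
        [/\ {within carrier S, continuous phi}, set_bij (carrier S) Gamma phi &
            forall t p, t \in S -> p \in t -> phi p = p]].

Definition normal_layers U F (rho : R) S (lo up : pt -> pt) : Prop :=
  ((4 * (rho * mesh_size S))%:E < reach (level_set U F))%E /\
  forall t p, t \in S -> p \in t ->
    lo p = p - (rho * mesh_size S) *: unit_normal U F p /\
    up p = p + (rho * mesh_size S) *: unit_normal U F p.

Definition level_layers U F (sigma : R) S (lo up : pt -> pt) : Prop :=
  forall t p, t \in S -> p \in t ->
    (exists a : R, [/\ 0 < a, lo p = p - a *: unit_normal U F p, U (lo p) &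
                       F (lo p) = - (sigma * mesh_size S)]) /\
    (exists a : R, [/\ 0 < a, up p = p + a *: unit_normal U F p, U (up p) &
                       F (up p) = sigma * mesh_size S]).

(* The six orderings of t give the six subdivisions of the prism over t that
   add no vertex; the order in which a triangulation lists the vertices of t
   selects one of them. *)
Definition prism_split (lo up : pt -> pt) (t : 3.-tuple pt) : mesh :=
  let p1 := tnth t 0 in let p2 := tnth t 1 in let p3 := tnth t 2 in
  [:: [tuple lo p1; lo p2; lo p3; up p1];
      [tuple lo p2; lo p3; up p1; up p2];
      [tuple lo p3; up p1; up p2; up p3]].

(* The cells of M' complete the mesh outside the shell; consistency of the
   prism subdivisions across neighbours and shape regularity of all cells are
   conformity and admissibility of Th j. *)
Definition tubular_offset_shell U F (J : Type) (Th : J -> mesh) : Prop :=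
  exists kappa q c1 c2 rho sigma h0 : R,
  [/\ 0 < q, 0 < c1, 0 < rho, 0 < sigma & 0 < h0] /\
  forall j, mesh_size (Th j) <= h0 ->
  exists (S : surface_mesh) (M' : mesh) (lo up : pt -> pt),
    [/\ surface_triangulation (level_set U F) S,
        forall t, t \in S ->
          shape_regular kappa t /\ q * mesh_size S <= diam (hull t),
        c1 * mesh_size (Th j) <= mesh_size S <= c2 * mesh_size (Th j),
        normal_layers U F rho S lo up \/ level_layers U F sigma S lo up &
        Th j = flatten [seq prism_split lo up t | t <- S] ++ M'].

Definition local_chart (k : nat) Gamma (V : set 'rV[R]_2)
    (g : 'rV[R]_2 -> pt) : Prop :=
  [/\ open V, Ck k V g, set_inj V g &
      forall O, open O -> O `<=` V ->
        exists2 O', open O' & g @` O = Gamma `&` O'].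

(* Uniform bounds on the derivatives of the charts and, in the last clause, of
   their inverses (the higher derivatives of the inverses are then bounded). *)
Definition uniform_charts (k : nat) Gamma
    (A : set (set 'rV[R]_2 * ('rV[R]_2 -> pt))) : Prop :=
  exists B : R, forall V g, A (V, g) ->
    [/\ local_chart k Gamma V g,
        forall (a : 'I_2 -> nat) z, (\sum_i a i <= k)%N -> V z ->
          enorm (mderiv a g z) <= B &
        forall z v, V z -> enorm v <= B * enorm ('D_v g z)].

End Geometry.

Section FourEdgeCut.
Context {R : realType}.
Local Notation pt := 'rV[R]_3.
Variables (U : set pt) (F : pt -> R) (x : 4.-tuple pt).
Local Notation Gamma := (level_set U F).
Local Notation x_ i := (tnth x i).

Definition cut_point_at (u v w : R) : pt :=
  (1 - w) *: ((1 - u) *: x_ 0 + u *: x_ 2) +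
  w *: ((1 - v) *: x_ 1 + v *: x_ 3).

Definition cut_weight (u v : R) : R :=
  xget 0 [set w | 0 < w < 1 /\ Gamma (cut_point_at u v w)].

Definition cut_point (u v : R) : pt := cut_point_at u v (cut_weight u v).

Definition edge_zero (i j : 'I_4) : pt :=
  xget 0 (hull [:: x_ i; x_ j] `&` Gamma).

Definition split_triangles : seq (3.-tuple pt) :=
  [:: [tuple edge_zero 0 1; edge_zero 1 2; edge_zero 3 0];
      [tuple edge_zero 1 2; edge_zero 2 3; edge_zero 3 0]].

(* l = bary X solves \sum_i l 0 i = 1 and \sum_i l 0 i *: x_ i = X. *)
Definition bary (X : pt) : 'rV[R]_4 :=
  row_mx (1 : 'rV_1) X *m
  invmx (\matrix_(i < 4) row_mx (1 : 'rV_1) (x_ i) : 'M[R]_(1 + 3)).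

Definition cut_map (X : pt) : pt :=
  let l := bary X 0 in
  cut_point (l 2 / (l 0 + l 2)) (l 3 / (l 1 + l 3)).

End FourEdgeCut.

Section Coordinates.
Context {R : realType}.

Definition ref_triangle : set 'rV[R]_2 :=
  [set z | [/\ 0 <= z 0 0, 0 <= z 0 1 & z 0 0 + z 0 1 <= 1]].

Definition affine_map (k : 3.-tuple 'rV[R]_3) (z : 'rV[R]_2) : 'rV[R]_3 :=
  tnth k 0 + z 0 0 *: (tnth k 1 - tnth k 0) + z 0 1 *: (tnth k 2 - tnth k 0).

Definition plane_point (o : 'rV[R]_3) (E : 'M[R]_(2, 3)) (z : 'rV[R]_2) :=
  o + z *m E.

Definition cartesian_frame (k : seq 'rV[R]_3) (o : 'rV[R]_3)
    (E : 'M[R]_(2, 3)) : Prop :=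
  E *m E^T = 1%:M /\ forall z, aff k (plane_point o E z).

End Coordinates.

(* Main.v *)
Require Import Defs.
From HB Require Import structures.
From mathcomp Require Import all_boot all_order all_fingroup all_algebra.
From mathcomp Require Import all_classical all_reals all_analysis.
From mathcomp Require Import zify ring lra.

Set Implicit Arguments.
Unset Strict Implicit.
Unset Printing Implicit Defensive.

Import Order.TTheory GRing.Theory Num.Theory.
Import numFieldNormedType.Exports.

Local Open Scope classical_set_scope.
Local Open Scope ring_scope.

(** Half-powers of h organise the whole argument.  Say that a function of the
parameter has half-order p when its derivatives of order n are
O(h^ceil((n+p)/2)).  Because ceil(a/2) + ceil(b/2) >= ceil((a+b)/2), half-orders
add under multiplication; differentiation raises them by one; the factor h
counts for 2.  As ceil((n+1)/2) = floor(n/2) + 1, the theorem says that s has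
half-order 1 up to an additive constant.

Let lambda be the barycentric coordinates in the cut tetrahedron of a point of
K_h.  They are affine in the parameter.  Where the surface cuts an edge, the two
ends have almost opposite signed distances, so that
lambda_0 + lambda_2 = 1/2 + O(h) at each vertex of K_h: the slopes of
lambda_0 + lambda_2 are O(h), those of a single coordinate only O(1).  Hence the
derivatives of u = lambda_2 / (lambda_0 + lambda_2) have half-order 0, and h u
has half-order 1 ([ratio_ord]); likewise for v.

The edges e1 = x2 - x0 and e2 = x3 - x1 join vertices at almost equal distances
from the surface, so grad F . e1 and grad F . e2 are O(h^2) instead of O(h),
while grad F . (N - M) is of the exact size h.  Differentiating F(Y) = 0 gives
w' = - ((1 - w) u' grad F . e1 + w v' grad F . e2) / (grad F . (N - M)).
If w has half-order 0 up to k derivatives, then Y has half-order 1 up to a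
constant, grad F(Y) . e1 has half-order 3 (its value is O(h^2), its derivative
is h times a quantity of half-order 2 times a bounded one), grad F(Y) . (N - M)
has half-order 2, and the formula shows that w' has half-order 1: one more
derivative of w is controlled ([cut_weight_ord]).  The chart relation g(s) = Y
is bootstrapped in the same way, with the Gram matrix of g solving for the
derivatives of s ([chart_coordinates_incr]).

The conditions on distances reach F through the expansion
|F(y)| = |grad F(p)| dist(y) + O(h^2), for p on the surface and |y - p| <= h
([abs_level_dist]); all that is needed of a cut tetrahedron is then collected in
[cut_cell].  Shape regularity enters only to show that K_h does not degenerate,
so that physical coordinates divided by h are a parametrisation of the same kind
as the reference triangle; undoing the scaling costs h^-n in an n-th derivative.

Uniformity in h and in the position of the cut is built in: all functions are
families indexed by the configurations (mesh, tetrahedron, triangle, chart), and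
a bound means one constant for the whole family. *)

(** * Differentiability on row vectors *)

Section RowVectors.
Context {R : realType} {d : nat}.
Implicit Types (v w : 'rV[R]_d) (c : R).

Lemma coord_norm_le v i : `|v 0 i| <= `|v|.
Proof. by rewrite [leRHS]/Num.Def.normr/= mx_normrE; exact: (le_bigmax _ _ (0, i)). Qed.

Lemma row_norm_le v c : 0 <= c -> (forall i, `|v 0 i| <= c) -> `|v| <= c.
Proof.
move=> c0 vc; rewrite [leLHS]/Num.Def.normr/= mx_normrE.
by apply: bigmax_le => // -[i j] _ /=; rewrite (ord1 i).
Qed.

End RowVectors.

Lemma differentiable_remainder (R : realType) (V W : normedModType R) (f : V -> W) x (e : R) :
  differentiable f x -> 0 < e ->
  \forall y \near x, `|f y - f x - 'd f x (y - x)| <= e * `|y - x|.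
Proof.
move=> df e0; have /diff_locallyx fx := df.
suff: \forall v \near (0 : V), `|f (v + x) - f x - 'd f x v| <= e * `|v|.
  move=> near0; rewrite (near_shift 0)/= subr0.
  near=> v; rewrite /= addrK; near: v; exact: near0.
near=> v; rewrite fx -addrA -opprD [X in X - _]addrC addrK.
near: v; exact: (littleoP _ e0).
Unshelve. all: by end_near. Qed.

Lemma near_linear_differentiable (R : realType) (V W : normedModType R)
    (f : V -> W) (L : {linear V -> W}) x : continuous L ->
  (forall e : R, 0 < e -> \forall y \near x,
     `|f y - f x - L (y - x)| <= e * `|y - x|) ->
  differentiable f x.
Proof.
move=> Lc fx.
have fL : f \o shift x = cst (f x) + L +o_ 0 id.
  apply/eqaddoP => e e0; have := fx e e0.
  rewrite (near_shift 0)/= subr0 => near0.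
  near=> v; rewrite /= fctE/= opprD addrA.
  by have := near near0 v; rewrite /= addrK; apply.
by apply/diff_locallyP; rewrite (diff_unique Lc fL).
Unshelve. all: by end_near. Qed.

Section Differentiability.
Context {R : realType} {d : nat}.
Implicit Types (f g : 'rV[R]_d -> R) (x v : 'rV[R]_d).

Lemma differentiable_row k (y : 'I_k -> 'rV[R]_d -> R) x :
  (forall i, differentiable (y i) x) ->
  differentiable (fun z => \row_i y i z) x.
Proof.
move=> dy.
have -> : (fun z => \row_i y i z) =
    \sum_(i < k) (fun z => y i z *: (delta_mx 0 i : 'rV[R]_k)).
  apply/funext => z; rewrite fct_sumE [LHS]row_sum_delta.
  by apply: eq_bigr => i _; rewrite mxE.
by apply: differentiable_sum => i; exact: differentiableZl.
Qed.

Lemma derive_partials f x v : differentiable f x ->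
  'D_v f x = \sum_i v 0 i * 'D_(delta_mx 0 i) f x.
Proof.
move=> df; rewrite deriveE// [in LHS](row_sum_delta v) linear_sum/=.
by apply: eq_bigr => i _; rewrite linearZ/= deriveE.
Qed.

Lemma differentiable_near f x (e : R) : differentiable f x -> 0 < e ->
  \forall y \near x, `|f y - f x - 'D_(y - x) f x| <= e * `|y - x|.
Proof.
move=> df e0; have := differentiable_remainder df e0.
by apply: filterS => y; rewrite deriveE.
Qed.

Lemma near_differentiable f x (a : 'I_d -> R) :
  (forall e : R, 0 < e -> \forall y \near x,
     `|f y - f x - \sum_i (y - x) 0 i * a i| <= e * `|y - x|) ->
  differentiable f x.
Proof.
move=> fx; set l := fun v : 'rV[R]_d => \sum_i v 0 i * a i : R.
have linl : linear l.
  move=> c u v; rewrite /l scaler_sumr -big_split/=; apply: eq_bigr => i _.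
  by rewrite !mxE mulrDl -mulrA.
pose L : {linear 'rV[R]_d -> R} := HB.pack l
  (GRing.isLinear.Build R 'rV[R]_d R *:%R _ linl).
have Lc : continuous L.
  move=> y; apply: differentiable_continuous.
  have -> : L = \sum_(i < d) (fun v : 'rV[R]_d => v 0 i * a i) :> ('rV[R]_d -> R).
    by apply/funext => v; rewrite fct_sumE.
  apply: differentiable_sum => i; apply: differentiableM => //.
  exact: differentiable_coord.
exact: (@near_linear_differentiable _ _ _ f L).
Qed.

Lemma near_eq_differentiable f g x :
  (\forall y \near x, f y = g y) -> differentiable f x -> differentiable g x.
Proof.
move=> fg df; apply: (@near_differentiable _ _ (fun i => 'D_(delta_mx 0 i) f x)).
move=> e e0; have := differentiable_near df e0; have fgx := nbhs_singleton fg.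
by apply: filterS2 fg => y /= fgy; rewrite -fgy -fgx derive_partials.
Qed.

(** An implicitly defined function is thus differentiable once it is within
o(|y - x|) of an explicit differentiable one. *)
Lemma approx_differentiable f g x : f x = g x -> differentiable g x ->
  (forall e : R, 0 < e -> \forall y \near x, `|f y - g y| <= e * `|y - x|) ->
  differentiable f x.
Proof.
move=> fgx dg fg; apply: (@near_differentiable _ _ (fun i => 'D_(delta_mx 0 i) g x)).
move=> e e0; have e20 : 0 < e / 2 by rewrite divr_gt0.
have := differentiable_near dg e20; have := fg _ e20.
apply: filterS2 => y /= fgy gy; rewrite derive_partials// in gy.
rewrite [X in `|X|](_ : _ = (f y - g y) + (g y - g x - \sum_i (y - x) 0 i * 'D_(delta_mx 0 i) g x)).
  by apply: le_trans (ler_normD _ _) _; rewrite (splitr e) mulrDl lerD.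
by rewrite fgx; ring.
Qed.

Lemma is_derive_line f x v (t : R) : differentiable f (x + t *: v) ->
  is_derive t 1 (fun t' => f (x + t' *: v)) ('D_v f (x + t *: v)).
Proof.
move=> df.
have dl : is_diff t (fun t' : R => x + t' *: v) ( *:%R^~ v).
  have -> : (fun t' : R => x + t' *: v) = cst x + *:%R^~ v by [].
  by apply: is_diff_eq; rewrite add0r.
have dfl : differentiable (f \o (fun t' : R => x + t' *: v)) t.
  by apply: differentiable_comp.
have d1 := diff_derivable (v := (1 : R)) dfl; apply: DeriveDef => //.
by rewrite deriveE// diff_comp//= deriveE// diff_val/= scale1r.
Qed.

Lemma mean_value f x y :
  (forall t : R, 0 <= t <= 1 -> differentiable f (x + t *: (y - x))) ->
  exists2 t : R, 0 <= t <= 1 & f y - f x = 'D_(y - x) f (x + t *: (y - x)).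
Proof.
move=> df; pose p t := f (x + t *: (y - x)).
have dp (t : R) : 0 <= t <= 1 -> is_derive t (1 : R) p ('D_(y - x) f (x + t *: (y - x))).
  by move=> /df; exact: is_derive_line.
have [||t] := @MVT_segment R p (fun t : R => 'D_(y - x) f (x + t *: (y - x))) 0 1 ler01.
- by move=> t; rewrite in_itv/= => /andP[/ltW ? /ltW ?]; apply: dp; apply/andP.
- apply: derivable_within_continuous => t; rewrite in_itv/= => /dp [+ _]; exact.
rewrite in_itv/= => t01 H; exists t => //; move: H.
by rewrite /p scale1r scale0r addr0 subr0 mulr1 subrKC.
Qed.

End Differentiability.

Lemma chain_rule (R : realType) (d k : nat) (G : 'rV[R]_k -> R) (y : 'I_k -> 'rV[R]_d -> R) x v :
  (forall c, differentiable (y c) x) -> differentiable G (\row_c y c x) ->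
  differentiable (fun z => G (\row_c y c z)) x /\
  'D_v (fun z => G (\row_c y c z)) x =
    \sum_c 'D_v (y c) x * 'D_(delta_mx 0 c) G (\row_c y c x).
Proof.
move=> dy dG; pose r := fun z => \row_c y c z : 'rV[R]_k.
have dr : differentiable r x by exact: differentiable_row.
have dGr : differentiable (G \o r) x by exact: differentiable_comp.
split=> //; rewrite -[LHS]/('D_v (G \o r) x) deriveE// diff_comp//=.
rewrite -(deriveE v dr) -(deriveE _ dG) derive_partials//; apply: eq_bigr => c _; congr (_ * _).
rewrite derive_mx ?mxE; last exact: diff_derivable.
by congr ('D_v _ x); apply/funext => z; rewrite mxE.
Qed.

(** * Families with uniformly bounded derivatives *)

Section Tame.
Context {R : realType} {I : Type} {d : nat}.
Variable O : I -> set 'rV[R]_d.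
Implicit Types (f g : I -> 'rV[R]_d -> R) (om : nat -> I -> R).

Definition bounded_by (om : I -> R) f :=
  exists C : R, forall i x, O i x -> `|f i x| <= C * om i.

(** The index i runs over configurations, so a single constant for all i
expresses uniformity; om n is the size allowed for derivatives of order n.
Partial derivatives are taken in every order, which lets each closure property
be proved by induction on k from the corresponding rule for one derivative. *)
Fixpoint tame k om f : Prop :=
  bounded_by (om 0) f /\
  if k is k'.+1 then
    (forall i x, O i x -> differentiable (f i) x) /\
    forall e : 'I_d, tame k' (om \o succn) (fun i => 'D_(delta_mx 0 e) (f i))
  else True.

Lemma tame_bounded k om f : tame k om f -> bounded_by (om 0) f.
Proof. by case: k => [|k] []. Qed.

Lemma tameW k om f : tame k.+1 om f -> tame k om f.
Proof.
elim: k om f => [|k IHk] om f; first by case.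
by move=> [bf [df pf]]; split=> //; split=> // e; apply: IHk; exact: pf.
Qed.

Lemma tame_le k l om f : (k <= l)%N -> tame l om f -> tame k om f.
Proof.
move=> /subnK <-; elim: (l - k)%N => [//|j IHj].
by rewrite addSn => /tameW /IHj.
Qed.

Lemma tame_differentiable k om f i x : tame k.+1 om f -> O i x ->
  differentiable (f i) x.
Proof. by move=> [_ [df _]]; exact: df. Qed.

Lemma tame_partial k om f e : tame k.+1 om f ->
  tame k (om \o succn) (fun i => 'D_(delta_mx 0 e) (f i)).
Proof. by move=> [_ [_ pf]]; exact: pf. Qed.

Hypothesis Oopen : forall i, open (O i).

Lemma near_open i x (P : 'rV[R]_d -> Prop) :
  O i x -> (forall y, O i y -> P y) -> \forall y \near x, P y.
Proof.
move=> Ox OP; have Onbhs : nbhs x (O i) by apply: open_nbhs_nbhs; split=> //; exact: Oopen.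
by apply: filterS Onbhs => y; exact: OP.
Qed.

Lemma tame_ext k om f g : (forall i x, O i x -> f i x = g i x) ->
  tame k om f -> tame k om g.
Proof.
elim: k om f g => [|k IHk] om f g fg [[C bf]].
  by move=> _; split=> //; exists C => i x Ox; rewrite -fg//; exact: bf.
move=> [df pf]; split; first by exists C => i x Ox; rewrite -fg//; exact: bf.
split=> [i x Ox|e].
  apply: near_eq_differentiable (df _ _ Ox).
  by apply: near_open Ox _ => y Oy; exact: fg.
apply: IHk (pf e) => i x Ox.
apply: near_eq_derive; apply: near_open Ox _ => y Oy; exact: fg.
Qed.

Lemma tameD k om f g : (forall n i, 0 <= om n i) ->
  tame k om f -> tame k om g -> tame k om (fun i x => f i x + g i x).
Proof.
elim: k om f g => [|k IHk] om f g om0 [[C bf] pf] [[D bg] pg].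
  split=> //; exists (C + D) => i x Ox; rewrite mulrDl.
  by apply: le_trans (ler_normD _ _) _; apply: lerD; [exact: bf|exact: bg].
split.
  exists (C + D) => i x Ox; rewrite mulrDl.
  by apply: le_trans (ler_normD _ _) _; apply: lerD; [exact: bf|exact: bg].
case: pf pg => df pf [dg pg]; split=> [i x Ox|e].
  by apply: differentiableD; [exact: df|exact: dg].
apply: tame_ext (IHk _ _ _ _ (pf e) (pg e)) => [i x Ox|n i]; last exact: om0.
by rewrite deriveD//; apply: diff_derivable; [exact: df|exact: dg].
Qed.

Lemma tame_cst k om (c : I -> R) : (forall n i, 0 <= om n i) ->
  (exists C : R, forall i, `|c i| <= C * om 0 i) -> tame k om (fun i _ => c i).
Proof.
elim: k om c => [|k IHk] om c om0 [C bc]; first by split=> //; exists C => i x _.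
split; first by exists C => i x _.
split=> [i x _|e]; first exact: differentiable_cst.
apply: tame_ext (IHk (om \o succn) (fun=> 0) _ _) => [i x Ox|n i|].
- by rewrite derive_cst.
- exact: om0.
- by exists 0 => i; rewrite normr0 mul0r.
Qed.

Lemma tameZ k om om' f (c : I -> R) (C : R) :
  (forall n i, 0 <= om n i) -> (forall n i, `|c i| * om n i <= C * om' n i) ->
  tame k om f -> tame k om' (fun i x => c i * f i x).
Proof.
elim: k om om' f => [|k IHk] om om' f om0 cC tf.
  split=> //; have [B bf] := tame_bounded tf; exists (`|B| * C) => i x Ox.
  rewrite normrM -mulrA; apply: le_trans (ler_wpM2l (normr_ge0 B) (cC 0 i)).
  rewrite mulrCA; apply: ler_wpM2l => //.
  by apply: le_trans (bf _ _ Ox) _; apply: ler_wpM2r => //; exact: ler_norm.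
split.
  have [B bf] := tame_bounded tf; exists (`|B| * C) => i x Ox.
  rewrite normrM -mulrA; apply: le_trans (ler_wpM2l (normr_ge0 B) (cC 0 i)).
  rewrite mulrCA; apply: ler_wpM2l => //.
  by apply: le_trans (bf _ _ Ox) _; apply: ler_wpM2r => //; exact: ler_norm.
have df i x := @tame_differentiable _ _ _ i x tf.
split=> [i x Ox|e]; first by apply: differentiableM => //; exact: df.
apply: tame_ext (IHk _ _ _ _ _ (tame_partial e tf)) => [i x Ox|n i|n i].
- by rewrite -[RHS]/('D_(delta_mx 0 e) (c i \*: f i) x) deriveZ//; apply: diff_derivable; exact: df.
- exact: om0.
- exact: cC.
Qed.

Lemma tameN k om f : (forall n i, 0 <= om n i) ->
  tame k om f -> tame k om (fun i x => - f i x).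
Proof.
move=> om0 /(tameZ (om' := om) (c := fun=> -1) (C := 1) om0) H.
apply: tame_ext (H _) => [i x _|n i]; first by rewrite mulN1r.
by rewrite normrN1.
Qed.

Lemma tameB k om f g : (forall n i, 0 <= om n i) ->
  tame k om f -> tame k om g -> tame k om (fun i x => f i x - g i x).
Proof. by move=> om0 tf /(tameN om0); exact: tameD. Qed.

Lemma tame_weight k om om' f (C : R) :
  (forall n i, 0 <= om n i) -> (forall n i, om n i <= C * om' n i) ->
  tame k om f -> tame k om' f.
Proof.
move=> om0 omC /(tameZ (om' := om') (c := fun=> 1) (C := C) om0) H.
apply: tame_ext (H _) => [i x _|n i]; first by rewrite mul1r.
by rewrite normr1 mul1r.
Qed.

Lemma tame_sum (T : Type) (r : seq T) k om (f : T -> I -> 'rV[R]_d -> R) :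
  (forall n i, 0 <= om n i) -> (forall t, tame k om (f t)) ->
  tame k om (fun i x => \sum_(t <- r) f t i x).
Proof.
move=> om0 tf; elim: r => [|t r IHr].
  apply: tame_ext (_ : tame k om (fun _ _ => 0)) => [i x _|].
    by rewrite big_nil.
  by apply: tame_cst => //; exists 0 => i; rewrite normr0 mul0r.
apply: tame_ext (tameD om0 (tf t) IHr) => i x _.
by rewrite big_cons.
Qed.

(** By the Leibniz rule a derivatives fall on one factor and b on the other, so
submultiplicativity of the weights is all that the product requires. *)
Lemma tameM k om1 om2 om f g :
  (forall n i, 0 <= om1 n i) -> (forall n i, 0 <= om2 n i) ->
  (forall a b i, om1 a i * om2 b i <= om (a + b)%N i) ->
  tame k om1 f -> tame k om2 g -> tame k om (fun i x => f i x * g i x).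
Proof.
move=> om1_ge0 om2_ge0 om12.
have om_ge0 n i : 0 <= om n i.
  by rewrite -[n]addn0; apply: le_trans (om12 _ _ _); exact: mulr_ge0.
have bM (om1' om2' om' : I -> R) f' g' : (forall i, 0 <= om1' i) -> (forall i, 0 <= om2' i) ->
    (forall i, om1' i * om2' i <= om' i) ->
    bounded_by om1' f' -> bounded_by om2' g' -> bounded_by om' (fun i x => f' i x * g' i x).
  move=> p1 p2 p12 [C bf] [D bg]; exists (`|C| * `|D|) => i x Ox; rewrite normrM.
  apply: (@le_trans _ _ ((`|C| * om1' i) * (`|D| * om2' i))).
    apply: ler_pM => //.
      by apply: le_trans (bf _ _ Ox) _; apply: ler_wpM2r => //; exact: ler_norm.
    by apply: le_trans (bg _ _ Ox) _; apply: ler_wpM2r => //; exact: ler_norm.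
  by rewrite mulrACA ler_wpM2l// mulr_ge0.
elim: k om1 om2 om f g om1_ge0 om2_ge0 om12 om_ge0
  => [|k IHk] om1 om2 om f g om1_ge0 om2_ge0 om12 om_ge0 tf tg.
  split=> //; exact: bM (om1_ge0 0) (om2_ge0 0) (om12 0 0) (tame_bounded tf) (tame_bounded tg).
split; first exact: bM (om1_ge0 0) (om2_ge0 0) (om12 0 0) (tame_bounded tf) (tame_bounded tg).
split=> [i x Ox|e].
  by apply: differentiableM; [exact: tame_differentiable tf Ox|exact: tame_differentiable tg Ox].
have pf := tame_partial e tf; have pg := tame_partial e tg.
have om_ge0' n i : 0 <= (om \o succn) n i by exact: om_ge0.
have t1 : tame k (om \o succn) (fun i x => f i x * 'D_(delta_mx 0 e) (g i) x).
  apply: IHk (tameW tf) pg => // [n i|a b i]; first exact: om2_ge0.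
  by rewrite /= -addnS; exact: om12.
have t2 : tame k (om \o succn) (fun i x => 'D_(delta_mx 0 e) (f i) x * g i x).
  apply: IHk pf (tameW tg) => // [n i|a b i]; first exact: om1_ge0.
  by rewrite /= -addSn; exact: om12.
apply: tame_ext (tameD om_ge0' t1 t2) => i x Ox.
rewrite deriveM; first by rewrite addrC [in RHS]addrC mulrC.
  by apply: diff_derivable; exact: tame_differentiable tf Ox.
by apply: diff_derivable; exact: tame_differentiable tg Ox.
Qed.

(** The derivative of 1/f is - f' / f^2: k derivatives of f and of 1/f give k + 1
derivatives of 1/f. *)
Lemma tameV k om f (c : R) : (forall n i, 0 <= om n i) -> (forall i, 1 <= om 0 i) ->
  (forall a b i, om a i * om b i <= om (a + b)%N i) -> 0 < c ->
  (forall i x, O i x -> c <= `|f i x|) ->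
  tame k om f -> tame k om (fun i x => (f i x)^-1).
Proof.
move=> om0 om1 omM c0 cf tf.
have f0 i x : O i x -> f i x != 0.
  by move=> /cf cfx; rewrite -normr_gt0; exact: lt_le_trans cfx.
have bV : bounded_by (om 0) (fun i x => (f i x)^-1).
  exists c^-1 => i x Ox; rewrite normfV.
  apply: (@le_trans _ _ c^-1); first by rewrite lef_pV2 ?posrE ?normr_gt0 ?f0 ?cf.
  by rewrite ler_peMr// invr_ge0 ltW.
elim: k tf => [|k IHk] tf; first by split.
split=> //; split=> [i x Ox|e].
  by apply: differentiableV; [exact: tame_differentiable tf Ox|exact: f0].
have tV := IHk (tameW tf).
have om0' n i : 0 <= (om \o succn) n i by exact: om0.
have t1 := tameM om0 om0 omM tV tV.
have omM' a b i : om a i * (om \o succn) b i <= (om \o succn) (a + b)%N i.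
  by rewrite /= -addnS; exact: omM.
have t2 := tameM om0 om0' omM' t1 (tame_partial e tf).
apply: tame_ext (tameN om0' t2) => i x Ox.
rewrite deriveV ?f0//; last by apply: diff_derivable; exact: tame_differentiable tf Ox.
by rewrite /GRing.scale/= mulNr -invfM -expr2.
Qed.

End Tame.

Section Composition.
Context {R : realType} {I : Type} {d d' : nat}.
Variables (O : I -> set 'rV[R]_d) (V : I -> set 'rV[R]_d').
Implicit Types (om : nat -> I -> R) (y : 'I_d' -> I -> 'rV[R]_d -> R).

(** For functions that are only controlled up to an additive constant, such as
positions and chart coordinates. *)
Definition tame_incr k om (f : I -> 'rV[R]_d -> R) :=
  if k is k'.+1 then
    (forall i x, O i x -> differentiable (f i) x) /\
    forall e : 'I_d, tame O k' (om \o succn) (fun i => 'D_(delta_mx 0 e) (f i))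
  else True.

Lemma tame_incrW k om f : tame_incr k.+1 om f -> tame_incr k om f.
Proof.
by case: k => [//|k] [df pf]; split=> // e; apply: tameW; exact: pf.
Qed.

Lemma tameE k om f : tame O k om f = (bounded_by O (om 0) f /\ tame_incr k om f).
Proof. by case: k. Qed.

(** In each term of the chain rule the inner derivative carries the weight, so
the outer function may have derivatives that are merely bounded, and the inner
one need not be bounded itself. *)
Lemma tame_comp k om y (G : I -> 'rV[R]_d' -> R) :
  (forall i, open (O i)) ->
  (forall n i, 0 <= om n i) -> (forall i, 1 <= om 0 i) ->
  (forall a b i, om a i * om b i <= om (a + b)%N i) ->
  (forall i x, O i x -> V i (\row_c y c i x)) ->
  (forall c, tame_incr k om (y c)) ->
  tame V k (fun _ _ => 1) G ->
  tame O k om (fun i x => G i (\row_c y c i x)).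
Proof.
move=> Oopen om0 om1 omM yV; elim: k G => [|k IHk] G ty tG.
all: have bG : bounded_by O (om 0) (fun i x => G i (\row_c y c i x)).
1,3: have [C bC] := tame_bounded tG; exists `|C| => i x Ox;
  apply: le_trans (bC _ _ (yV _ _ Ox)) _; rewrite mulr1;
  by apply: le_trans (ler_norm C) _; rewrite ler_peMr.
- by split.
have dc i x e (Ox : O i x) := @chain_rule R d d' (G i) (fun c => y c i) x e
  (fun c => (ty c).1 i x Ox) (tame_differentiable tG (yV _ _ Ox)).
split=> //; split=> [i x Ox|e]; first exact: (dc i x 0 Ox).1.
have om0' n i : 0 <= (om \o succn) n i by exact: om0.
apply: (tame_ext Oopen (f := fun i x => \sum_(c <- index_enum _)
   'D_(delta_mx 0 e) (y c i) x * 'D_(delta_mx 0 c) (G i) (\row_c y c i x))).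
  by move=> i x Ox; rewrite (dc i x _ Ox).2.
apply: tame_sum => // c.
apply: (tameM Oopen om0' om0) ((ty c).2 e) (IHk _ _ (tame_partial c tG)) => //.
  by move=> a b i; rewrite /= -addSn; exact: omM.
by move=> c'; exact: tame_incrW.
Qed.

End Composition.

(** * Symmetry of second derivatives *)

Section Schwarz.
Context {R : realType} {d : nat}.
Implicit Types (f : 'rV[R]_d -> R) (x u v : 'rV[R]_d).

Lemma differentiable_translate f a x : differentiable f (x + a) ->
  differentiable (fun y => f (y + a)) x /\
  forall v, 'D_v (fun y => f (y + a)) x = 'D_v f (x + a).
Proof.
move=> df.
have dt : is_diff x (fun y : 'rV[R]_d => y + a) id.
  have -> : (fun y : 'rV[R]_d => y + a) = id + cst a by [].
  by apply: is_diff_eq; rewrite addr0.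
have dft : differentiable (f \o (fun y : 'rV[R]_d => y + a)) x.
  by apply: differentiable_comp.
split=> // v; rewrite -[LHS]/('D_v (f \o (fun y : 'rV[R]_d => y + a)) x).
by rewrite deriveE// diff_comp//= deriveE// diff_val.
Qed.

(** The second difference is a first difference, along t v, of
f (y + t u) - f y; the mean value theorem and the differentiability of the
v-derivative at the single point x evaluate it up to o(t^2). *)
Lemma second_difference f x u v (e : R) : 0 < e ->
  (\forall y \near x, differentiable f y) -> differentiable ('D_v f) x ->
  exists2 r : R, 0 < r & forall t : R, 0 < t < r ->
    `|f (x + t *: u + t *: v) - f (x + t *: u) - f (x + t *: v) + f x
      - t ^+ 2 * 'D_u ('D_v f) x| <= e * t ^+ 2.
Proof.
move=> e0 df dDf; pose M := 2 * (`|u| + `|v|) + 1.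
have M0 : 0 < M by rewrite ltr_wpDl// mulr_ge0// addr_ge0.
have eM : 0 < e / M by rewrite divr_gt0.
have nx : nbhs x (fun y => differentiable f y /\
    `|'D_v f y - 'D_v f x - 'D_(y - x) ('D_v f) x| <= e / M * `|y - x|).
  by apply: filterI df _; exact: differentiable_near.
have /nbhs_ballP[r /= r0 ball_r] := nx.
have {}ball_r y : `|y - x| < r -> differentiable f y /\
    `|'D_v f y - 'D_v f x - 'D_(y - x) ('D_v f) x| <= e / M * `|y - x|.
  by move=> yr; apply: ball_r; rewrite -ball_normE /ball_/= distrC.
exists (r / M) => [|t /andP[t0 tr]]; first by rewrite divr_gt0.
have norm_le (c : R) : 0 <= c <= 1 ->
    `|t *: u + c *: (t *: v)| <= t * (`|u| + `|v|) /\ `|c *: (t *: v)| <= t * (`|u| + `|v|).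
  move=> /andP[c0 c1].
  have cv : `|c *: (t *: v)| <= t * `|v|.
    by rewrite !normrZ (ger0_norm c0) (gtr0_norm t0) ler_piMl// mulr_ge0// ltW.
  split; last by apply: le_trans cv _; rewrite ler_wpM2l ?(ltW t0)// lerDr.
  apply: le_trans (ler_normD _ _) _; rewrite mulrDr lerD//.
  by rewrite normrZ (gtr0_norm t0).
have tM : t * (`|u| + `|v|) < r.
  rewrite -(ltr_pM2r M0) in tr; rewrite divfK ?gt_eqF// in tr.
  apply: le_lt_trans tr; rewrite ler_wpM2l ?(ltW t0)// /M.
  by have := normr_ge0 u; have := normr_ge0 v; lra.
pose psi y := f (y + t *: u) - f y.
have dpsi (c : R) : 0 <= c <= 1 -> differentiable psi (x + c *: (t *: v)) /\
    forall w, 'D_w psi (x + c *: (t *: v)) =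
      'D_w f (x + c *: (t *: v) + t *: u) - 'D_w f (x + c *: (t *: v)).
  move=> /norm_le[n1 n2].
  have d1 : differentiable f (x + c *: (t *: v) + t *: u).
    apply: (ball_r _ _).1; rewrite addrAC [x + _]addrC addrK addrC.
    exact: le_lt_trans n1 tM.
  have d2 : differentiable f (x + c *: (t *: v)).
    by apply: (ball_r _ _).1; rewrite [x + _]addrC addrK; exact: le_lt_trans n2 tM.
  have [d3 D3] := differentiable_translate d1.
  split; first exact: differentiableB.
  by move=> w; rewrite /psi deriveB ?D3//; exact: diff_derivable.
have [c c01 psiE] : exists2 c : R, 0 <= c <= 1 &
    psi (x + t *: v) - psi x = 'D_(t *: v) psi (x + c *: (t *: v)).
  have := @mean_value R d psi x (x + t *: v).
  rewrite [x + t *: v]addrC addrK; apply=> c c01.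
  exact: (dpsi c c01).1.
have D_scale w g y : differentiable g y -> 'D_(t *: w) g y = t * 'D_w g y.
  by move=> dg; rewrite !deriveE// linearZ.
have [d1 D1] := dpsi c c01; have [n1 n2] := norm_le c c01.
have -> : f (x + t *: u + t *: v) - f (x + t *: u) - f (x + t *: v) + f x =
    t * ('D_v f (x + c *: (t *: v) + t *: u) - 'D_v f (x + c *: (t *: v))).
  rewrite -D1 -D_scale// -psiE /psi [x + t *: v + _]addrAC; ring.
set y1 := x + c *: (t *: v) + t *: u; set y2 := x + c *: (t *: v).
have y1x : y1 - x = t *: u + c *: (t *: v) by rewrite /y1 addrAC [x + _]addrC addrK addrC.
have y2x : y2 - x = c *: (t *: v) by rewrite /y2 [x + _]addrC addrK.
have [|_ b1] := ball_r y1; first by rewrite y1x; exact: le_lt_trans tM.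
have [|_ b2] := ball_r y2; first by rewrite y2x; exact: le_lt_trans tM.
have dE : 'D_(y1 - x) ('D_v f) x = t * 'D_u ('D_v f) x + 'D_(y2 - x) ('D_v f) x.
  by rewrite -D_scale// y1x y2x !deriveE// linearD.
have b1' : `|'D_v f y1 - 'D_v f x - 'D_(y1 - x) ('D_v f) x| <= e / M * (t * (`|u| + `|v|)).
  by apply: le_trans b1 _; rewrite ler_wpM2l ?(ltW eM)// y1x.
have b2' : `|'D_v f y2 - 'D_v f x - 'D_(y2 - x) ('D_v f) x| <= e / M * (t * (`|u| + `|v|)).
  by apply: le_trans b2 _; rewrite ler_wpM2l ?(ltW eM)// y2x.
have regroup (a b k p q w : R) :
  w * (a - b) - w ^+ 2 * p = w * ((a - k - (w * p + q)) - (b - k - q)) by ring.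
rewrite (regroup _ _ ('D_v f x) _ ('D_(y2 - x) ('D_v f) x)) -dE.
rewrite normrM (gtr0_norm t0) expr2 mulrCA ler_wpM2l ?(ltW t0)//.
apply: le_trans (ler_normB _ _) _; apply: le_trans (lerD b1' b2') _.
rewrite -mulrDr mulrAC ler_pdivrMr//.
have et : 0 < e * t by rewrite mulr_gt0.
have -> : e * (t * (`|u| + `|v|) + t * (`|u| + `|v|)) = e * t * (2 * (`|u| + `|v|)) by ring.
by rewrite ler_wpM2l ?(ltW et)// /M lerDl.
Qed.

(** The second difference is symmetric in u and v. *)
Lemma schwarz f x u v : (\forall y \near x, differentiable f y) ->
  differentiable ('D_u f) x -> differentiable ('D_v f) x ->
  'D_u ('D_v f) x = 'D_v ('D_u f) x.
Proof.
move=> df du dv; apply/eqP; rewrite -subr_eq0 -normr_le0.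
apply/ler_addgt0Pr => e e0; rewrite add0r; have e20 : 0 < e / 2 by rewrite divr_gt0.
have [r r0 Hr] := second_difference u e20 df dv.
have [s s0 Hs] := second_difference v e20 df du.
pose t := Num.min r s / 2.
have t0 : 0 < t by rewrite divr_gt0// lt_min r0.
have trs : t < Num.min r s by rewrite ltr_pdivrMr// ltr_pMr ?ltr1n// lt_min r0.
move: trs; rewrite lt_min => /andP[tr ts].
have {Hr}b1 := Hr t (introT andP (conj t0 tr)).
have {Hs}b2 := Hs t (introT andP (conj t0 ts)).
have t20 : 0 < t ^+ 2 by rewrite exprn_gt0.
rewrite -(ler_pM2l t20) -{1}(gtr0_norm t20) -normrM.
set A := f (x + _ + _) in b1; set A' := f (x + _ + _) in b2.
have AA : A' = A by rewrite /A /A' addrAC.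
rewrite AA in b2.
have regroup (a b c k p q w : R) :
  w * (p - q) = (a - b - c + k - w * q) - (a - c - b + k - w * p) by ring.
rewrite (regroup A (f (x + t *: v)) (f (x + t *: u)) (f x)).
apply: le_trans (ler_normB _ _) _; apply: le_trans (lerD b2 b1) _.
by rewrite -mulrDl -splitr mulrC.
Qed.

End Schwarz.

(** * Vector-valued functions and iterated partial derivatives *)

Section VectorValued.
Context {R : realType} {d k : nat}.
Implicit Types (f : 'rV[R]_d -> 'rV[R]_k) (x v : 'rV[R]_d).

Lemma differentiable_coords f x :
  (forall c, differentiable (fun z => f z 0 c) x) <-> differentiable f x.
Proof.
split=> [df|df c].
  rewrite (_ : f = fun z => \row_c f z 0 c); first exact: differentiable_row.
  by apply/funext => z; apply/rowP => c; rewrite mxE.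
exact: (differentiable_comp df (differentiable_coord _ 0 c)).
Qed.

Lemma derive_coord f x v c : derivable f x v ->
  'D_v f x 0 c = 'D_v (fun z => f z 0 c) x.
Proof. by move=> df; rewrite derive_mx// mxE. Qed.

Lemma schwarz_vector (V : set 'rV[R]_d) f x u v : open V -> V x ->
  (forall y, V y -> differentiable f y) ->
  (forall y, V y -> differentiable ('D_u f) y) ->
  (forall y, V y -> differentiable ('D_v f) y) ->
  'D_u ('D_v f) x = 'D_v ('D_u f) x.
Proof.
move=> Vopen Vx df du dv.
have Vnear (P : 'rV[R]_d -> Prop) : (forall y, V y -> P y) -> \forall y \near x, P y.
  have Vnbhs : nbhs x V by apply: open_nbhs_nbhs.
  by move=> VP; apply: filterS Vnbhs => y; exact: VP.
have coordD w c : \forall y \near x, 'D_w f y 0 c = 'D_w (fun z => f z 0 c) y.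
  by apply: Vnear => y Vy; rewrite derive_coord//; exact/diff_derivable/df.
have coord_diff w c : (forall y, V y -> differentiable ('D_w f) y) ->
    differentiable ('D_w (fun z => f z 0 c)) x.
  move=> dw; apply: near_eq_differentiable (coordD w c) _.
  by apply: (differentiable_coords _ _).2; exact: dw.
apply/rowP => c.
have partial2 w w' : differentiable ('D_w' f) x ->
    'D_w ('D_w' f) x 0 c = 'D_w ('D_w' (fun z => f z 0 c)) x.
  move=> dw'; rewrite -(near_eq_derive w (coordD w' c)).
  exact: derive_coord (diff_derivable dw').
apply: eq_trans (partial2 u v (dv x Vx)) _.
apply: eq_trans _ (esym (partial2 v u (du x Vx))).
apply: schwarz; [|exact: coord_diff|exact: coord_diff].
by apply: Vnear => y Vy; apply: (differentiable_coords _ _).2; exact: df.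
Qed.

End VectorValued.

Lemma enorm_le_sum (R : realType) d (v : 'rV[R]_d) : enorm v <= \sum_i `|v 0 i|.
Proof.
have s0 : 0 <= \sum_i `|v 0 i| by apply: sumr_ge0.
rewrite /enorm -(ger0_norm s0) -sqrtr_sqr ler_sqrt ?sqr_ge0//.
rewrite expr2 mulr_suml; apply: ler_sum => i _; rewrite -real_normK ?num_real// expr2.
by rewrite ler_wpM2l// (bigD1 i)//= lerDl sumr_ge0.
Qed.

Lemma coord_le_enorm (R : realType) d (v : 'rV[R]_d) i : `|v 0 i| <= enorm v.
Proof.
rewrite /enorm -sqrtr_sqr ler_sqrt ?sumr_ge0// => [|j _]; last exact: sqr_ge0.
by rewrite (bigD1 i)//= lerDl sumr_ge0// => j _; exact: sqr_ge0.
Qed.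

Section IteratedPartials.
Context {R : realType} {d : nat} {W : normedModType R}.
Implicit Types (f : 'rV[R]_d -> W) (l : seq 'I_d).

Definition iter_partial l f : 'rV[R]_d -> W :=
  foldr (fun i f' => 'D_(delta_mx 0 i) f') f l.

(** The directions of the partial derivatives in the order in which mderiv takes
them, outermost first. *)
Definition mderiv_word (a : 'I_d -> nat) : seq 'I_d :=
  flatten [seq nseq (a i) i | i <- enum 'I_d].

Lemma mderivE a f : mderiv a f = iter_partial (mderiv_word a) f.
Proof.
rewrite /mderiv /mderiv_word; elim: (enum _) => [//|i r IHr] /=.
by rewrite /iter_partial foldr_cat -/(iter_partial _ f) -IHr; elim: (a i) => //= n ->.
Qed.

Lemma size_mderiv_word a : size (mderiv_word a) = (\sum_i a i)%N.
Proof.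
rewrite size_flatten /shape -map_comp sumnE big_map big_enum/=.
by apply: eq_bigr => i _; rewrite size_nseq.
Qed.

End IteratedPartials.

Section TameVectors.
Context {R : realType} {I : Type} {d k : nat}.
Variable O : I -> set 'rV[R]_d.
Hypothesis Oopen : forall i, open (O i).
Implicit Types (f : I -> 'rV[R]_d -> 'rV[R]_k) (om : nat -> I -> R).

Lemma tame_vector_partial n om f v c : (forall m i, 0 <= om m i) ->
  (forall c', tame_incr O n.+1 om (fun i z => f i z 0 c')) ->
  tame O n (om \o succn) (fun i z => 'D_v (f i) z 0 c).
Proof.
move=> om0 tf; have om0' m i : 0 <= (om \o succn) m i by exact: om0.
apply: (tame_ext Oopen (f := fun i z => \sum_(e <- index_enum _)
   v 0 e * 'D_(delta_mx 0 e) (fun z => f i z 0 c) z)) => [i z Oz|].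
  rewrite derive_coord; first by rewrite (derive_partials _ ((tf c).1 i z Oz)).
  apply/diff_derivable/differentiable_coords => c'; exact: (tf c').1.
apply: tame_sum => // e.
exact: (tameZ Oopen (c := fun=> v 0 e) om0' (fun _ _ => lexx _) ((tf c).2 e)).
Qed.

Lemma tame_Ck n om f i : (forall m i, 0 <= om m i) ->
  (forall c, tame_incr O n.+1 om (fun i z => f i z 0 c)) ->
  Ck n (O i) (f i).
Proof.
elim: n om f => [|n IHn] om f om0 tf /=.
  move=> z Oz; apply: differentiable_continuous; apply/differentiable_coords => c.
  exact: (tf c).1.
split=> [z Oz|v]; first by apply/differentiable_coords => c; exact: (tf c).1.
apply: (IHn (om \o succn) (fun i => 'D_v (f i))) => [m i'|c]; first exact: om0.
have := tame_vector_partial v c om0 tf.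
by rewrite tameE => -[].
Qed.

(** The induction peels off the innermost derivative: there f is known
componentwise, so taking components commutes with the derivative. *)
Lemma iter_partial_bounded l om f : (forall m i, 0 <= om m i) ->
  (forall c, tame O (size l) om (fun i z => f i z 0 c)) -> forall c,
  bounded_by O (om (size l)) (fun i z => iter_partial l (f i) z 0 c).
Proof.
elim/last_ind: l om f => [|l e IHl] om f om0 tf c; first exact: tame_bounded (tf c).
rewrite size_rcons in tf *; rewrite /iter_partial.
under eq_fun do under eq_fun do rewrite foldr_rcons.
apply: (IHl (om \o succn) (fun i => 'D_(delta_mx 0 e) (f i))) => [m i|c'].
  exact: om0.
apply: tame_vector_partial => // c''.
by have := tf c''; rewrite tameE => -[].
Qed.

(** At least one derivative is taken, hence f need only be controlled up to a
constant. *)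
Lemma mderiv_bounded n om f : (forall m i, 0 <= om m i) -> (0 < n)%N ->
  (forall c, tame_incr O n om (fun i z => f i z 0 c)) ->
  exists C : R, forall i a z, (\sum_j a j)%N = n -> O i z ->
    enorm (mderiv a (f i) z) <= C * om n i.
Proof.
case: n => [//|n] om0 _ tf.
have bw (w : n.+1.-tuple 'I_d) c : exists C : R, forall i z, O i z ->
    `|iter_partial w (f i) z 0 c| <= C * om n.+1 i.
  case: w => w /= sw; case/lastP: w sw => [//|w e] /eqP.
  rewrite size_rcons => -[sw].
  have [C bC] : bounded_by O ((om \o succn) (size w))
      (fun i z => iter_partial w ('D_(delta_mx 0 e) (f i)) z 0 c).
    apply: (@iter_partial_bounded w (om \o succn) (fun i => 'D_(delta_mx 0 e) (f i))).
      by move=> m i; exact: om0.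
    by move=> c'; rewrite sw; apply: tame_vector_partial.
  exists C => i z Oz; rewrite /iter_partial foldr_rcons.
  by have := bC i z Oz; rewrite /= sw.
have [C bC] := choice (fun wc : n.+1.-tuple 'I_d * 'I_k => bw wc.1 wc.2).
exists (\sum_(c < k) \big[Num.max/0]_(w : n.+1.-tuple 'I_d) C (w, c)) => i a z an Oz.
apply: le_trans (enorm_le_sum _) _; rewrite mulr_suml; apply: ler_sum => c _.
have sw : size (mderiv_word a) == n.+1 by rewrite size_mderiv_word an.
rewrite mderivE; apply: le_trans (bC (Tuple sw, c) _ _ Oz) _.
by rewrite ler_wpM2r//; exact: (le_bigmax _ (fun w => C (w, c)) (Tuple sw)).
Qed.

End TameVectors.

(** * Level functions on compact sets, charts with bounded derivatives *)

Lemma compact_bounded_fun (R : realType) d (f : 'rV[R]_d -> R) (A : set 'rV[R]_d) :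
  compact A -> (forall x, A x -> {for x, continuous f}) ->
  exists C : R, forall x, A x -> `|f x| <= C.
Proof.
move=> cA fc; have [->|A0] := eqVneq A set0; first by exists 0.
have A_ne : A !=set0 by exact/set0P.
have nfc : {within A, continuous (fun x => `|f x|)}.
  apply: continuous_in_subspaceT => x /set_mem Ax.
  by apply: continuous_comp; [exact: fc|exact: norm_continuous].
have [c _ fmax] := EVT_max_rV A_ne cA nfc.
by exists `|f c| => x Ax; apply: fmax; exact: mem_set.
Qed.

Lemma Ck_continuous (R : realType) d k (U : set 'rV[R]_d) (f : 'rV[R]_d -> R) x :
  Ck k U f -> U x -> {for x, continuous f}.
Proof.
by case: k => [fc /fc|k [df _] /df /differentiable_continuous].
Qed.

Lemma Ck_compact_tame (R : realType) d k (I : Type) (U K : set 'rV[R]_d)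
    (f : 'rV[R]_d -> R) : compact K -> K `<=` U -> Ck k U f ->
  tame (fun _ : I => K) k (fun _ _ => 1) (fun _ => f).
Proof.
move=> cK KU.
have bf l g : Ck l U g -> bounded_by (fun _ : I => K) (fun=> 1) (fun=> g).
  move=> Cg; have [C bC] := compact_bounded_fun cK (fun x Kx => Ck_continuous Cg (KU x Kx)).
  by exists C => i x Kx; rewrite mulr1; exact: bC.
elim: k f => [|k IHk] f Cf; first by split=> //; exact: bf Cf.
split; first exact: bf Cf.
case: Cf => df Df; split=> [i x Kx|e]; first exact/df/KU.
by apply: IHk; exact: Df.
Qed.

Section Charts.
Context {R : realType} {I : Type} {k : nat}.
Variables (V : I -> set 'rV[R]_2) (g : I -> 'rV[R]_2 -> 'rV[R]_k) (K : nat) (B : R).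
Hypothesis Vopen : forall i, open (V i).
Hypothesis gC : forall i, Ck K (V i) (g i).
Hypothesis gB : forall i (a : 'I_2 -> nat) z, (\sum_j a j <= K)%N -> V i z ->
  enorm (mderiv a (g i) z) <= B.

Let N (p q : nat) i : 'rV[R]_2 -> 'rV[R]_k :=
  iter p (fun f => 'D_(delta_mx 0 0) f) (iter q (fun f => 'D_(delta_mx 0 1) f) (g i)).

Let N_Ck p q i : (p + q <= K)%N -> Ck (K - (p + q)) (V i) (N p q i).
Proof.
elim: p => [|p IHp].
  rewrite add0n; elim: q => [|q IHq] qK; first by rewrite subn0; exact: gC.
  have := IHq (ltnW qK); rewrite -[(K - q)%N]prednK ?subn_gt0// -subnS.
  by move=> -[_]; exact.
rewrite addSn => pK; have := IHp (ltnW pK).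
rewrite -[(K - (p + q))%N]prednK ?subn_gt0// -subnS.
by move=> -[_]; exact.
Qed.

Let N_diff p q i z : (p + q < K)%N -> V i z -> differentiable (N p q i) z.
Proof.
move=> pqK; have := N_Ck i (ltnW pqK).
rewrite -[(K - (p + q))%N]prednK ?subn_gt0// => -[dN _]; exact: dN.
Qed.

Let N_partial1 p q i z : (p + q < K)%N -> V i z ->
  'D_(delta_mx 0 1) (N p q i) z = N p q.+1 i z.
Proof.
elim: p z => [//|p IHp] z pqK Vz.
rewrite [LHS](@schwarz_vector _ _ _ (V i) (N p q i) z).
- rewrite [RHS]/(N p.+1 q.+1 i z) /N /=; apply: near_eq_derive.
  by apply: near_open (Vopen) _ _ _ Vz _ => y Vy; apply: IHp => //; exact: ltnW.
- exact: Vopen.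
- exact: Vz.
- by move=> y Vy; apply: N_diff => //; exact: ltnW.
- move=> y Vy.
  apply: (differentiable_coords _ _).1 => c.
  have dN := @N_diff p q.+1 i y; rewrite addnS in dN; have {}dN := dN pqK Vy.
  apply: near_eq_differentiable ((differentiable_coords _ _).2 dN c).
  apply: near_open (Vopen) _ _ _ Vy _ => y' Vy'; rewrite IHp//; exact: ltnW.
- by move=> y Vy; apply: (@N_diff p.+1).
Qed.

(** The hypothesis bounds the partial derivatives in one order only, all those in
the direction 1 being taken first; Schwarz's theorem brings every other order
to this one. *)
Lemma chart_tame c : tame V K (fun _ _ => 1) (fun i z => g i z 0 c).
Proof.
have NB p q i z : (p + q <= K)%N -> V i z -> `|N p q i z 0 c| <= B.
  move=> pqK Vz; pose a (j : 'I_2) := if j == 0 then p else q.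
  have -> : N p q i = mderiv a (g i).
    by rewrite /mderiv enum_ordSl enum_ordSl enum_ord0/=.
  by apply: le_trans (coord_le_enorm _ _) (gB _ _) => //; rewrite big_ord_recl big_ord1.
suff H n p q : (p + q + n <= K)%N -> tame V n (fun _ _ => 1) (fun i z => N p q i z 0 c).
  by apply: (H K 0%N 0%N).
have bN p' q' : (p' + q' <= K)%N -> bounded_by V (fun=> 1) (fun i z => N p' q' i z 0 c).
  by move=> pqK; exists B => i z Vz; rewrite mulr1; exact: NB.
elim: n p q => [|n IHn] p q pqn; first by split=> //; apply: bN; lia.
have pqK : (p + q < K)%N by lia.
split; first by apply: bN; lia.
split=> [i z Vz|e].
  by apply: (differentiable_coords _ _).2; exact: N_diff.
have dN i z : V i z -> derivable (N p q i) z (delta_mx 0 e).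
  by move=> Vz; apply: diff_derivable; exact: N_diff.
have [->|->] : e = 0 \/ e = 1 by case: e {dN} => -[|[|//]] e2; [left|right]; exact: val_inj.
  apply: (tame_ext Vopen) (IHn p.+1 q _) => [i z Vz|]; last lia.
  by rewrite -derive_coord//; apply: diff_derivable; exact: N_diff.
apply: (tame_ext Vopen) (IHn p q.+1 _) => [i z Vz|]; last lia.
rewrite -N_partial1//; rewrite -derive_coord//; apply: diff_derivable; exact: N_diff.
Qed.

End Charts.

(** * Differentiability of implicitly defined functions *)

Section ImplicitDifferentiability.
Context {R : realType}.

Lemma differentiable_lipschitz (V W : normedModType R) (f : V -> W) x :
  differentiable f x ->
  exists2 L : R, 0 < L & \forall y \near x, `|f y - f x| <= L * `|y - x|.
Proof.
move=> df; have [L L0 dL] := linear_lipschitz (diff_continuous df).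
exists (L + 1); first by rewrite ltr_wpDr.
have := differentiable_remainder df ltr01; apply: filterS => y /= fy.
rewrite -[f y - f x](subrK ('d f x (y - x))) addrC mulrDl.
by apply: le_trans (ler_normD _ _) _; exact: lerD.
Qed.

Lemma near_lipschitz_continuous (V W : normedModType R) (f : V -> W) x (L : R) :
  0 < L -> (\forall y \near x, `|f y - f x| <= L * `|y - x|) ->
  {for x, continuous f}.
Proof.
move=> L0 fL; apply/cvgrPdist_le => e e0; near=> y.
rewrite distrC; apply: (@le_trans _ _ (L * `|y - x|)); first by near: y.
rewrite -ler_pdivlMl// mulrC; near: y.
apply/nbhs_ballP; exists (e / L) => /=; first by rewrite divr_gt0.
by move=> y; rewrite -ball_normE/= distrC => /ltW.
Unshelve. all: by end_near. Qed.

(** F (Y z) = F (Y x) expands to an equation that is affine in w z, with the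
nonzero slope 'd F (Y x) (b x), up to o(|Y z - Y x|); the Lipschitz bound on w
makes this o(|z - x|), so w is close to the explicit solution. *)
Lemma implicit_weight_differentiable d d' (F : 'rV[R]_d' -> R)
    (P b : 'rV[R]_d -> 'rV[R]_d') (w : 'rV[R]_d -> R) x (L : R) :
  let Y z := P z + w z *: b z in
  differentiable P x -> differentiable b x -> differentiable F (Y x) ->
  (\forall z \near x, F (Y z) = F (Y x)) ->
  (\forall z \near x, `|w z - w x| <= L * `|z - x|) ->
  'd F (Y x) (b x) != 0 ->
  differentiable w x.
Proof.
move=> Y dP db dF FY wL qx0.
pose T : {linear 'rV[R]_d' -> R} := 'd F (Y x).
have dT (f : 'rV[R]_d -> 'rV[R]_d') : differentiable f x -> differentiable (T \o f) x.
  move=> df; apply: differentiable_comp => //.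
  by apply: linear_differentiable => ?; exact: diff_continuous.
pose A z := T (P z - P x + w x *: (b z - b x)).
have dA : differentiable A x.
  apply: (dT (fun z => P z - P x + w x *: (b z - b x))).
  by apply: differentiableD; [apply: differentiableB|apply: differentiableZ; apply: differentiableB].
have dq : differentiable (T \o b) x by exact: dT.
pose g z := w x - A z / T (b z).
have dg : differentiable g x.
  apply: differentiableB => //; apply: differentiableM => //.
  exact: differentiableV.
have [LP LP0 P_lip] := differentiable_lipschitz dP.
have [Lb Lb0 b_lip] := differentiable_lipschitz db.
have q_pos : 0 < `|T (b x)| by rewrite normr_gt0.
have q_near : \forall z \near x, `|T (b x)| / 2 <= `|T (b z)|.
  apply: (cvgr_norm_ge _ (differentiable_continuous dq)).
  by rewrite ltr_pdivrMr// ltr_pMr// ltr1n.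
have b_near : \forall z \near x, `|b z| <= `|b x| + 1.
  by apply: (cvgr_norm_le _ (differentiable_continuous db)); rewrite ltrDl.
pose M := LP + `|w x| * Lb + `|L| * (`|b x| + 1) + 1.
have M0 : 0 < M by rewrite ltr_wpDl// !addr_ge0// ?mulr_ge0// ?addr_ge0// ltW.
have Y_lip : \forall z \near x, `|Y z - Y x| <= M * `|z - x|.
  near=> z.
  have -> : Y z - Y x = (P z - P x) + w x *: (b z - b x) + (w z - w x) *: b z.
    rewrite /Y scalerBr scalerBl opprD.
    by apply/rowP => c; rewrite !mxE; ring.
  apply: le_trans (ler_normD _ _) _.
  have n1 : `|P z - P x + w x *: (b z - b x)| <= (LP + `|w x| * Lb) * `|z - x|.
    apply: le_trans (ler_normD _ _) _; rewrite mulrDl lerD//; first by near: z.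
    by rewrite normrZ -mulrA ler_wpM2l//; near: z.
  have n2 : `|(w z - w x) *: b z| <= `|L| * (`|b x| + 1) * `|z - x|.
    rewrite normrZ mulrAC ler_pM//; last by near: z.
    apply: (@le_trans _ _ (L * `|z - x|)); first by near: z.
    by rewrite ler_wpM2r// ler_norm.
  by apply: le_trans (lerD n1 n2) _; rewrite -mulrDl ler_wpM2r// lerDl.
apply: (approx_differentiable (g := g)) => //.
  by rewrite /g /A !subrr scaler0 addr0 linear0 mul0r subr0.
move=> e e0.
have e'0 : 0 < e * (`|T (b x)| / 2) / M by rewrite divr_gt0// mulr_gt0// divr_gt0.
have := differentiable_remainder dF e'0 => F_near.
have Y_cont := near_lipschitz_continuous M0 Y_lip.
have {}F_near := Y_cont _ F_near.
near=> z.
have FYz : F (Y z) = F (Y x) by near: z.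
have remainder : `|F (Y z) - F (Y x) - T (Y z - Y x)| <=
   e * (`|T (b x)| / 2) / M * `|Y z - Y x| by near: z.
have Yz : `|Y z - Y x| <= M * `|z - x| by near: z.
have qz : `|T (b x)| / 2 <= `|T (b z)| by near: z.
have qz0 : T (b z) != 0 by rewrite -normr_gt0; apply: lt_le_trans qz; rewrite divr_gt0.
rewrite FYz subrr sub0r normrN in remainder.
have TY : T (Y z - Y x) = A z + (w z - w x) * T (b z).
  rewrite /A -[(w z - w x) * _]/((w z - w x) *: (T (b z) : R^o)) -linearZ -linearD.
  congr (T _); rewrite /Y scalerBr scalerBl opprD.
  by apply/rowP => c; rewrite !mxE; ring.
have -> : w z - g z = T (Y z - Y x) / T (b z).
  rewrite TY /g; field.
  exact: qz0.
rewrite normrM normfV ler_pdivrMr ?normr_gt0//.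
apply: le_trans remainder _.
apply: le_trans (ler_wpM2l (ltW e'0) Yz) _.
rewrite mulrA divfK ?gt_eqF// mulrAC ler_wpM2l//.
by rewrite mulr_ge0// ltW.
Unshelve. all: by end_near. Qed.

(** The injectivity of 'd g turns continuity of s into a Lipschitz bound, because
the remainder of g can be absorbed; a left inverse of 'd g then compares s with
an affine image of Y. *)
Lemma implicit_chart_differentiable d k k' (g : 'rV[R]_k -> 'rV[R]_k')
    (s : 'rV[R]_d -> 'rV[R]_k) (Y : 'rV[R]_d -> 'rV[R]_k') x (B : R) :
  {for x, continuous s} -> differentiable Y x -> differentiable g (s x) ->
  (\forall z \near x, g (s z) = Y z) ->
  (forall v, `|v| <= B * `|'d g (s x) v|) ->
  differentiable s x.
Proof.
move=> sc dY dg gY dg_inj.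
pose D : {linear 'rV[R]_k -> 'rV[R]_k'} := 'd g (s x).
pose B' := `|B| + 1; have B'0 : 0 < B' by rewrite ltr_wpDl.
have {}dg_inj v : `|v| <= B' * `|D v|.
  apply: le_trans (dg_inj v) _; rewrite ler_wpM2r// /B'.
  by rewrite (le_trans (ler_norm B))// lerDl.
pose J := lin1_mx D; have JD v : v *m J = D v by rewrite mul_rV_lin1.
have Jfree : row_free J.
  rewrite -kermx_eq0; apply/rowV0P => v /sub_kermxP; rewrite JD => Dv0.
  apply/eqP; rewrite -normr_le0; apply: le_trans (dg_inj v) _.
  by rewrite Dv0 normr0 mulr0.
pose P : 'M[R]_(k', k) := pinvmx J.
have P_lin c : exists2 C : R, 0 < C & forall v : 'rV[R]_k', `|(v *m P) 0 c| <= C * `|v|.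
  exists (\sum_j `|P j c| + 1); first by rewrite ltr_wpDl// sumr_ge0.
  move=> v; rewrite mxE mulrDl; apply: le_trans (ler_norm_sum _ _ _) _.
  apply: (@le_trans _ _ ((\sum_j `|P j c|) * `|v|)); last by rewrite lerDl mul1r.
  rewrite mulr_suml; apply: ler_sum => j _; rewrite normrM mulrC ler_wpM2l//.
  exact: coord_norm_le.
have [LY LY0 Y_lip] := differentiable_lipschitz dY.
have gYx : g (s x) = Y x by exact: nbhs_singleton gY.
have remainder e : 0 < e -> \forall z \near x,
    `|Y z - Y x - D (s z - s x)| <= e * `|s z - s x|.
  move=> e0; have := sc _ (differentiable_remainder dg e0).
  apply: filterS2 gY => z /= gYz; by rewrite gYz gYx.
have s_lip : \forall z \near x, `|s z - s x| <= 2 * B' * LY * `|z - x|.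
  have e0 : 0 < (2 * B')^-1 by rewrite invr_gt0 mulr_gt0.
  near=> z.
  have r : `|Y z - Y x - D (s z - s x)| <= (2 * B')^-1 * `|s z - s x|.
    by near: z; exact: remainder.
  have Yz : `|Y z - Y x| <= LY * `|z - x| by near: z.
  have Dle : `|D (s z - s x)| <= LY * `|z - x| + (2 * B')^-1 * `|s z - s x|.
    rewrite -[D _](subKr (Y z - Y x)); apply: le_trans (ler_normB _ _) _.
    exact: lerD.
  have := le_trans (dg_inj (s z - s x)) (ler_wpM2l (ltW B'0) Dle).
  have halve (a b : R) : B' * (a + (2 * B')^-1 * b) = B' * a + b / 2.
    by field; rewrite gt_eqF.
  by rewrite halve -!mulrA; lra.
apply/differentiable_coords => c; have [C C0 PC] := P_lin c.
apply: (approx_differentiable (g := fun z => s x 0 c + ((Y z - Y x) *m P) 0 c)).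
- by rewrite subrr mul0mx mxE addr0.
- apply: differentiableD => //.
  have linP : linear (fun v : 'rV[R]_k' => (v *m P) 0 c : R).
    by move=> a u v; rewrite mulmxDl -scalemxAl !mxE.
  pose Pc : {linear 'rV[R]_k' -> R} := HB.pack (fun v : 'rV[R]_k' => (v *m P) 0 c : R)
    (GRing.isLinear.Build R 'rV[R]_k' R *:%R _ linP).
  apply: (@differentiable_comp _ _ _ _ (fun z => Y z - Y x) Pc).
    exact: differentiableB.
  apply: linear_differentiable => u; apply: (near_lipschitz_continuous C0).
  by near=> v; rewrite -linearB; exact: PC.
move=> e e0; pose M := C * (2 * B' * LY).
have M0 : 0 < M by rewrite !mulr_gt0.
have eM : 0 < e / M by rewrite divr_gt0.
near=> z.
have r : `|Y z - Y x - D (s z - s x)| <= e / M * `|s z - s x|.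
  by near: z; exact: remainder.
have sz : `|s z - s x| <= 2 * B' * LY * `|z - x| by near: z.
have -> : s z 0 c - (s x 0 c + ((Y z - Y x) *m P) 0 c) =
    - ((Y z - Y x - D (s z - s x)) *m P) 0 c.
  rewrite [(_ - D _) *m _]mulmxBl -JD -mulmxA mulmxVp// mulmx1 !mxE.
  by ring.
rewrite normrN; apply: le_trans (PC _) _.
apply: le_trans (ler_wpM2l (ltW C0) (le_trans r (ler_wpM2l (ltW eM) sz))) _.
rewrite le_eqVlt; apply/orP; left; apply/eqP.
rewrite /M; field.
by rewrite !gt_eqF.
Unshelve. all: by end_near. Qed.

End ImplicitDifferentiability.

(** * Half-orders *)

Lemma uphalf_add_le m n : (uphalf (m + n) <= uphalf m + uphalf n)%N.
Proof. by rewrite !uphalfE; lia. Qed.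

Section OrderClasses.
Context {R : realType} {I : Type} {d : nat}.
Variables (h : I -> R) (O : I -> set 'rV[R]_d).
Hypothesis h_gt0 : forall i, 0 < h i.
Hypothesis h_le1 : forall i, h i <= 1.
Hypothesis Oopen : forall i, open (O i).
Implicit Types (f g : I -> 'rV[R]_d -> R) (k p q : nat).

(** The exponent is ceil((n + p) / 2): rounding up after the addition is what makes
half-orders additive under products. *)
Definition half_order p : nat -> I -> R := fun n i => h i ^+ uphalf (n + p).

Local Notation ord k p f := (tame O k (half_order p) f).
Local Notation ord_incr k p f := (tame_incr O k (half_order p) f).

Lemma half_order_ge0 p n i : 0 <= half_order p n i.
Proof. by rewrite exprn_ge0// ltW. Qed.
Hint Resolve half_order_ge0 : core.

Lemma half_orderM p q a b i :
  half_order p a i * half_order q b i <= half_order (p + q) (a + b) i.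
Proof.
rewrite /half_order -exprD addnACA; apply: ler_wiXn2l => //; first exact/ltW.
exact: uphalf_add_le.
Qed.

Lemma half_orderW p q n i : (q <= p)%N -> half_order p n i <= half_order q n i.
Proof.
move=> qp; apply: ler_wiXn2l => //; first exact/ltW.
by rewrite uphalf_leq// leq_add2l.
Qed.

Lemma half_orderS p : half_order p \o succn = half_order p.+1.
Proof. by apply/funext => n; apply/funext => i; rewrite /half_order /= addnS. Qed.

Lemma half_order2 p n i : half_order p.+2 n i = h i * half_order p n i.
Proof. by rewrite /half_order !addnS /= exprS. Qed.

Lemma ordW k p q f : (q <= p)%N -> ord k p f -> ord k q f.
Proof.
move=> qp; apply: (tame_weight Oopen (C := 1)) => // n i.
by rewrite mul1r half_orderW.
Qed.

Lemma ordM k p q f g : ord k p f -> ord k q g ->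
  ord k (p + q) (fun i z => f i z * g i z).
Proof. by apply: tameM => // a b i; exact: half_orderM. Qed.

Lemma ordV k f (c : R) : 0 < c -> (forall i z, O i z -> c <= `|f i z|) ->
  ord k 0 f -> ord k 0 (fun i z => (f i z)^-1).
Proof.
move=> c0 cf; apply: (tameV Oopen (c := c)) => // a b i.
by have := half_orderM 0 0 a b i.
Qed.

Lemma ord_incrE k p f : ord_incr k.+1 p f =
  ((forall i z, O i z -> differentiable (f i) z) /\
   forall e, ord k p.+1 (fun i => 'D_(delta_mx 0 e) (f i))).
Proof. by rewrite /tame_incr half_orderS. Qed.

Lemma ord_cst k p (c : I -> R) (C : R) :
  (forall i, `|c i| <= C * h i ^+ uphalf p) -> ord k p (fun i _ => c i).
Proof. by move=> cC; apply: tame_cst => //; exists C => i; exact: cC. Qed.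

Lemma ord_divh k p f : ord k p.+2 f -> ord k p (fun i z => (h i)^-1 * f i z).
Proof.
apply: (tameZ Oopen (C := 1)) => // n i; rewrite half_order2 mul1r.
by rewrite gtr0_norm ?invr_gt0// mulKf// gt_eqF.
Qed.

Lemma ord_incr_cst k p f (c : I -> R) : ord_incr k p f ->
  ord_incr k p (fun i z => c i + f i z).
Proof.
case: k => [//|k]; rewrite !ord_incrE => -[df pf]; split=> [i z Oz|e].
  by apply: differentiableD; [exact: differentiable_cst|exact: df].
apply: (tame_ext Oopen) (pf e) => i z Oz.
rewrite -[RHS]/('D_(delta_mx 0 e) (cst (c i) + f i) z) deriveD//.
  by rewrite derive_cst add0r.
exact/diff_derivable/df.
Qed.

(** Beyond the first derivative there is nothing to bound, which is why the
values and the slopes may be prescribed independently. *)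
Lemma ord_affine k p (a0 : I -> R) (a : I -> 'I_d -> R) (C D : R) :
  (forall i z, O i z -> `|a0 i + \sum_e z 0 e * a i e| <= C * h i ^+ uphalf p) ->
  (forall i e, `|a i e| <= D * h i ^+ uphalf p.+1) ->
  ord k p (fun i z => a0 i + \sum_e z 0 e * a i e) /\
  forall i z, differentiable (fun z : 'rV[R]_d => a0 i + \sum_e z 0 e * a i e) z /\
    forall e, 'D_(delta_mx 0 e) (fun z : 'rV[R]_d => a0 i + \sum_e z 0 e * a i e) z = a i e.
Proof.
move=> bC bD.
have daff i z : differentiable (fun z : 'rV[R]_d => a0 i + \sum_e z 0 e * a i e) z /\
    forall e, 'D_(delta_mx 0 e) (fun z : 'rV[R]_d => a0 i + \sum_e z 0 e * a i e) z = a i e.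
  have -> : (fun z : 'rV[R]_d => a0 i + \sum_e z 0 e * a i e) =
      cst (a0 i) + \sum_(e < d) (fun z : 'rV[R]_d => z 0 e * a i e).
    by apply/funext => y; rewrite !fctE fct_sumE.
  have dc e : differentiable (fun z : 'rV[R]_d => z 0 e * a i e) z.
    by apply: differentiableM => //; exact: differentiable_coord.
  split=> [|e]; first by apply: differentiableD => //; exact: differentiable_sum.
  rewrite deriveD; [|exact: derivable_cst|exact/diff_derivable/differentiable_sum].
  rewrite derive_cst add0r derive_sum => [|e']; last exact/diff_derivable/dc.
  have De e' : 'D_(delta_mx 0 e) (fun z : 'rV[R]_d => z 0 e' * a i e') z = (e' == e)%:R * a i e'.
    have co : derivable (fun z : 'rV[R]_d => z 0 e') z (delta_mx 0 e).
      by apply: diff_derivable; exact: differentiable_coord.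
    rewrite (deriveM co (derivable_cst _ _ _)) derive_cst scaler0 add0r.
    rewrite -[X in _ *: X](derive_coord (f := id)) ?derive_id; last exact: derivable_id.
    by rewrite mxE eqxx/= [LHS]mulrC.
  rewrite (bigD1 e)//= De eqxx mul1r big1 ?addr0// => e' e'e.
  by rewrite De (negbTE e'e) mul0r.
split=> //; case: k => [|k]; first by split=> //; exists C => i z; exact: bC.
split; first by exists C => i z; exact: bC.
split=> [i z _|e]; first exact: (daff i z).1.
rewrite half_orderS; apply: (tame_ext Oopen (f := fun i _ => a i e)).
  by move=> i z _; rewrite (daff i z).2.
by apply: (@ord_cst _ _ _ D) => i; exact: bD.
Qed.

Lemma ord_comp k d' (K : I -> set 'rV[R]_d') (y : 'I_d' -> I -> 'rV[R]_d -> R)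
    (G : I -> 'rV[R]_d' -> R) :
  (forall i z, O i z -> K i (\row_c y c i z)) ->
  (forall c, ord_incr k 1 (y c)) ->
  tame K k (fun _ _ => 1) G ->
  ord k 0 (fun i z => G i (\row_c y c i z)).
Proof.
move=> yK yI; apply: (tame_comp Oopen) => // [a b i|c].
  by have := half_orderM 0 0 a b i.
move: (yI c); case: k {yI} => [//|k]; rewrite !ord_incrE => -[dy py].
by split=> // e; apply: ordW (py e).
Qed.

Lemma ord_comp_incr k d' (K : I -> set 'rV[R]_d') (y : 'I_d' -> I -> 'rV[R]_d -> R)
    (G : I -> 'rV[R]_d' -> R) :
  (forall i z, O i z -> K i (\row_c y c i z)) ->
  (forall c, ord_incr k 1 (y c)) ->
  tame K k (fun _ _ => 1) G ->
  ord_incr k 1 (fun i z => G i (\row_c y c i z)).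
Proof.
move=> yK; case: k => [//|k] yI tG.
have dy c i z : O i z -> differentiable (y c i) z.
  by have := yI c; rewrite ord_incrE => -[dyc _]; exact: dyc.
have chain i z v (Oz : O i z) := @chain_rule R d d' (G i) (fun c => y c i) z v
  (fun c => dy c i z Oz) (tame_differentiable tG (yK _ _ Oz)).
rewrite ord_incrE; split=> [i z Oz|e]; first exact: (chain i z 0 Oz).1.
apply: (tame_ext Oopen (f := fun i z => \sum_(c <- index_enum _)
   'D_(delta_mx 0 e) (y c i) z * 'D_(delta_mx 0 c) (G i) (\row_c y c i z))).
  by move=> i z Oz; rewrite (chain i z _ Oz).2.
apply: tame_sum => // c.
have yIc c' : ord_incr k 1 (y c').
  by apply: tame_incrW; exact: yI.
have := yI c; rewrite ord_incrE => -[_ /(_ e) pyc].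
by have := ordM pyc (ord_comp yK yIc (tame_partial c tG)); rewrite addn0.
Qed.

End OrderClasses.

(** * The cut weight and the cut point *)

Lemma derive_dot (R : realType) d n (f g : 'I_n -> 'rV[R]_d -> R) x v :
  (forall j, differentiable (f j) x) -> (forall j, differentiable (g j) x) ->
  differentiable (fun z => \sum_j f j z * g j z) x /\
  'D_v (fun z => \sum_j f j z * g j z) x =
    \sum_j 'D_v (f j) x * g j x + \sum_j f j x * 'D_v (g j) x.
Proof.
move=> df dg.
have -> : (fun z => \sum_j f j z * g j z) = \sum_(j < n) (f j * g j).
  by apply/funext => z; rewrite fct_sumE.
have dfg j : differentiable (f j * g j) x by exact: differentiableM.
split; first exact: differentiable_sum.
have E := derive_sum (fun j => diff_derivable (v := v) (dfg j)).
apply: (eq_trans E); rewrite -big_split/=; apply: eq_bigr => j _.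
have Ej := deriveM (diff_derivable (v := v) (df j)) (diff_derivable (v := v) (dg j)).
apply: (eq_trans Ej); rewrite /GRing.scale/= addrC.
by congr (_ + _); rewrite mulrC.
Qed.

Lemma derive_cut (R : realType) d (u v w : 'rV[R]_d -> R) z t (a p q r : R) :
  differentiable u z -> differentiable v z -> differentiable w z ->
  'D_t (fun z => r + v z * q - u z * p) z = 'D_t v z * q - 'D_t u z * p /\
  'D_t (fun z => a + (u z * p + w z * (r + v z * q - u z * p))) z =
    (1 - w z) * 'D_t u z * p + w z * 'D_t v z * q + 'D_t w z * (r + v z * q - u z * p).
Proof.
move=> du dv dw.
have Du := derivableP (diff_derivable (v := t) du).
have Dv := derivableP (diff_derivable (v := t) dv).
have Dw := derivableP (diff_derivable (v := t) dw).
have Dcst (k : R) := is_derive_cst k z t.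
have Dvq := is_deriveM Dv (Dcst q); have Dup := is_deriveM Du (Dcst p).
have Db := is_deriveB (is_deriveD (Dcst r) Dvq) Dup.
have Dy := is_deriveD (Dcst a) (is_deriveD Dup (is_deriveM Dw Db)).
case: Db => _ Db; case: Dy => _ Dy.
split; [apply: (eq_trans Db)|apply: (eq_trans Dy)]; rewrite /GRing.scale/= ?fctE /cst.
  by move: ('D_t v z) ('D_t u z) => ? ?; ring.
by move: ('D_t v z) ('D_t u z) ('D_t w z) => ? ? ?; ring.
Qed.

Lemma derive_ratio (R : realType) d (f g : 'rV[R]_d -> R) x v :
  differentiable f x -> differentiable g x -> g x != 0 ->
  'D_v (fun z => f z / g z) x = 'D_v f x / g x - f x * 'D_v g x / g x ^+ 2.
Proof.
move=> df dg gx0.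
have dV := differentiableV dg gx0.
have E := deriveM (diff_derivable (v := v) df) (diff_derivable (v := v) dV).
apply: (eq_trans E); have -> := deriveV gx0 (diff_derivable (v := v) dg).
rewrite /GRing.scale/=.
move: ('D_v f x) ('D_v g x) => a b; by field.
Qed.

(** Solves the derivative of F (Y) = 0 for the derivative of w; the factors 1/k,
with k = h, make numerator and denominator bounded. *)
Lemma solve_weight (R : realType) (W Du Dv Dw q E1 E2 k : R) : k != 0 -> q != 0 ->
  0 = (1 - W) * Du * E1 + W * Dv * E2 + Dw * q ->
  - (((1 - W) * Du * (k^-1 * E1) + W * Dv * (k^-1 * E2)) * (k^-1 * q)^-1) = Dw.
Proof.
move=> k0 q0 E; have -> : Dw = (Dw * q) / q by rewrite mulfK.
have -> : Dw * q = - ((1 - W) * Du * E1 + W * Dv * E2) by lra.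
by field; rewrite q0.
Qed.

Lemma sum_comb3 (R : realType) n (a b c : R) (p q r f : 'I_n -> R) :
  \sum_j (a * p j + b * q j + c * r j) * f j =
  a * (\sum_j p j * f j) + b * (\sum_j q j * f j) + c * (\sum_j r j * f j).
Proof.
by rewrite !mulr_sumr -!big_split/=; apply: eq_bigr => j _; ring.
Qed.

Section CutEstimate.
Context {R : realType} {I : Type} {d : nat}.
Variables (h : I -> R) (O : I -> set 'rV[R]_d).
Hypothesis h_gt0 : forall i, 0 < h i.
Hypothesis h_le1 : forall i, h i <= 1.
Hypothesis Oopen : forall i, open (O i).

Local Notation ord k p f := (tame O k (half_order h p) f).
Local Notation ord_incr k p f := (tame_incr O k (half_order h p) f).
Local Notation affine a0 a := (fun i (z : 'rV[R]_d) => a0 i + \sum_e z 0 e * a i e).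

Let om_ge0 p n i : 0 <= half_order h p n i. Proof. exact: half_order_ge0. Qed.
Let ordm k p q f g := @ordM R I d h O h_gt0 h_le1 Oopen k p q f g.
Let ordc k p c C := @ord_cst R I d h O h_gt0 Oopen k p c C.
Let ordw k p q f := @ordW R I d h O h_gt0 h_le1 Oopen k p q f.

(** The point is the quotient rule n'/s - n s'/s^2: its first term is a constant
over s, its second is (h n) (s'/h) / s^2, of half-order 1. *)
Lemma ratio_ord (n0 s0 : I -> R) (n s : I -> 'I_d -> R) (C c : R) :
  0 < c ->
  (forall i z, O i z -> 0 <= affine n0 n i z <= 1) ->
  (forall i z, O i z -> c <= affine s0 s i z <= 1) ->
  (forall i e, `|n i e| <= C) -> (forall i e, `|s i e| <= C * h i) ->
  forall k, [/\ ord k 1 (fun i z => h i * (affine n0 n i z / affine s0 s i z)),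
    forall i z, O i z -> differentiable (fun z => affine n0 n i z / affine s0 s i z) z &
    forall e, ord k 0 (fun i => 'D_(delta_mx 0 e)
                          (fun z => affine n0 n i z / affine s0 s i z))].
Proof.
move=> c0 n01 s01 nC sC k.
have hn : ord k 1 (fun i z => h i * affine n0 n i z).
  have [] := @ord_affine _ _ _ h O h_gt0 Oopen k 1 (fun i => h i * n0 i)
    (fun i e => h i * n i e) 1 C.
  - move=> i z Oz; under eq_bigr do rewrite mulrCA.
    rewrite -mulr_sumr -mulrDr normrM gtr0_norm// mul1r ler_piMr//; first exact: ltW.
    by have /andP[a0 a1] := n01 i z Oz; rewrite ger0_norm.
  - by move=> i e; rewrite normrM gtr0_norm// mulrC ler_wpM2r// ltW.
  move=> + _; apply: tame_ext => // i z _.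
  by under eq_bigr do rewrite mulrCA; rewrite -mulr_sumr -mulrDr.
have [os ds] : ord k 0 (affine s0 s) /\ forall i z, differentiable (affine s0 s i) z /\
    forall e, 'D_(delta_mx 0 e) (affine s0 s i) z = s i e.
  apply: (@ord_affine _ _ _ h O h_gt0 Oopen k 0 s0 s 1 C) => [i z Oz|//].
  have /andP[a0 a1] := s01 i z Oz; rewrite mul1r expr0 ger0_norm//.
  exact: le_trans (ltW c0) a0.
have s_ge i z : O i z -> c <= `|affine s0 s i z|.
  by move=> /s01 /andP[a0 _]; apply: le_trans a0 (ler_norm _).
have s_ne0 i z : O i z -> affine s0 s i z != 0.
  by move=> Oz; rewrite -normr_gt0; exact: lt_le_trans (s_ge i z Oz).
have oV := ordV h_gt0 h_le1 Oopen c0 s_ge os.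
have dn i z : differentiable (affine n0 n i) z /\
    forall e, 'D_(delta_mx 0 e) (affine n0 n i) z = n i e.
  have [_] := @ord_affine R unit d (fun=> 1) (fun=> set0) (fun=> ltr01) (fun=> open0) 0 0
    (fun=> n0 i) (fun=> n i) 0 (\sum_e `|n i e|) (fun _ _ F => False_ind _ F)
    (fun _ e => ltac:(by rewrite expr1n mulr1 (bigD1 e)//= lerDl sumr_ge0)).
  exact.
split.
- apply: (tame_ext Oopen) (ordm hn oV) => i z _; by rewrite mulrA.
- move=> i z Oz; apply: differentiableM; first exact: (dn i z).1.
  by apply: differentiableV; [exact: (ds i z).1|exact: s_ne0].
- move=> e.
  have on : ord k 0 (fun i _ => n i e).
    by apply: (@ordc _ _ _ C) => i; rewrite expr0 mulr1.
  have oh : ord k 0 (fun i _ => (h i)^-1 * s i e).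
    apply: (@ordc _ _ _ C) => i; rewrite expr0 mulr1 normrM gtr0_norm ?invr_gt0//.
    by rewrite ler_pdivrMl// mulrC.
  have t1 := ordm on oV.
  have t2 := ordw (leq0n _) (ordm (ordm (ordm hn oh) oV) oV).
  apply: (tame_ext Oopen) (tameB Oopen (om_ge0 0) t1 t2) => i z Oz.
  have := derive_ratio (delta_mx 0 e) (dn i z).1 (ds i z).1 (s_ne0 i z Oz).
  move=> /esym/(eq_trans _); apply; rewrite (dn i z).2 (ds i z).2.
  have := s_ne0 i z Oz; set N := n0 i + _; set S := s0 i + _ => S0.
  by field; rewrite S0 gt_eqF.
Qed.

Variables (L0 : I -> 'I_4 -> R) (L : I -> 'I_d -> 'I_4 -> R).
Variables (x : I -> 4.-tuple 'rV[R]_3) (w : I -> 'rV[R]_d -> R).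
Variables (F : 'rV[R]_3 -> R) (K : set 'rV[R]_3) (C c : R).

Let lam a := affine (fun i => L0 i a) (fun i e => L i e a).
Let sig a b := affine (fun i => L0 i a + L0 i b) (fun i e => L i e a + L i e b).
Let u i z := lam 2 i z / sig 0 2 i z.
Let v i z := lam 3 i z / sig 1 3 i z.
Let e1 i : 'rV[R]_3 := tnth (x i) 2 - tnth (x i) 0.
Let e2 i : 'rV[R]_3 := tnth (x i) 3 - tnth (x i) 1.
Let e0 i : 'rV[R]_3 := tnth (x i) 1 - tnth (x i) 0.
Let M i z : 'rV[R]_3 := tnth (x i) 0 + u i z *: e1 i.
Let b i z : 'rV[R]_3 := e0 i + v i z *: e2 i - u i z *: e1 i.
Let Y i z : 'rV[R]_3 := M i z + w i z *: b i z.
Let yc (k : 'I_3) i z := (tnth (x i) 0) 0 k + (u i z * (e1 i) 0 k + w i z * ((e0 i) 0 k + v i z * (e2 i) 0 k - u i z * (e1 i) 0 k)).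

Hypothesis c_gt0 : 0 < c.
Hypothesis lam01 : forall a i z, O i z -> 0 <= lam a i z <= 1.
Hypothesis sig02 : forall i z, O i z -> c <= sig 0 2 i z <= 1.
Hypothesis sig13 : forall i z, O i z -> c <= sig 1 3 i z <= 1.
Hypothesis L_le : forall i e a, `|L i e a| <= C.
Hypothesis L02 : forall i e, `|L i e 0 + L i e 2| <= C * h i.
Hypothesis L13 : forall i e, `|L i e 1 + L i e 3| <= C * h i.
Hypothesis x_le : forall i a a', `|tnth (x i) a - tnth (x i) a'| <= h i.
Hypothesis w01 : forall i z, O i z -> 0 <= w i z <= 1.
Hypothesis w_diff : forall i z, O i z -> differentiable (w i) z.
Hypothesis YK : forall i z, O i z -> K (Y i z).
Hypothesis FY : forall i z, O i z -> F (Y i z) = 0.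
Hypothesis FE1 : forall i z, O i z -> `|'D_(e1 i) F (Y i z)| <= C * h i ^+ 2.
Hypothesis FE2 : forall i z, O i z -> `|'D_(e2 i) F (Y i z)| <= C * h i ^+ 2.
Hypothesis FQ : forall i z, O i z -> 'D_(b i z) F (Y i z) <= - (c * h i).

Let u_ord k : [/\ ord k 1 (fun i z => h i * u i z),
    forall i z, O i z -> differentiable (u i) z &
    forall e, ord k 0 (fun i => 'D_(delta_mx 0 e) (u i))].
Proof.
by apply: (ratio_ord c_gt0 (lam01 2) sig02 (fun i e => L_le i e 2) L02).
Qed.

Let v_ord k : [/\ ord k 1 (fun i z => h i * v i z),
    forall i z, O i z -> differentiable (v i) z &
    forall e, ord k 0 (fun i => 'D_(delta_mx 0 e) (v i))].
Proof.
by apply: (ratio_ord c_gt0 (lam01 3) sig13 (fun i e => L_le i e 3) L13).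
Qed.

Let YE i z : Y i z = \row_k yc k i z.
Proof. by apply/rowP => k; rewrite /Y /M /b /yc /e0 /e1 /e2 !mxE; ring. Qed.

Let edge_ord k a a' (j : 'I_3) :
  ord k 2 (fun i _ => (tnth (x i) a - tnth (x i) a') 0 j).
Proof.
apply: (@ordc _ _ _ 1) => i; rewrite mul1r expr1.
exact: le_trans (coord_norm_le _ _) (x_le i a a').
Qed.

Let edge_ord0 k a a' (j : 'I_3) :
  ord k 0 (fun i _ => (h i)^-1 * (tnth (x i) a - tnth (x i) a') 0 j).
Proof. by apply: (@ord_divh _ _ _ h O h_gt0 Oopen); exact: edge_ord. Qed.

Let uedge_ord k a a' (j : 'I_3) :
  ord k 1 (fun i z => u i z * (tnth (x i) a - tnth (x i) a') 0 j).
Proof.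
have [uo _ _] := u_ord k; have := ordm uo (edge_ord0 k a a' j).
apply: (tame_ext Oopen) => i z _.
by move: (_ 0 j) => r; field; rewrite gt_eqF.
Qed.

Let vedge_ord k a a' (j : 'I_3) :
  ord k 1 (fun i z => v i z * (tnth (x i) a - tnth (x i) a') 0 j).
Proof.
have [vo _ _] := v_ord k; have := ordm vo (edge_ord0 k a a' j).
apply: (tame_ext Oopen) => i z _.
by move: (_ 0 j) => r; field; rewrite gt_eqF.
Qed.

Let bc (j : 'I_3) i z := (e0 i) 0 j + v i z * (e2 i) 0 j - u i z * (e1 i) 0 j.

Let b_ord k j : ord k 1 (bc j).
Proof.
apply: (tameB Oopen (om_ge0 1)); last exact: uedge_ord.
apply: (tameD Oopen (om_ge0 1)); last exact: vedge_ord.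
by apply: (ordw (p := 2)) => //; exact: edge_ord.
Qed.

Let y_incr k j : ord k 0 w -> ord_incr k 1 (yc j).
Proof.
move=> wo; pose f i z := u i z * (e1 i) 0 j + w i z * bc j i z.
apply: (@ord_incr_cst R I d h O Oopen k 1 f (fun i => (tnth (x i) 0) 0 j)).
suff : ord k 1 f by rewrite tameE => -[].
apply: (tameD Oopen (om_ge0 1)); first exact: uedge_ord.
exact: ordm wo (b_ord k j).
Qed.

Variable N : nat.
Hypothesis F_tame : tame (fun _ : I => K) N.+1 (fun _ _ => 1) (fun _ => F).

Let Fy (j : 'I_3) i z := 'D_(delta_mx 0 j) F (\row_k yc k i z).

Let yK i z : O i z -> K (\row_k yc k i z).
Proof. by rewrite -YE; exact: YK. Qed.

Let FyE i z (t : 'rV[R]_3) : O i z -> 'D_t F (Y i z) = \sum_j t 0 j * Fy j i z.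
Proof.
move=> Oz; rewrite YE derive_partials//.
exact: (tame_differentiable F_tame (yK Oz)).
Qed.

Let Fy_ord k j : (k <= N)%N -> ord k 0 w -> ord k 0 (Fy j) /\ ord_incr k 1 (Fy j).
Proof.
move=> kN wo; have tF := tame_le kN (tame_partial j F_tame).
have yi j' := y_incr j' wo.
split; first exact: (ord_comp h_gt0 h_le1 Oopen yK yi tF).
exact: (ord_comp_incr h_gt0 h_le1 Oopen yK yi tF).
Qed.

(** Half-order 3 from a value of size h^2: the derivative is the edge, of
half-order 2, times the derivative of grad F (Y), of half-order 2. *)
Let E_ord k a a' : (k <= N)%N -> ord k 0 w ->
  (forall i z, O i z ->
    `|'D_(tnth (x i) a - tnth (x i) a') F (Y i z)| <= C * h i ^+ 2) ->
  ord k 3 (fun i z => 'D_(tnth (x i) a - tnth (x i) a') F (Y i z)).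
Proof.
move=> kN wo EC; have bE : bounded_by O (half_order h 3 0)
  (fun i z => 'D_(tnth (x i) a - tnth (x i) a') F (Y i z)) by exists C.
apply: (tame_ext Oopen) (_ : ord k 3 (fun i z => \sum_j
    (tnth (x i) a - tnth (x i) a') 0 j * Fy j i z)) => [i z Oz|].
  by rewrite FyE.
rewrite tameE; split.
  by case: bE => D bD; exists D => i z Oz; rewrite -FyE//; exact: bD.
have {wo kN} Fi j := (Fy_ord j kN wo).2.
case: k Fi => [//|k] Fi; rewrite ord_incrE.
have dF j i z : O i z -> differentiable (Fy j i) z.
  by have := Fi j; rewrite ord_incrE => -[dF _]; exact: dF.
have D i z t (Oz : O i z) := derive_dot
  (f := fun j => cst ((tnth (x i) a - tnth (x i) a') 0 j)) (g := fun j => Fy j i) t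
  (fun j => differentiable_cst _ _) (fun j => dF j i z Oz).
split=> [i z Oz|e]; first exact: (D i z 0 Oz).1.
apply: (tame_ext Oopen (f := fun i z => \sum_(j <- index_enum _)
   (tnth (x i) a - tnth (x i) a') 0 j * 'D_(delta_mx 0 e) (Fy j i) z)) => [i z Oz|].
  apply: eq_trans (esym (D i z _ Oz).2).
  rewrite [X in _ = X + _]big1 ?add0r// => j _.
  by rewrite derive_cst mul0r.
apply: (tame_sum Oopen) => // j.
have := Fi j; rewrite ord_incrE => -[_ /(_ e) pF].
exact: ordm (edge_ord k a a' j) pF.
Qed.

Let Q i z := 'D_(b i z) F (Y i z).

Let bE i z j : b i z 0 j = bc j i z.
Proof. by rewrite /b /bc /e0 /e1 /e2 !mxE. Qed.

Let b_derive i z j t : O i z -> differentiable (bc j i) z /\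
  'D_t (bc j i) z = 'D_t (v i) z * (e2 i) 0 j - 'D_t (u i) z * (e1 i) 0 j.
Proof.
move=> Oz; have [_ du _] := u_ord 0; have [_ dv _] := v_ord 0.
split; last exact: (derive_cut _ _ _ _ _ (du i z Oz) (dv i z Oz) (w_diff Oz)).1.
exact: (tame_differentiable (b_ord 1 j) Oz).
Qed.

(** The value of Q is only of half-order 1 a priori.  In its derivative, the terms
where N - M is differentiated are again derivatives of F along the two edges,
hence of half-order 3, and this gives Q half-order 2. *)
Let Q_ord k : (k <= N)%N -> ord k 0 w -> ord k 2 Q.
Proof.
move=> kN wo; have E1o := E_ord kN wo FE1; have E2o := E_ord kN wo FE2.
have Fo j := Fy_ord j kN wo.
have QE i z : O i z -> Q i z = \sum_j bc j i z * Fy j i z.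
  by move=> Oz; rewrite /Q FyE//; apply: eq_bigr => j _; rewrite bE.
apply: (tame_ext Oopen) (_ : ord k 2 (fun i z => \sum_j bc j i z * Fy j i z)) => [i z Oz|].
  by rewrite QE.
have bFo : ord k 1 (fun i z => \sum_j bc j i z * Fy j i z).
  by apply: (tame_sum Oopen) => // j; have := ordm (b_ord k j) (Fo j).1.
rewrite tameE; split.
  have [D bD] := tame_bounded bFo; exists D => i z Oz; exact: bD.
case: k kN wo E1o E2o Fo bFo => [//|k] kN wo E1o E2o Fo bFo; rewrite ord_incrE.
have dF j i z (Oz : O i z) := tame_differentiable (Fo j).1 Oz.
have D i z t (Oz : O i z) := derive_dot
  (f := fun j => bc j i) (g := fun j => Fy j i) t
  (fun j => (b_derive j t Oz).1) (fun j => dF j i z Oz).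
split=> [i z Oz|e]; first exact: (D i z 0 Oz).1.
have [_ _ pu] := u_ord k; have [_ _ pv] := v_ord k.
have t1 := ordm (pv e) (tameW E2o); have t2 := ordm (pu e) (tameW E1o).
have t12 := tameB Oopen (om_ge0 3) t1 t2.
have t3 : ord k 3 (fun i z => \sum_(j <- index_enum _)
    bc j i z * 'D_(delta_mx 0 e) (Fy j i) z).
  apply: (tame_sum Oopen) => // j.
  have := (Fo j).2; rewrite ord_incrE => -[_ /(_ e) pF].
  exact: ordm (b_ord k j) pF.
apply: (tame_ext Oopen) (tameD Oopen (om_ge0 3) t12 t3) => i z Oz.
apply: eq_trans (esym (D i z _ Oz).2); congr (_ + _).
rewrite !FyE// !mulr_sumr -sumrB; apply: eq_bigr => j _.
rewrite (b_derive j _ Oz).2.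
by move: ('D_(delta_mx 0 e) (u i) z) ('D_(delta_mx 0 e) (v i) z) (Fy j i z) => *; ring.
Qed.

(** Each step uses the class of w to place Y, then grad F . e1, grad F . e2 and
grad F . (N - M), and reads off one more derivative of w. *)
Lemma cut_weight_ord k : (k <= N.+1)%N -> ord k 0 w.
Proof.
have bw : bounded_by O (half_order h 0 0) w.
  by exists 1 => i z Oz; have /andP[w0 w1] := w01 Oz; rewrite mul1r ger0_norm// expr0.
elim: k => [|k IHk] kN; first by split.
have kN' : (k <= N)%N by lia.
have wo := IHk (ltnW kN).
rewrite tameE; split=> //; rewrite ord_incrE; split=> [i z Oz|e]; first exact: w_diff.
have E1o := ord_divh h_gt0 Oopen (E_ord kN' wo FE1).
have E2o := ord_divh h_gt0 Oopen (E_ord kN' wo FE2).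
have Qo := ord_divh h_gt0 Oopen (Q_ord kN' wo).
have Q_ge i z : O i z -> c <= `|(h i)^-1 * Q i z|.
  move=> Oz; rewrite normrM gtr0_norm ?invr_gt0// ler_pdivlMl// mulrC.
  by rewrite -normrN (le_trans _ (ler_norm _))// lerNr; exact: FQ.
have Q_ne0 i z : O i z -> Q i z != 0.
  move=> /Q_ge; apply: contraTneq => ->.
  by rewrite mulr0 normr0 -ltNge.
have QV := ordV h_gt0 h_le1 Oopen c_gt0 Q_ge Qo.
have [_ du pu] := u_ord k; have [_ dv pv] := v_ord k.
have one : ord k 0 (fun _ _ => 1).
  by apply: (@ordc _ _ _ 1) => i; rewrite expr0 mulr1 normr1.
have w' := tameB Oopen (om_ge0 0) one wo.
have t1 := ordm (ordm w' (pu e)) E1o; have t2 := ordm (ordm wo (pv e)) E2o.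
have t := tameN Oopen (om_ge0 1) (ordm (tameD Oopen (om_ge0 1) t1 t2) QV).
apply: (tame_ext Oopen) t => i z Oz.
have yd j : differentiable (yc j i) z.
  have := y_incr j wo => _.
  apply: differentiableD => //; apply: differentiableD.
    by apply: differentiableM => //; exact: du.
  by apply: differentiableM; [exact: w_diff|exact: (b_derive j 0 Oz).1].
have := (chain_rule (delta_mx 0 e) yd (tame_differentiable (i := i) F_tame (yK Oz))).2.
have -> : 'D_(delta_mx 0 e) (fun z => F (\row_j yc j i z)) z = 0.
  rewrite -[RHS](@derive_cst _ _ _ (0 : R) z (delta_mx 0 e)).
  apply: near_eq_derive; apply: (near_open Oopen Oz) => y Oy.
  by rewrite -YE FY.
have yD j : 'D_(delta_mx 0 e) (yc j i) z = (1 - w i z) * 'D_(delta_mx 0 e) (u i) z * (e1 i) 0 j +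
    w i z * 'D_(delta_mx 0 e) (v i) z * (e2 i) 0 j + 'D_(delta_mx 0 e) (w i) z * bc j i z.
  exact: (derive_cut _ _ _ _ _ (du i z Oz) (dv i z Oz) (w_diff Oz)).2.
rewrite (eq_bigr _ (fun j _ => congr1 ( *%R^~ _) (yD j))) => E.
apply: (solve_weight _ (Q_ne0 i z Oz)); first by rewrite gt_eqF.
apply: (eq_trans E); apply: eq_trans (sum_comb3 _ _ _ _ _ _ _) _.
rewrite !FyE//; congr (_ + _ * _).
by rewrite /Q FyE//; apply: eq_bigr => j _; rewrite bE.
Qed.

Lemma cut_point_incr k j : (k <= N.+1)%N -> ord_incr k 1 (fun i z => Y i z 0 j).
Proof.
move=> kN; have := y_incr j (cut_weight_ord kN).
have -> // : (fun i z => Y i z 0 j) = yc j.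
by apply/funext => i; apply/funext => z; rewrite YE mxE.
Qed.

End CutEstimate.

(** * Chart coordinates of the cut point *)

(** A quadratic form bounded below by 1/B^2 has determinant at least 1/B^4; the
vector (b, -a) realises the determinant.  Writing B^2 + 1 keeps the bound
meaningful for every B. *)
Lemma gram_det_lower (R : realType) (B a b c : R) :
  (forall s t, s ^+ 2 + t ^+ 2 <= B ^+ 2 * (s ^+ 2 * a + 2 * s * t * b + t ^+ 2 * c)) ->
  ((B ^+ 2 + 1) ^+ 2)^-1 <= a * c - b ^+ 2.
Proof.
move=> H; set D := a * c - b ^+ 2; set b2 := B ^+ 2 in H *.
have b20 : 0 <= b2 by exact: sqr_ge0.
have h1 := H 1 0; have h2 := H b (- a).
have a1 : 1 <= b2 * a by lra.
have a0 : 0 < a.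
  rewrite ltNge; apply/negP => a0; have : b2 * a <= 0 by exact: mulr_ge0_le0.
  by lra.
have aD : a * a <= a * (b2 * D).
  have -> : a * (b2 * D) = b2 * (b ^+ 2 * a + 2 * b * - a * b + (- a) ^+ 2 * c).
    by rewrite /D; ring.
  by apply: le_trans h2; rewrite sqrrN expr2 lerDr sqr_ge0.
have {}aD : a <= b2 * D by rewrite ler_pM2l in aD.
have b2D : 1 <= b2 * (b2 * D) by apply: le_trans a1 _; rewrite ler_wpM2l.
have D0 : 0 <= D.
  rewrite leNgt; apply/negP => D0; have : b2 * (b2 * D) <= 0.
    by rewrite mulr_ge0_le0// mulr_ge0_le0// ltW.
  by lra.
rewrite -[X in X <= _]mul1r ler_pdivrMr; last by rewrite exprn_gt0// ltr_wpDl.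
by have := mulr_ge0 b20 D0; lra.
Qed.

Lemma cramer2 (R : realType) (a b c x y : R) : a * c - b ^+ 2 != 0 ->
  ((x * a + y * b) * c - (x * b + y * c) * b) / (a * c - b ^+ 2) = x /\
  ((x * b + y * c) * a - (x * a + y * b) * b) / (a * c - b ^+ 2) = y.
Proof. by move=> D0; split; field. Qed.

Section ChartEstimate.
Context {R : realType} {I : Type} {d : nat}.
Variables (h : I -> R) (O : I -> set 'rV[R]_d) (V : I -> set 'rV[R]_2).
Hypothesis h_gt0 : forall i, 0 < h i.
Hypothesis h_le1 : forall i, h i <= 1.
Hypothesis Oopen : forall i, open (O i).
Variables (g : I -> 'rV[R]_2 -> 'rV[R]_3) (s : I -> 'rV[R]_d -> 'rV[R]_2).
Variables (Y : I -> 'rV[R]_d -> 'rV[R]_3) (B : R) (N : nat).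
Hypothesis sV : forall i z, O i z -> V i (s i z).
Hypothesis s_diff : forall i z, O i z -> differentiable (s i) z.
Hypothesis gsY : forall i z, O i z -> g i (s i z) = Y i z.
Hypothesis g_tame : forall c, tame V N.+1 (fun _ _ => 1) (fun i y => g i y 0 c).
Hypothesis g_inj : forall i y v, V i y -> enorm v <= B * enorm ('D_v (g i) y).

Local Notation ord k p f := (tame O k (half_order h p) f).
Local Notation ord_incr k p f := (tame_incr O k (half_order h p) f).
Hypothesis Y_incr : forall k j, (k <= N.+1)%N -> ord_incr k 1 (fun i z => Y i z 0 j).

Let om_ge0 p n i : 0 <= half_order h p n i. Proof. exact: half_order_ge0. Qed.
Let ordm k p q f f' := @ordM R I d h O h_gt0 h_le1 Oopen k p q f f'.

Let pg (a : 'I_2) (j : 'I_3) i z :=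
  'D_(delta_mx 0 a) (fun y => g i y 0 j) (\row_c s i z 0 c).
Let sE i z : \row_c s i z 0 c = s i z. Proof. by apply/rowP => c; rewrite mxE. Qed.
Let G a b i z := \sum_j pg a j i z * pg b j i z.
Let det i z := G 0 0 i z * G 1 1 i z - G 0 1 i z ^+ 2.
Let r e a i z := \sum_j 'D_(delta_mx 0 e) (fun z => Y i z 0 j) z * pg a j i z.

Let pg_ord k a j : (k <= N)%N -> (forall c, ord_incr k 1 (fun i z => s i z 0 c)) ->
  ord k 0 (pg a j).
Proof.
move=> kN si; have := tame_le kN (tame_partial a (g_tame j)).
by apply: (ord_comp h_gt0 h_le1 Oopen) si => i z Oz; rewrite sE; exact: sV.
Qed.

Let G_ord k a b : (k <= N)%N -> (forall c, ord_incr k 1 (fun i z => s i z 0 c)) ->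
  ord k 0 (G a b).
Proof.
move=> kN si; apply: (tame_sum Oopen) => // j.
exact: ordm (pg_ord a j kN si) (pg_ord b j kN si).
Qed.

Let det_ge i z : O i z -> ((B ^+ 2 + 1) ^+ 2)^-1 <= det i z.
Proof.
move=> Oz; apply: gram_det_lower => p q.
pose v : 'rV[R]_2 := \row_a (if a == 0 then p else q).
have := g_inj v (sV Oz).
have DE j : 'D_v (g i) (s i z) 0 j = p * pg 0 j i z + q * pg 1 j i z.
  have dg c : differentiable (fun y => g i y 0 c) (s i z).
    exact: tame_differentiable (g_tame c) (sV Oz).
  rewrite derive_coord; last by apply/diff_derivable/differentiable_coords.
  rewrite (derive_partials _ (dg j)) big_ord_recl big_ord1.
  by rewrite /pg sE !mxE/=; congr (_ + q * 'D_(delta_mx 0 _) _ _); exact: val_inj.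
have vE : \sum_a v 0 a ^+ 2 = p ^+ 2 + q ^+ 2.
  by rewrite big_ord_recl big_ord1 !mxE.
have s0 n (u : 'rV[R]_n) : 0 <= \sum_a u 0 a ^+ 2 by apply: sumr_ge0 => a _; exact: sqr_ge0.
move=> le_v; have {le_v} : enorm v ^+ 2 <= (B * enorm ('D_v (g i) (s i z))) ^+ 2.
  by rewrite lerXn2r// ?nnegrE ?(le_trans _ le_v)// sqrtr_ge0.
rewrite exprMn !sqr_sqrtr// vE; congr (_ <= _ * _).
under eq_bigr do rewrite DE sqrrD !exprMn.
rewrite /G !mulr_sumr -!big_split/=; apply: eq_bigr => j _.
by move: (pg _ _ _ _) (pg _ _ _ _) => *; ring.
Qed.

(** The products of the derivative of Y with the columns of g' are linear in the
derivatives of s, with the Gram matrix as coefficients.  Cramer's rule bounds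
k + 1 derivatives of s by k derivatives of g' (s), that is by k derivatives
of s. *)
Lemma chart_coordinates_incr k c : (k <= N.+1)%N -> ord_incr k 1 (fun i z => s i z 0 c).
Proof.
elim: k c => [//|k IHk] c kN; have kN' : (k <= N)%N by lia.
have si c' := IHk c' (ltnW kN).
have sd c' i z (Oz : O i z) := (differentiable_coords _ _).2 (s_diff Oz) c'.
rewrite ord_incrE; split=> [i z|e]; first exact: sd.
have ro a : ord k 2 (r e a).
  apply: (tame_sum Oopen) => // j.
  have := Y_incr j kN; rewrite ord_incrE => -[_ /(_ e) pY].
  exact: ordm pY (pg_ord a j kN' si).
have Go a b := G_ord a b kN' si.
have c0 : 0 < ((B ^+ 2 + 1) ^+ 2)^-1 by rewrite invr_gt0 exprn_gt0// ltr_wpDl// sqr_ge0.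
have deto : ord k 0 det.
  exact: (tameB Oopen (om_ge0 0) (ordm (Go 0 0) (Go 1 1)) (ordm (Go 0 1) (Go 0 1))).
have det_ge' i z : O i z -> ((B ^+ 2 + 1) ^+ 2)^-1 <= `|det i z|.
  by move=> /det_ge /le_trans; apply; exact: ler_norm.
have det0 i z : O i z -> det i z != 0.
  by move=> Oz; rewrite gt_eqF//; exact: lt_le_trans (det_ge Oz).
have Vo := ordV h_gt0 h_le1 Oopen c0 det_ge' deto.
have rE a i z : O i z -> r e a i z = 
    'D_(delta_mx 0 e) (fun z => s i z 0 0) z * G 0 a i z +
    'D_(delta_mx 0 e) (fun z => s i z 0 1) z * G 1 a i z.
  move=> Oz; rewrite /r /G !mulr_sumr -big_split/=; apply: eq_bigr => j _.
  have dg : differentiable (fun y => g i y 0 j) (\row_c s i z 0 c).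
    by rewrite sE; exact: tame_differentiable (g_tame j) (sV Oz).
  have E := (chain_rule (delta_mx 0 e) (fun c => sd c i z Oz) dg).2.
  rewrite (_ : 'D_(delta_mx 0 e) (fun z => Y i z 0 j) z =
     'D_(delta_mx 0 e) (fun z => g i (\row_c s i z 0 c) 0 j) z); last first.
    apply: near_eq_derive; apply: (near_open Oopen Oz) => y Oy.
    by rewrite sE gsY.
  rewrite E big_ord_recl big_ord1 -!/(pg _ _ _ _).
  rewrite (_ : lift ord0 ord0 = 1); last exact: val_inj.
  by rewrite mulrDl !mulrA.
have G10 i z : G 1 0 i z = G 0 1 i z by apply: eq_bigr => j _; rewrite mulrC.
have [->|->] : c = 0 \/ c = 1 by case: c => -[|[|//]] c2; [left|right]; exact: val_inj.
  have t := ordm (tameB Oopen (om_ge0 2) (ordm (ro 0) (Go 1 1)) (ordm (ro 1) (Go 0 1))) Vo.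
  apply: (tame_ext Oopen) t => i z Oz.
  by rewrite !rE// G10 (cramer2 _ _ (det0 i z Oz)).1.
have t := ordm (tameB Oopen (om_ge0 2) (ordm (ro 1) (Go 0 0)) (ordm (ro 0) (Go 0 1))) Vo.
apply: (tame_ext Oopen) t => i z Oz.
by rewrite !rE// G10 (cramer2 _ _ (det0 i z Oz)).2.
Qed.

End ChartEstimate.

(** * Distances, tubes and Taylor bounds *)

Section EuclideanNorm.
Context {R : realType} {d : nat}.
Implicit Types (v w : 'rV[R]_d) (A : set 'rV[R]_d).

Lemma enorm_ge0 v : 0 <= enorm v. Proof. exact: sqrtr_ge0. Qed.

Lemma enorm0 : enorm (0 : 'rV[R]_d) = 0.
Proof. by rewrite /enorm big1 ?sqrtr0// => i _; rewrite mxE expr0n. Qed.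

Lemma enorm_sqr v : enorm v ^+ 2 = \sum_i v 0 i ^+ 2.
Proof. by rewrite sqr_sqrtr// sumr_ge0// => i _; exact: sqr_ge0. Qed.

Lemma enormZ (t : R) v : enorm (t *: v) = `|t| * enorm v.
Proof.
rewrite /enorm; under eq_bigr do rewrite mxE exprMn.
by rewrite -mulr_sumr sqrtrM ?sqr_ge0// sqrtr_sqr.
Qed.

Lemma norm_le_enorm v : `|v| <= enorm v.
Proof. by apply: row_norm_le => [|i]; [exact: enorm_ge0|exact: coord_le_enorm]. Qed.

Lemma enorm_le_norm v : enorm v <= d%:R * `|v|.
Proof.
apply: le_trans (enorm_le_sum v) _.
apply: (@le_trans _ _ (\sum_(i < d) `|v|)); last by rewrite sumr_const card_ord mulr_natl.
by apply: ler_sum => i _; exact: coord_norm_le.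
Qed.

Lemma cauchy_schwarz v w : `|\sum_i v 0 i * w 0 i| <= enorm v * enorm w.
Proof.
rewrite -(ler_pXn2r (n := 2)) ?nnegrE ?mulr_ge0 ?enorm_ge0//.
rewrite exprMn !enorm_sqr real_normK ?num_real//.
set a := \sum_i v 0 i ^+ 2; set b := \sum_i w 0 i ^+ 2; set c := \sum_i _ * _.
have a0 : 0 <= a by apply: sumr_ge0 => i _; exact: sqr_ge0.
have key : 0 <= a * (a * b - c ^+ 2).
  have -> : a * (a * b - c ^+ 2) = \sum_i (c * v 0 i - a * w 0 i) ^+ 2.
    under eq_bigr do rewrite sqrrB !exprMn.
    rewrite big_split sumrB/= -!mulr_sumr -/a -/b.
    rewrite (_ : \sum_i (c * v 0 i * (a * w 0 i)) *+ 2 = 2 * c * a * c); last first.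
      transitivity (2 * c * a * (\sum_i v 0 i * w 0 i)) => //.
      by rewrite mulr_sumr; apply: eq_bigr => i _; ring.
    by ring.
  by apply: sumr_ge0 => i _; exact: sqr_ge0.
have [a_gt0|a_le0] := ltP 0 a; first by rewrite pmulr_rge0// subr_ge0 in key.
have a_eq0 : a = 0 by apply/eqP; rewrite eq_le a_le0.
have v0 i : v 0 i = 0.
  apply/eqP; rewrite -sqrf_eq0; move/eqP: a_eq0.
  by rewrite psumr_eq0 => [/allP/(_ i)|j _]; [rewrite mem_index_enum => /(_ isT)|exact: sqr_ge0].
rewrite [c]big1 => [|i _]; last by rewrite v0 mul0r.
by rewrite expr0n/= mulr_ge0// sumr_ge0// => i _; exact: sqr_ge0.
Qed.

Lemma dist_ge0 v A : 0 <= dist v A.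
Proof.
rewrite /dist; set S := [set _ | _ in _].
have [->|S0] := eqVneq S set0; first by rewrite inf0.
apply: lb_le_inf; first exact/set0P.
by move=> _ [y _ <-]; exact: enorm_ge0.
Qed.

Lemma dist_le v w A : A w -> dist v A <= enorm (v - w).
Proof.
move=> Aw; apply: ge_inf; last by exists w.
by exists 0 => _ [y _ <-]; exact: enorm_ge0.
Qed.

Lemma dist_near v A (e : R) : A !=set0 -> 0 < e ->
  exists2 w, A w & enorm (v - w) < dist v A + e.
Proof.
move=> [w0 Aw0] e0.
have [|_ [w Aw <-] lew] := @inf_adherent R [set enorm (v - y) | y in A] e e0.
  split; first by exists (enorm (v - w0)), w0.
  by exists 0 => _ [y _ <-]; exact: enorm_ge0.
by exists w.
Qed.

End EuclideanNorm.

Section Tube.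
Context {R : realType} {d : nat}.
Implicit Types (U G : set 'rV[R]_d) (F : 'rV[R]_d -> R).

Lemma compact_tube U G (delta : R) : compact G -> 0 < delta ->
  (forall y, dist y G < delta -> U y) ->
  exists (K : set 'rV[R]_d) (rho : R), [/\ 0 < rho, compact K, K `<=` U &
    forall p y, G p -> `|y - p| <= rho -> K y].
Proof.
move=> cG delta0 GU; pose rho := delta / d.+1%:R.
have rho0 : 0 < rho by rewrite divr_gt0.
pose cball := [set v : 'rV[R]_d | `|v| <= rho].
have cball_compact : compact cball.
  apply: bounded_closed_compact.
    exists rho; split; first exact: num_real.
    by move=> r rr v /= vr; exact: le_trans vr (ltW rr).
  rewrite (_ : cball = closed_ball 0 rho); first exact: closed_ball_closed.
  rewrite closed_ballE//; apply/seteqP.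
  by split=> v; rewrite /closed_ball_/= sub0r normrN.
exists [set pv.1 + pv.2 | pv in G `*` cball], rho; split=> //.
- apply: continuous_compact; last exact: compact_setX.
  by apply: continuous_subspaceT => pv; apply: add_continuous.
- move=> _ [[p v] [/= Gp vr] <-]; apply: GU.
  apply: le_lt_trans (dist_le _ Gp) _; rewrite /= [p + v]addrC addrK.
  apply: le_lt_trans (enorm_le_norm v) _.
  apply: (@le_lt_trans _ _ (d%:R * rho)); first exact: ler_wpM2l.
  by rewrite /rho mulrCA gtr_pMr// ltr_pdivrMr// mul1r ltr_nat.
- by move=> p y Gp yp; exists (p, y - p) => //=; rewrite subrKC.
Qed.

Lemma ball_segment (p y z : 'rV[R]_d) (r t : R) : 0 <= t <= 1 ->
  `|y - p| <= r -> `|z - p| <= r -> `|y + t *: (z - y) - p| <= r.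
Proof.
move=> /andP[t0 t1] yr zr.
have -> : y + t *: (z - y) - p = (1 - t) *: (y - p) + t *: (z - p).
  by apply/rowP => i; rewrite !mxE; ring.
apply: le_trans (ler_normD _ _) _; rewrite !normrZ ger0_norm ?subr_ge0// ger0_norm//.
have s0 : 0 <= 1 - t by rewrite subr_ge0.
have -> : r = (1 - t) * r + t * r by ring.
by apply: lerD; exact: ler_wpM2l.
Qed.

(** All points considered lie in a ball around p contained in K, on which the
second derivatives are bounded; both estimates follow from the mean value
theorem on segments of that ball. *)
Lemma gradient_lipschitz (U K G : set 'rV[R]_d) F (rho : R) :
  Ck 2 U F -> compact K -> K `<=` U ->
  (forall p y, G p -> `|y - p| <= rho -> K y) ->
  exists2 C : R, 0 <= C & forall p r, G p -> 0 <= r <= rho ->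
    (forall y v, `|y - p| <= r -> `|'D_v F y - 'D_v F p| <= C * r * `|v|) /\
    (forall y z, `|y - p| <= r -> `|z - p| <= r ->
      `|F y - F z - 'D_(y - z) F p| <= C * r * `|y - z|).
Proof.
move=> CF cK KU GK.
have tF := Ck_compact_tame unit cK KU CF.
have dF y : K y -> differentiable F y by exact: (tame_differentiable (i := tt) tF).
have tF1 a := tame_partial a tF; have tF2 a b := tame_partial b (tF1 a).
have dF1 a y : K y -> differentiable ('D_(delta_mx 0 a) F) y.
  exact: (tame_differentiable (i := tt) (tF1 a)).
have /choice [C2 bC2] : forall ab : 'I_d * 'I_d, exists C : R, forall y, K y ->
    `|'D_(delta_mx 0 ab.2) ('D_(delta_mx 0 ab.1) F) y| <= C.
  move=> [a b]; have [C bC] := tame_bounded (tF2 a b).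
  by exists C => y Ky; have := bC tt y Ky; rewrite mulr1.
exists (\sum_a \sum_b `|C2 (a, b)|).
  by apply: sumr_ge0 => a _; exact: sumr_ge0.
move=> p r Gp /andP[r0 rrho].
have inK y : `|y - p| <= r -> K y by move=> yr; apply: (GK p) => //; exact: le_trans rrho.
have pr : `|p - p| <= r by rewrite subrr normr0.
have bound v w : `|'D_v F w - 'D_v F p| <= \sum_a \sum_b `|C2 (a, b)| * r * `|v| -> 
   `|'D_v F w - 'D_v F p| <= (\sum_a \sum_b `|C2 (a, b)|) * r * `|v|.
  move=> /le_trans; apply; rewrite -mulrA mulr_suml; apply: ler_sum => a _.
  by rewrite mulr_suml; apply: ler_sum => b _; rewrite mulrA.
have grad_lip y v : `|y - p| <= r -> `|'D_v F y - 'D_v F p| <= (\sum_a \sum_b `|C2 (a, b)|) * r * `|v|.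
  move=> yr; apply: bound.
  rewrite (derive_partials _ (dF _ (inK _ yr))) (derive_partials _ (dF _ (inK _ pr))).
  rewrite -sumrB; apply: le_trans (ler_norm_sum _ _ _) _; apply: ler_sum => a _.
  rewrite -mulrBr normrM mulrC -mulr_suml ler_pM//; last exact: coord_norm_le.
  have [t t01 ->] : exists2 t : R, 0 <= t <= 1 &
    'D_(delta_mx 0 a) F y - 'D_(delta_mx 0 a) F p =
      'D_(y - p) ('D_(delta_mx 0 a) F) (p + t *: (y - p)).
    by apply: (@mean_value _ _ ('D_(delta_mx 0 a) F) p y) => t t01; apply/dF1/inK/ball_segment.
  have Kt : K (p + t *: (y - p)) by apply/inK/ball_segment.
  rewrite (derive_partials _ (dF1 a _ Kt)).
  apply: le_trans (ler_norm_sum _ _ _) _; apply: ler_sum => b _.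
  rewrite normrM mulrC ler_pM//.
    by apply: le_trans (bC2 (a, b) _ Kt) (ler_norm _).
  exact: le_trans (coord_norm_le _ _) yr.
split=> // y z yr zr.
have [t t01 ->] : exists2 t : R, 0 <= t <= 1 & F y - F z = 'D_(y - z) F (z + t *: (y - z)).
  by apply: (@mean_value _ _ F z y) => t t01; apply/dF/inK/ball_segment.
by apply: grad_lip; exact: ball_segment.
Qed.

End Tube.

(** * Level function and distance to the surface *)

Section LinearBounds.
Context {R : realType}.
Implicit Types a b c d e q r s t : R.

Lemma close_sub a b s t e q : `|a - s| <= e -> `|b - t| <= e -> `|s - t| <= q ->
  `|a - b| <= q + 2 * e.
Proof.
rewrite !ler_norml => /andP[? ?] /andP[? ?] /andP[? ?].
by apply/andP; split; lra.
Qed.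

Lemma close_bound a b e q : `|a - b| <= e -> `|a| <= q -> `|b| <= q + e.
Proof. by rewrite !ler_norml => /andP[? ?] /andP[? ?]; apply/andP; split; lra. Qed.

Lemma cross_bound a b d (f : R) s t c q r : `|s| <= q -> `|t| <= q -> `|d - f| <= r ->
  `|b - a - f| <= r -> c <= a -> c <= - b -> 2 * q + 2 * r <= c ->
  s + (- t + d) <= - c.
Proof.
rewrite !ler_norml => /andP[? ?] /andP[? ?] /andP[? ?] /andP[? ?] ? ? ?.
by lra.
Qed.

Lemma positive_near a b s c q r : `|b - a - s| <= r -> `|s| <= q -> c <= a ->
  r + q < c -> 0 < b.
Proof. by rewrite !ler_norml => /andP[? ?] /andP[? ?] ? ?; lra. Qed.

Lemma half_bound a b d t q r : `|- a - t * d| <= r -> `|t * (b - a - d)| <= r ->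
  `|t * (a - - b)| <= q -> `|a * (1 - 2 * t)| <= 2 * r + q.
Proof.
have -> : a * (1 - 2 * t) = - (- a - t * d) + t * (b - a - d) - t * (a - - b) by ring.
rewrite !ler_norml => /andP[? ?] /andP[? ?] /andP[? ?].
by apply/andP; split; lra.
Qed.

Lemma gap_bound a b d c k e q : c <= a -> c <= - b -> `|a - b - d| <= e -> `|d| <= k ->
  k + e <= q -> 2 * c <= q.
Proof. by rewrite !ler_norml => ? ? /andP[? ?] /andP[? ?] ?; lra. Qed.

Lemma lower_near a s e q : `|a - s| <= e -> 2 * q <= s -> e <= q -> q <= a.
Proof. by rewrite ler_norml => /andP[? ?] ? ?; lra. Qed.

Lemma nonpositive_near a b e : `|a - b + 2 * b| <= e -> e <= b -> a <= 0.
Proof. by rewrite ler_norml => /andP[? ?] ?; lra. Qed.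

Lemma gap_le_upper a b e q : a <= e + b -> e <= q -> a - b <= q.
Proof. by move=> ? ?; lra. Qed.

Lemma gap_ge_lower a b s e q : b <= s -> s <= a + e -> e <= q -> - q <= a - b.
Proof. by move=> ? ? ?; lra. Qed.

End LinearBounds.

Lemma derive_grad (R : realType) d (F : 'rV[R]_d -> R) y v : differentiable F y ->
  'D_v F y = \sum_i v 0 i * grad F y 0 i.
Proof.
by move=> dF; rewrite derive_partials//; apply: eq_bigr => i _; rewrite mxE.
Qed.

Lemma derive_le_grad (R : realType) d (F : 'rV[R]_d -> R) y v : differentiable F y ->
  `|'D_v F y| <= enorm (grad F y) * enorm v.
Proof. by move=> dF; rewrite derive_grad// mulrC; exact: cauchy_schwarz. Qed.

Lemma derive_comb (R : realType) d (F : 'rV[R]_d -> R) y (a : R) v w :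
  differentiable F y -> 'D_(a *: v + w) F y = a * 'D_v F y + 'D_w F y.
Proof. by move=> dF; rewrite !deriveE// linearD linearZ. Qed.

Lemma segment_zero (R : realType) d (F : 'rV[R]_d -> R) y z :
  (forall t : R, 0 <= t <= 1 -> differentiable F (y + t *: (z - y))) ->
  0 < F y -> F z < 0 ->
  exists2 t : R, 0 < t < 1 & F (y + t *: (z - y)) = 0.
Proof.
move=> dF Fy Fz; pose p (t : R) := F (y + t *: (z - y)).
have p0 : p 0 = F y by rewrite /p scale0r addr0.
have p1 : p 1 = F z by rewrite /p scale1r subrKC.
have pc : {within `[0, 1], continuous p}.
  apply: derivable_within_continuous => t; rewrite in_itv/= => t01.
  by have [+ _] := is_derive_line (dF t t01); exact.
have [|t] := @IVT R p 0 1 0 ler01 pc.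
  by rewrite p0 p1 ge_min le_max (ltW Fy) (ltW Fz)/= orbT.
rewrite in_itv/= => /andP[t0 t1] pt; exists t => //.
rewrite !lt_neqAle t0 t1 !andbT; apply/andP; split.
  by apply: contra_eq_neq pt => <-; rewrite p0 gt_eqF.
by apply: contra_eq_neq pt => ->; rewrite p1 lt_eqF.
Qed.

Section LevelSurface.
Context {R : realType}.
Variables (U : set 'rV[R]_3) (F : 'rV[R]_3 -> R).
Local Notation G := (level_set U F).

(** Constants of the surface: K is a compact tube of width rho, c0 and C0 bound
the gradient on the surface, CT bounds the variation of the gradient. *)
Definition surface_data (K : set 'rV[R]_3) (rho c0 C0 CT : R) : Prop :=
  [/\ 0 < rho <= 1, 0 < c0, 0 <= CT & forall p, G p ->
   [/\ c0 <= enorm (grad F p) <= C0,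
       forall y, `|y - p| <= rho -> [/\ K y, U y & differentiable F y] &
       forall r, 0 <= r <= rho ->
       (forall y v, `|y - p| <= r -> `|'D_v F y - 'D_v F p| <= CT * r * `|v|) /\
       (forall y z, `|y - p| <= r -> `|z - p| <= r ->
          `|F y - F z - 'D_(y - z) F p| <= CT * r * `|y - z|)]].

Lemma surface_dataP : Ck 2 U F -> closed_level_surface U F ->
  exists K rho c0 C0 CT, [/\ surface_data K rho c0 C0 CT, compact K & K `<=` U].
Proof.
move=> CF [cG _ G0 [delta delta0 GU]].
have [K [rho [rho0 cK KU GK]]] := compact_tube cG delta0 (fun y yd => (GU y yd).1).
have [CT CT0 T] := gradient_lipschitz CF cK KU GK.
have GK0 p : G p -> K p by move=> Gp; apply: (GK p) => //; rewrite subrr normr0 ltW.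
have cont p : G p -> {for p, continuous (fun y => enorm (grad F y) ^+ 2)}.
  move=> /GK0/KU Up; apply: differentiable_continuous.
  rewrite (_ : (fun _ => _) = \sum_i (fun y => 'D_(delta_mx 0 i) F y * 'D_(delta_mx 0 i) F y)).
    apply: differentiable_sum => i.
    by apply: differentiableM; case: CF => _ /(_ (delta_mx 0 i))[dF _]; exact: dF.
  apply/funext => y; rewrite enorm_sqr fct_sumE.
  by apply: eq_bigr => i _; rewrite mxE expr2.
have within_cont : {within G, continuous (fun y => enorm (grad F y) ^+ 2)}.
  by apply: continuous_in_subspaceT => y /set_mem; exact: cont.
have [p0 /set_mem Gp0 min_p0] := EVT_min_rV G0 cG within_cont.
have [p1 _ max_p1] := EVT_max_rV G0 cG within_cont.
have grad0 : 0 < enorm (grad F p0).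
  have d0 : dist p0 G < delta.
    by apply: le_lt_trans (dist_le _ Gp0) _; rewrite subrr enorm0.
  apply: lt_le_trans (norm_le_enorm _); rewrite normr_gt0; exact: (GU _ d0).2.
exists K, (Num.min rho 1), (enorm (grad F p0)), (enorm (grad F p1)), CT.
split=> //; split=> // [|p Gp].
  by rewrite lt_min rho0 ltr01 ge_min lexx orbT.
have min_rho r : r <= Num.min rho 1 -> r <= rho by rewrite le_min => /andP[].
split.
- have p_in : p \in G by exact: mem_set.
  have sqr_le a b : enorm (grad F a) ^+ 2 <= enorm (grad F b) ^+ 2 ->
      enorm (grad F a) <= enorm (grad F b).
    by rewrite ler_sqr ?nnegrE ?enorm_ge0.
  by apply/andP; split; apply: sqr_le; [exact: min_p0|exact: max_p1].
- move=> y /min_rho yp; have Ky := GK p y Gp yp; split=> //; first exact: KU.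
  by case: CF => dF _; exact/dF/KU.
- by move=> r /andP[r0 /min_rho rr]; apply: T; rewrite ?r0.
Qed.

(** A nearly closest point bounds |F y| from above.  For the converse, F decreases
at the rate |grad F(p)|, up to O(h), along the fixed direction of grad F(p), so
the surface is met at distance at most |F y| / |grad F(p)| + O(h^2); no
smoothness of the distance is involved. *)
Lemma abs_level_dist K rho c0 C0 CT : G !=set0 -> surface_data K rho c0 C0 CT ->
  exists h1 C : R, [/\ 0 < h1, 0 <= C & forall h p y, 0 < h <= h1 -> G p -> `|y - p| <= h ->
    `| `|F y| - enorm (grad F p) * dist y G | <= C * h ^+ 2].
Proof.
move=> G0 [/andP[rho0 rho1] c0_gt0 CT0 data].
have [pG GpG] := G0; have [/andP[c0C0 _] _ _] := data pG GpG.
have C0_gt0 : 0 < C0.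
  by have [/andP[? ?] _ _] := data pG GpG; apply: lt_le_trans c0_gt0 _; exact: le_trans c0C0 _.
pose C3 := 3 * C0 + CT; have C3_ge0 : 0 <= C3 by rewrite /C3; lra.
pose C4 := 2 * C3 / c0; have C4_ge0 : 0 <= C4 by rewrite divr_ge0// ?mulr_ge0// ltW.
have p1 : 0 <= CT * (1 + C4) by rewrite mulr_ge0//; lra.
have p2 : 0 <= CT * (1 + C4) * C4 by rewrite mulr_ge0.
have Clow : CT * (1 + C4) * C4 <= C0 + 20 * CT + CT * (1 + C4) * C4 by lra.
have Cup : 20 * CT + C0 <= C0 + 20 * CT + CT * (1 + C4) * C4 by lra.
pose h1 := rho / (5 + C4 + 2 * CT * (1 + C4) / c0).
have den_gt0 : 0 < 5 + C4 + 2 * CT * (1 + C4) / c0.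
  by rewrite !ltr_wpDr// ?divr_ge0 ?mulr_ge0 ?addr_ge0// ltW.
exists h1, (C0 + 20 * CT + CT * (1 + C4) * C4); split.
- by rewrite divr_gt0.
- by lra.
move=> h p y /andP[h_gt0 hh1] Gp yp.
have [/andP[c0N NC0] tube taylor] := data p Gp.
set N := enorm (grad F p) in c0N NC0 *.
have N_gt0 : 0 < N by exact: lt_le_trans c0N.
have h_small : h * (5 + C4 + 2 * CT * (1 + C4) / c0) <= rho.
  by rewrite -ler_pdivlMr.
have hx (a : R) : a <= 5 + C4 + 2 * CT * (1 + C4) / c0 -> h * a <= rho.
  by move=> aB; apply: le_trans h_small; rewrite ler_wpM2l// ltW.
have q_ge0 : 0 <= 2 * CT * (1 + C4) / c0 by rewrite divr_ge0 ?mulr_ge0 ?addr_ge0// ltW.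
have h5 : 5 * h <= rho by rewrite mulrC; apply: hx; lra.
have h_rho : h <= rho by lra.
have h_C4 : h <= (1 + C4) * h by rewrite mulrDl mul1r lerDl mulr_ge0// ltW.
have h_5 : h <= 5 * h by lra.
have h5_ge0 : 0 <= 5 * h by lra.
have hC4 : (1 + C4) * h <= rho by rewrite mulrC; apply: hx; lra.
have h_le1 : h <= 1 by exact: le_trans rho1.
have hCT : CT * ((1 + C4) * h) <= N / 2.
  have : h * (2 * CT * (1 + C4) / c0) <= 1.
    apply: le_trans (_ : rho <= 1) => //; apply: hx; lra.
  rewrite [h * (_ / _)]mulrA ler_pdivrMr// mul1r => ?; lra.
have dFp : differentiable F p by have [] := tube p; rewrite ?subrr ?normr0 ?ltW.
have Fp0 : F p = 0 by case: Gp.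
have DN v : `|'D_v F p| <= N * enorm v by exact: derive_le_grad.
have pp r : 0 <= r -> `|p - p| <= r by rewrite subrr normr0.
have ey : enorm (y - p) <= 3 * h.
  by apply: le_trans (enorm_le_norm _) _; rewrite ler_wpM2l.
have yr r : h <= r -> `|y - p| <= r by move=> hr; exact: le_trans hr.
have Fy_le : `|F y| <= C3 * h.
  have [_ /(_ y p yp (pp h (ltW h_gt0)))] := taylor h (introT andP (conj (ltW h_gt0) h_rho)).
  rewrite Fp0 subr0 => T; have D := DN (y - p).
  have D' : `|'D_(y - p) F p| <= C0 * (3 * h).
    by apply: le_trans D _; apply: ler_pM (ltW N_gt0) (enorm_ge0 _) NC0 ey.
  have T' : CT * h * `|y - p| <= CT * h.
    by rewrite ler_piMr ?mulr_ge0// ?(ltW h_gt0)//; lra.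
  rewrite -[F y](subrK ('D_(y - p) F p)); apply: le_trans (ler_normD _ _) _.
  by apply: le_trans (lerD (le_trans T T') D') _; rewrite /C3; lra.
have hh_gt0 : 0 < h ^+ 2 by rewrite exprn_gt0.
rewrite ler_norml; apply/andP; split.
(* lower bound on |F y|: the sign e selects the direction of descent for |F| *)
  have [Fy0|Fy_ne0] := eqVneq (F y) 0.
    have Gy : G y by split=> //; have [] := tube y (yr rho h_rho).
    have -> : dist y G = 0.
      by apply/eqP; rewrite eq_le dist_ge0 andbT -[X in _ <= X](@enorm0 R 3) -(subrr y) dist_le.
    by rewrite Fy0 normr0 mulr0 subrr oppr_le0; exact: mulr_ge0 (le_trans p2 Clow) (ltW hh_gt0).
  pose e : R := Num.sg (F y).
  have eF : e * F y = `|F y| by rewrite /e normrEsg.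
  have e1 : `|e| = 1 by rewrite normr_sg Fy_ne0.
  have ee : e * e = 1 by rewrite -expr2 sqr_sg Fy_ne0.
  pose nu := N^-1 *: grad F p.
  have nu1 : enorm nu = 1 by rewrite enormZ gtr0_norm ?invr_gt0// mulVf// gt_eqF.
  have Dnu : 'D_nu F p = N.
    rewrite derive_grad// -[RHS](mulKf (lt0r_neq0 N_gt0)) -expr2 /N enorm_sqr mulr_sumr.
    by apply: eq_bigr => i _; rewrite [nu 0 i]mxE -mulrA expr2.
  pose line (t : R) := y - (e * t) *: nu.
  pose t1 := 2 * `|F y| / N.
  have t1_ge0 : 0 <= t1 by apply: divr_ge0 (ltW N_gt0); exact: mulr_ge0.
  have t1_le : t1 <= C4 * h.
    rewrite /t1 ler_pdivrMr// /C4; apply: (@le_trans _ _ (2 * (C3 * h))); first by rewrite ler_wpM2l.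
    have -> : 2 * C3 / c0 * h * N = 2 * (C3 * h) * (N / c0) by ring.
    apply: ler_peMr; last by rewrite (ler_pdivlMr _ _ c0_gt0) mul1r.
    by apply: mulr_ge0 => //; apply: mulr_ge0 C3_ge0 (ltW h_gt0).
  have line_y t : line t - y = (- (e * t)) *: nu by rewrite /line addrC addKr scaleNr.
  have line_e t : 0 <= t -> enorm (line t - y) = t.
    by move=> t0; rewrite line_y enormZ nu1 mulr1 normrN normrM e1 mul1r ger0_norm.
  have line_p t : 0 <= t <= t1 -> `|line t - p| <= (1 + C4) * h.
    move=> /andP[t0 tt1]; rewrite -(subrKA y) mulrDl mul1r addrC.
    apply: le_trans (ler_normD _ _) _; apply: lerD => //.
    by apply: le_trans (norm_le_enorm _) _; rewrite line_e//; exact: le_trans t1_le.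
  have rr : 0 <= (1 + C4) * h <= rho by rewrite hC4 mulr_ge0 ?addr_ge0// ltW.
  have line_T t : 0 <= t <= t1 ->
      `|F (line t) - F y + e * t * N| <= CT * ((1 + C4) * h) * t.
    move=> t01; have [_ T] := taylor _ rr.
    have := T (line t) y (line_p t t01) (yr _ h_C4).
    have -> : 'D_(line t - y) F p = - (e * t * N).
      by rewrite line_y -[_ *: nu]addr0 derive_comb// Dnu derive0 addr0 mulNr.
    rewrite opprK => /le_trans; apply; rewrite ler_wpM2l ?mulr_ge0 ?addr_ge0 ?(ltW h_gt0)//.
    by apply: le_trans (norm_le_enorm _) _; rewrite line_e//; case/andP: t01.
  pose phi (t : R) := e * F (line t).
  have phi0 : phi 0 = `|F y| by rewrite /phi /line mulr0 scale0r subr0.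
  have eT t : 0 <= t <= t1 -> `|phi t - `|F y| + t * N| <= CT * ((1 + C4) * h) * t.
    move=> /line_T; apply: le_trans; rewrite -eF /phi.
    have -> : t * N = e * (e * t * N) by rewrite !mulrA ee mul1r.
    by rewrite -mulrBr -mulrDr normrM e1 mul1r.
  have phi1 : phi t1 <= 0.
    have := eT t1; rewrite t1_ge0 lexx => /(_ isT).
    have -> : t1 * N = 2 * `|F y| by rewrite /t1 divfK// gt_eqF.
    move=> /nonpositive_near; apply; apply: le_trans (ler_wpM2r t1_ge0 hCT) _.
    by rewrite /t1 le_eqVlt; apply/orP; left; apply/eqP; field; rewrite gt_eqF.
  have phic : {within `[0, t1], continuous phi}.
    apply: continuous_in_subspaceT => t /set_mem; rewrite /= in_itv/= => t01.
    have [_ _ dFl] := tube _ (le_trans (line_p t t01) hC4).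
    have dline : differentiable line t.
      apply: (@differentiableB _ _ _ (cst y) (fun t => (e * t) *: nu)) => //.
      apply: (@differentiableZl _ _ _ (fun t => e * t)).
      exact: (@differentiableM _ _ (cst e) id).
    apply: differentiable_continuous.
    apply: (@differentiableM _ _ (cst e) (F \o line)) => //.
    exact: differentiable_comp.
  have [|t] := @IVT R phi 0 t1 0 t1_ge0 phic.
    by rewrite ge_min le_max phi0 normr_ge0 phi1 /= orbT.
  rewrite in_itv/= => t01 phit.
  have Gl : G (line t).
    split; first by have [] := tube _ (le_trans (line_p t t01) hC4).
    by apply/eqP; move/eqP: phit; rewrite mulf_eq0 -normr_eq0 e1 oner_eq0.
  have /andP[t0 tt1] := t01.
  have dist_t : dist y G <= t.
    by apply: le_trans (dist_le _ Gl) _; rewrite -[y - _]opprB -scaleN1r enormZ normrN1 mul1r line_e.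
  apply: (gap_ge_lower (ler_wpM2l (ltW N_gt0) dist_t)
    (e := CT * ((1 + C4) * h) * (C4 * h))); last first.
    have -> : CT * ((1 + C4) * h) * (C4 * h) = CT * (1 + C4) * C4 * h ^+ 2 by ring.
    by apply: ler_wpM2r; [exact: ltW|exact: Clow].
  have := eT t t01; rewrite phit sub0r addrC => /(le_trans (ler_norm _)).
  rewrite lerBlDl mulrC => /le_trans; apply; rewrite lerD2l; apply: ler_wpM2l.
    by apply: mulr_ge0 CT0 _; exact: le_trans (ltW h_gt0) h_C4.
  exact: le_trans t1_le.
(* upper bound on |F y|: the infimum defining the distance is approached within
   h^2, which is as good as attained *)
have [z Gz dz] := dist_near y G0 hh_gt0.
have dyG : dist y G <= 3 * h by exact: le_trans (dist_le _ Gp) ey.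
have hh_le : h ^+ 2 <= h by rewrite expr2 ler_piMr// ltW.
have zy : `|y - z| <= 4 * h.
  apply: le_trans (norm_le_enorm _) _; apply: le_trans (ltW dz) _.
  apply: le_trans (lerD dyG hh_le) _.
  by rewrite (_ : 3 * h + h = 4 * h)//; ring.
have zp : `|z - p| <= 5 * h.
  rewrite -(subrKA y); apply: le_trans (ler_normD _ _) _; rewrite distrC.
  by apply: le_trans (lerD zy yp) _; rewrite (_ : 4 * h + h = 5 * h)//; ring.
have [_ T] := taylor (5 * h) (introT andP (conj h5_ge0 h5)).
have {T} := T y z (yr _ h_5) zp.
have -> : F z = 0 by case: Gz.
rewrite subr0 => T.
have T' : CT * (5 * h) * `|y - z| <= 20 * CT * h ^+ 2.
  rewrite (_ : 20 * CT * h ^+ 2 = CT * (5 * h) * (4 * h)); last by ring.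
  by apply: ler_wpM2l; [exact: mulr_ge0|exact: zy].
have D := DN (y - z).
have D' : N * enorm (y - z) <= N * dist y G + C0 * h ^+ 2.
  apply: le_trans (ler_wpM2l (ltW N_gt0) (ltW dz)) _.
  by rewrite mulrDr lerD2l; apply: ler_wpM2r; [exact: ltW|exact: NC0].
apply: (gap_le_upper (e := (20 * CT + C0) * h ^+ 2)); last first.
  by apply: ler_wpM2r; [exact: ltW|exact: Cup].
rewrite (_ : (20 * CT + C0) * h ^+ 2 + N * dist y G = 20 * CT * h ^+ 2 + (N * dist y G + C0 * h ^+ 2)); last by ring.
rewrite -[F y](subrK ('D_(y - z) F p)); apply: le_trans (ler_normD _ _) _.
by apply: lerD; [exact: le_trans T'|exact: le_trans D'].
Qed.

End LevelSurface.

(** * Simplices *)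

Section Simplices.
Context {R : realType} {d n : nat}.
Implicit Types (x : n.-tuple 'rV[R]_d) (y : 'rV[R]_d).

Lemma hull_tupleP x y : hull x y <-> exists l : 'I_n -> R,
  [/\ forall i, 0 <= l i, \sum_i l i = 1 & y = \sum_i l i *: tnth x i].
Proof.
case: x => s sz /=; case: n / (eqP sz) (sz) => {}sz.
by split=> -[l [l0 l1 ->]]; exists l; split=> //; apply: eq_bigr => i _;
  rewrite (tnth_nth 0).
Qed.

Lemma aff_tupleP x y : aff x y <-> exists l : 'I_n -> R,
  \sum_i l i = 1 /\ y = \sum_i l i *: tnth x i.
Proof.
case: x => s sz /=; case: n / (eqP sz) (sz) => {}sz.
by split=> -[l [l1 ->]]; exists l; split=> //; apply: eq_bigr => i _;
  rewrite (tnth_nth 0).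
Qed.

Lemma affine_free_tuple x (l : 'I_n -> R) : affine_free x ->
  \sum_i l i = 0 -> \sum_i l i *: tnth x i = 0 -> forall i, l i = 0.
Proof.
case: x l => s sz /=; case: n / (eqP sz) (sz) => {}sz l fs l0 lx.
apply: fs => //; rewrite -[RHS]lx; apply: eq_bigr => i _.
by rewrite (tnth_nth 0).
Qed.

Lemma hull_vertex x i : hull x (tnth x i).
Proof.
apply/hull_tupleP; exists (fun j => (j == i)%:R); split=> [j||].
- exact: ler0n.
- by rewrite (bigD1 i)//= eqxx big1 ?addr0// => j /negbTE ->.
- rewrite (bigD1 i)//= eqxx scale1r big1 ?addr0// => j /negbTE ->.
  by rewrite scale0r.
Qed.

Lemma hull_perm x x' : perm_eq x x' -> hull x = hull x'.
Proof.
have sub (s t : n.-tuple 'rV[R]_d) : perm_eq t s -> hull s `<=` hull t.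
  move=> /tuple_permP[p tE] y /hull_tupleP[l [l0 l1 ->]].
  have {}tE : t = [tuple tnth s (p i) | i < n] by exact: val_inj.
  apply/hull_tupleP; exists (fun i => l (p i)); split=> [//||].
    by rewrite -[RHS]l1 [RHS](reindex_inj (@perm_inj _ p)).
  rewrite (reindex_inj (@perm_inj _ p)); apply: eq_bigr => i _.
  by rewrite tE tnth_mktuple.
by move=> xx'; apply/seteqP; split; apply: sub; rewrite // perm_sym.
Qed.

Lemma enorm_le_diam x y z : hull x y -> hull x z -> enorm (y - z) <= diam (hull x).
Proof.
move=> xy xz; apply: ub_le_sup; last by exists (y, z).
pose M := \sum_i `|tnth x i|.
have bd v : hull x v -> `|v| <= M.
  move=> /hull_tupleP[l [l0 l1 ->]]; apply: le_trans (ler_norm_sum _ _ _) _.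
  apply: ler_sum => i _; rewrite normrZ ger0_norm// ler_piMl//.
  by rewrite -l1 (bigD1 i)//= lerDl sumr_ge0.
exists (d%:R * (M + M)) => _ [[v v'] [/= xv xv'] <-].
apply: le_trans (enorm_le_norm _) _; apply: ler_wpM2l => //.
by apply: le_trans (ler_normB _ _) _; apply: lerD; exact: bd.
Qed.

(** Moving from the centre of the inscribed ball by r in the directions v and - v
stays in the simplex, where barycentric coordinates lie between 0 and 1: so the
coordinates of v are at most |v| / (2 r). *)
Lemma shape_regular_bary kappa x (mu : 'I_n -> R) : shape_regular kappa x ->
  \sum_i mu i = 0 -> forall i,
  `|mu i| * diam (hull x) <= `|kappa| * enorm (\sum_i mu i *: tnth x i).
Proof.
move=> [xfree [r [c [r0 dr /aff_tupleP[l [l1 cE]] inball]]]] mu0 i.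
set v := \sum_i _.
have [v0|v_ne0] := eqVneq v 0.
  by rewrite (affine_free_tuple xfree mu0 v0) normr0 mul0r mulr_ge0 ?enorm_ge0.
have ev : 0 < enorm v.
  by apply: lt_le_trans (norm_le_enorm v); rewrite normr_gt0.
pose t := r / enorm v; have t0 : 0 < t by rewrite divr_gt0.
have pt (e : R) : `|e| = 1 -> 0 <= l i + e * t * mu i <= 1.
  move=> e1; have cv : c + (e * t) *: v = \sum_j (l j + e * t * mu j) *: tnth x j.
    rewrite cE /v scaler_sumr -big_split/=; apply: eq_bigr => j _.
    by rewrite scalerDl scalerA.
  have s1 : \sum_j (l j + e * t * mu j) = 1.
    by rewrite big_split/= l1 -mulr_sumr mu0 mulr0 addr0.
  have : hull x (c + (e * t) *: v).
    apply: inball; first by apply/aff_tupleP; eexists; split; [exact: s1|exact: cv].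
    rewrite addrC addKr enormZ normrM e1 mul1r gtr0_norm// divfK// gt_eqF//.
  move=> /hull_tupleP[l' [l'0 l'1 l'E]].
  have E j : l j + e * t * mu j - l' j = 0.
    apply: (@affine_free_tuple x (fun j => l j + e * t * mu j - l' j) xfree).
      by rewrite sumrB s1 l'1 subrr.
    under eq_bigr do rewrite scalerBl.
    by rewrite sumrB -cv -l'E subrr.
  have /eqP := E i; rewrite subr_eq0 => /eqP ->; rewrite l'0/=.
  by rewrite -l'1 (bigD1 i)//= lerDl sumr_ge0.
have /andP[p1 p2] := pt 1 (normr1 _); have /andP[p3 p4] := pt (-1) (normrN1 _).
have tmu : t * `|mu i| <= 1.
  rewrite -{1}(gtr0_norm t0) -normrM ler_norml; apply/andP; split; lra.
have rmu : `|mu i| * r <= enorm v.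
  by move: tmu; rewrite /t mulrAC ler_pdivrMr// mul1r mulrC.
apply: le_trans (ler_wpM2l (normr_ge0 _) dr) _; rewrite mulrCA.
apply: (@le_trans _ _ (`|kappa| * (`|mu i| * r))); last exact: ler_wpM2l.
by rewrite ler_wpM2r ?ler_norm// mulr_ge0// ltW.
Qed.

End Simplices.

Lemma hull_pairP (R : realType) d (a b y : 'rV[R]_d) :
  hull [:: a; b] y <-> exists2 t : R, 0 <= t <= 1 & y = a + t *: (b - a).
Proof.
split=> [/(@hull_tupleP _ _ _ [tuple a; b])[l [l0 l1 ->]]|[t /andP[t0 t1] ->]].
  move: l1; rewrite !big_ord_recl !big_ord0 !addr0 => l1.
  exists (l (lift ord0 ord0)); first by rewrite l0 -l1 lerDr l0.
  rewrite !(tnth_nth 0)/=; have -> : l ord0 = 1 - l (lift ord0 ord0) by rewrite -l1 addrK.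
  by apply/rowP => i; rewrite !mxE; ring.
apply/(@hull_tupleP _ _ _ [tuple a; b]).
exists (fun i => if i == ord0 then 1 - t else t); split=> [i||].
- by case: ifP; rewrite ?subr_ge0.
- by rewrite !big_ord_recl !big_ord0 !addr0/= subrK.
- rewrite !big_ord_recl !big_ord0 !addr0/= !(tnth_nth 0)/=.
  by apply/rowP => i; rewrite !mxE; ring.
Qed.

Lemma diam_le_mesh_size (R : realType) d k (S : seq (k.-tuple 'rV[R]_d)) s :
  s \in S -> diam (hull s) <= mesh_size S.
Proof.
rewrite /mesh_size; elim: S => [//|t S IHS]; rewrite inE big_cons le_max.
by case/orP => [/eqP ->|/IHS ->]; rewrite ?lexx ?orbT.
Qed.

(** * Cut tetrahedra *)

Section CutCells.
Context {R : realType}.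
Local Notation pt := 'rV[R]_3.
Implicit Types (U K : set pt) (F : pt -> R) (x T : 4.-tuple pt).

(** What the analysis needs of a cut tetrahedron.  The surface separates the edges
x0x2 and x1x3, along which F is constant up to O(h^2), and crosses the segments
between them with a slope of size h ([cc_cross]), close to the midpoint on the
four cut edges ([cc_half]); the tetrahedron is not flat ([cc_bary]). *)
Record cut_cell F K (c C h : R) x : Prop := CutCell {
  cc_h_gt0 : 0 < h;
  cc_h_le1 : h <= 1;
  cc_sub : hull x `<=` K;
  cc_diam : forall y z, hull x y -> hull x z -> `|y - z| <= h;
  cc_edge02 : forall y, hull x y -> `|'D_(tnth x 2 - tnth x 0) F y| <= C * h ^+ 2;
  cc_edge13 : forall y, hull x y -> `|'D_(tnth x 3 - tnth x 1) F y| <= C * h ^+ 2;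
  cc_cross : forall u v y, 0 <= u <= 1 -> 0 <= v <= 1 -> hull x y ->
    'D_(tnth x 1 - tnth x 0 + v *: (tnth x 3 - tnth x 1) - u *: (tnth x 2 - tnth x 0)) F y
      <= - (c * h);
  cc_pos : forall u, 0 <= u <= 1 -> 0 < F (tnth x 0 + u *: (tnth x 2 - tnth x 0));
  cc_neg : forall v, 0 <= v <= 1 -> F (tnth x 1 + v *: (tnth x 3 - tnth x 1)) < 0;
  cc_half : forall a b t, (a == 0) || (a == 2) -> (b == 1) || (b == 3) ->
    0 <= t <= 1 -> F (tnth x a + t *: (tnth x b - tnth x a)) = 0 -> `|1 - 2 * t| <= C * h;
  cc_bary : forall mu : 'I_4 -> R, \sum_i mu i = 0 ->
    forall i, `|mu i| * h <= C * enorm (\sum_i mu i *: tnth x i) }.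

Lemma hull_segment x a b (t : R) : 0 <= t <= 1 -> a != b ->
  hull x (tnth x a + t *: (tnth x b - tnth x a)).
Proof.
move=> /andP[t0 t1] ab; apply/hull_tupleP.
exists (fun i => (i == a)%:R * (1 - t) + (i == b)%:R * t); split=> [i||].
- by rewrite addr_ge0// mulr_ge0// subr_ge0.
- rewrite big_split/= -!mulr_suml.
  have one (k : 'I_4) : \sum_i (i == k)%:R = 1 :> R.
    by rewrite (bigD1 k)//= eqxx big1 ?addr0// => i /negbTE ->.
  by rewrite !one !mul1r subrK.
- under eq_bigr do rewrite scalerDl -!scalerA.
  rewrite big_split/=.
  have one (k : 'I_4) (v : 'I_4 -> pt) : \sum_i (i == k)%:R *: v i = v k.
    rewrite (bigD1 k)//= eqxx scale1r big1 ?addr0// => i /negbTE ->.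
    by rewrite scale0r.
  rewrite (one a (fun i => (1 - t) *: tnth x i)) (one b (fun i => t *: tnth x i)).
  by rewrite scalerBl scale1r scalerBr addrAC -addrA.
Qed.

Lemma sdist_abs U F y : `|sdist U F y| = dist y (level_set U F).
Proof. by rewrite /sdist; case: ifP => _; [rewrite normrN|]; exact: ger0_norm (dist_ge0 _ _). Qed.

Lemma shape_regular_bary_perm kappa x T (mu : 'I_4 -> R) : perm_eq x T ->
  shape_regular kappa T -> \sum_i mu i = 0 -> forall i,
  `|mu i| * diam (hull T) <= `|kappa| * enorm (\sum_i mu i *: tnth x i).
Proof.
move=> /tuple_permP[p xE] reg mu0 i.
have {}xE : x = [tuple tnth T (p i) | i < 4] by exact: val_inj.
have s0 : \sum_i mu (p^-1 i)%g = 0.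
  by rewrite -[RHS]mu0 [RHS](reindex_inj (@perm_inj _ p^-1%g)).
have := shape_regular_bary reg s0 (p i); rewrite permK => /le_trans; apply.
rewrite le_eqVlt; apply/orP; left; apply/eqP; congr (_ * enorm _).
rewrite (reindex_inj (@perm_inj _ p)); apply: eq_bigr => k _.
by rewrite permK xE tnth_mktuple.
Qed.

(** With F = |grad F(p)| d + O(h^2), equal distances give equal values of |F| up to
O(h^2), and |d| >= eta h gives |F| >= c h at the vertices.  Taylor expansion at a
point p of the surface in the tetrahedron yields the rest. *)
Lemma admissible_cut_cell U F (J : Type) (Th : J -> seq (4.-tuple pt)) K rho c0 C0 CT :
  level_set U F !=set0 -> surface_data U F K rho c0 C0 CT -> admissible U F Th ->
  exists h0 c C : R, [/\ 0 < h0, 0 < c, 0 <= C & forall j T x, mesh_size (Th j) <= h0 ->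
    T \in Th j -> is_cut U F T -> perm_eq x T ->
    0 < F (tnth x 0) -> 0 < F (tnth x 2) -> F (tnth x 1) < 0 -> F (tnth x 3) < 0 ->
    cut_cell F K c C (mesh_size (Th j)) x].
Proof.
move=> G0 data [kappa [eta [ca [ha [eta0 ha0 adm]]]]].
have [h1 [Cd [h1_gt0 Cd0 lvl]]] := abs_level_dist G0 data.
have [/andP[rho0 rho1] c0_gt0 CT0 {}data] := data.
have C0_gt0 : 0 < C0.
  have [p Gp] := G0; have [/andP[a b] _ _] := data p Gp.
  exact: lt_le_trans c0_gt0 (le_trans a b).
have [c1 c1E] : exists c1, c1 = c0 * eta / 2 by eexists.
have c1_gt0 : 0 < c1 by rewrite c1E divr_gt0// mulr_gt0.
have [Ca CaE] : exists Ca, Ca = C0 * `|ca| + 2 * Cd by eexists.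
have Ca0 : 0 <= Ca by rewrite CaE addr_ge0 ?mulr_ge0// ltW.
have [C CE] : exists C, C = (Ca + 2 * CT) + (2 * CT + Ca) / c1 +
  `|kappa| * (C0 + CT) / (2 * c1) by eexists.
have C_1 : 0 <= (2 * CT + Ca) / c1 by rewrite divr_ge0 ?(ltW c1_gt0)//; lra.
have C_2 : 0 <= `|kappa| * (C0 + CT) / (2 * c1).
  by apply: divr_ge0; [apply: mulr_ge0 => //|]; lra.
pose h0 := Num.min (Num.min ha h1) (Num.min rho (c1 / (Cd + 6 * CT + 2 * Ca + 1))).
have den0 : 0 < Cd + 6 * CT + 2 * Ca + 1 by lra.
have q6 : 6 * CT + 2 * Ca <= Cd + 6 * CT + 2 * Ca + 1 by lra.
have q2 : 2 * CT + Ca + 1 <= Cd + 6 * CT + 2 * Ca + 1 by lra.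
have C0CT : 0 <= C0 + CT by lra.
have c1_2 : 0 < 2 * c1 by rewrite mulr_gt0.
have qd : Cd <= Cd + 6 * CT + 2 * Ca + 1 by lra.
have Ca_C : Ca + 2 * CT <= C by rewrite CE; lra.
have Cb_C : (2 * CT + Ca) / c1 <= C by rewrite CE; lra.
have Cc_C : `|kappa| * (C0 + CT) / (2 * c1) <= C by rewrite CE; lra.
exists h0, c1, C; split=> [|||j T x]; [by rewrite !lt_min ha0 h1_gt0 rho0 divr_gt0|exact: c1_gt0|by lra|].
set h := mesh_size (Th j); rewrite !le_min => /andP[/andP[hha hh1] /andP[hrho hc1]].
move=> TTh [p [Tp Gp]] xT F0 F2 F1 F3.
have [reg novertex eta_le close] := adm j hha T TTh.
have cutT : is_cut U F T by exists p.
have {}eta_le := eta_le cutT; have {}close := close cutT.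
have xTh := hull_perm xT; have xp : hull x p by rewrite xTh.
have diamT : diam (hull x) <= h by rewrite xTh; exact: diam_le_mesh_size.
have small y z : hull x y -> hull x z -> `|y - z| <= h.
  move=> xy xz; apply: le_trans (norm_le_enorm _) _.
  exact: le_trans (enorm_le_diam xy xz) diamT.
have vx a : hull x (tnth x a) by exact: hull_vertex.
have h_ge0 : 0 <= h by apply: le_trans (normr_ge0 _) (small _ _ xp xp).
have h_gt0 : 0 < h.
  rewrite lt_neqAle h_ge0 andbT; apply/negP => /eqP h0E.
  have : tnth x 0 = tnth x 1.
    by apply/eqP; rewrite -subr_eq0 -normr_le0 h0E; exact: small.
  by move=> E; move: F0; rewrite E ltNge (ltW F1).
have h_le1 : h <= 1 by exact: le_trans rho1.
have {hc1} hc1 : h * (Cd + 6 * CT + 2 * Ca + 1) <= c1 by rewrite -ler_pdivlMr.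
have Cdh : 0 <= Cd * h by rewrite mulr_ge0. have CTh : 0 <= CT * h by rewrite mulr_ge0.
have Cah : 0 <= Ca * h by rewrite mulr_ge0.
have hh0 : 0 <= h ^+ 2 by exact: sqr_ge0.
have hhE : h ^+ 2 = h * h by rewrite expr2.
have small_quad (k : R) : k <= Cd + 6 * CT + 2 * Ca + 1 -> k * h ^+ 2 <= c1 * h.
  move=> kle; rewrite hhE mulrA ler_wpM2r//; apply: le_trans hc1.
  by rewrite mulrC ler_wpM2l.
have [/andP[c0N NC0] tube taylor] := data p Gp.
set N := enorm (grad F p) in c0N NC0.
have N0 : 0 < N by exact: lt_le_trans c0N.
have [T1 T2] := taylor h (introT andP (conj h_ge0 hrho)).
have dF y : hull x y -> [/\ K y, U y & differentiable F y].
  by move=> xy; apply: tube; apply: le_trans hrho; exact: small.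
have dFp : differentiable F p by have [] := dF p xp.
have Taylor y z : hull x y -> hull x z -> `|F y - F z - 'D_(y - z) F p| <= CT * h ^+ 2.
  move=> xy xz; apply: le_trans (T2 y z (small _ _ xy xp) (small _ _ xz xp)) _.
  by rewrite expr2 mulrA ler_wpM2l//; exact: small.
have Grad y a b : hull x y ->
    `|'D_(tnth x a - tnth x b) F y - 'D_(tnth x a - tnth x b) F p| <= CT * h ^+ 2.
  move=> xy; apply: le_trans (T1 y _ (small _ _ xy xp)) _.
  by rewrite expr2 mulrA ler_wpM2l//; exact: small.
have xmem a : tnth x a \in T by rewrite -(perm_mem xT) mem_tnth.
pose D a := dist (tnth x a) (level_set U F).
have lvl_a a : `| `|F (tnth x a)| - N * D a| <= Cd * h ^+ 2.
  by apply: lvl => //; [rewrite h_gt0|exact: small].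
have D_ge a : eta * h <= D a by rewrite /D -sdist_abs; exact: eta_le.
have D_close a b : `|D a - D b| <= ca * h ^+ 2.
  by rewrite /D -!(sdist_abs U F); exact: close.
have F_close a b : `| `|F (tnth x a)| - `|F (tnth x b)| | <= Ca * h ^+ 2.
  have : `|N * D a - N * D b| <= C0 * `|ca| * h ^+ 2.
    rewrite -mulrBr normrM gtr0_norm// -mulrA; apply: ler_pM => //; first exact: ltW.
    by apply: le_trans (D_close a b) _; rewrite ler_wpM2r ?ler_norm.
  by rewrite CaE mulrDl -[2 * Cd * _]mulrA; apply: close_sub (lvl_a a) (lvl_a b).
have F_ge a : c1 * h <= `|F (tnth x a)|.
  have : c0 * (eta * h) <= N * D a.
    by apply: ler_pM => //; rewrite ?mulr_ge0 ?ltW.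
  have -> : c0 * (eta * h) = 2 * (c1 * h) by rewrite c1E; field.
  by move=> low; exact: lower_near (lvl_a a) low (small_quad _ qd).
have absP a : 0 < F (tnth x a) -> `|F (tnth x a)| = F (tnth x a) by exact: gtr0_norm.
have absN a : F (tnth x a) < 0 -> `|F (tnth x a)| = - F (tnth x a) by exact: ltr0_norm.
have CTh2 : 0 <= CT * h ^+ 2 by rewrite mulr_ge0.
have Cah2 : 0 <= Ca * h ^+ 2 by rewrite mulr_ge0.
have edge a b : `|F (tnth x a) - F (tnth x b)| <= Ca * h ^+ 2 ->
    `|'D_(tnth x a - tnth x b) F p| <= (Ca + CT) * h ^+ 2.
  by rewrite mulrDl; apply: close_bound; exact: Taylor.
have e1p : `|'D_(tnth x 2 - tnth x 0) F p| <= (Ca + CT) * h ^+ 2.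
  by apply: edge; have := F_close 2 0; rewrite !absP.
have e2p : `|'D_(tnth x 3 - tnth x 1) F p| <= (Ca + CT) * h ^+ 2.
  by apply: edge; have := F_close 3 1; rewrite !absN// -[X in X <= _ -> _]normrN opprB opprK addrC.
have toy y a b : hull x y -> `|'D_(tnth x a - tnth x b) F p| <= (Ca + CT) * h ^+ 2 ->
    `|'D_(tnth x a - tnth x b) F y| <= (Ca + 2 * CT) * h ^+ 2.
  move=> xy Dp; rewrite (_ : _ * _ = (Ca + CT) * h ^+ 2 + CT * h ^+ 2); last by ring.
  by apply: close_bound Dp; rewrite distrC; exact: Grad.
have CC : (Ca + 2 * CT) * h ^+ 2 <= C * h ^+ 2.
  exact: ler_wpM2r.
have quad_lt : CT * h ^+ 2 + (Ca + CT) * h ^+ 2 < c1 * h.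
  apply: lt_le_trans (small_quad _ q2).
  have -> : (2 * CT + Ca + 1) * h ^+ 2 = CT * h ^+ 2 + (Ca + CT) * h ^+ 2 + h ^+ 2 by ring.
  by rewrite ltrDl exprn_gt0.
have seg a b t : 0 <= t <= 1 -> a != b ->
    `|F (tnth x a + t *: (tnth x b - tnth x a)) - F (tnth x a) -
      t * 'D_(tnth x b - tnth x a) F p| <= CT * h ^+ 2.
  move=> t01 ab; have := Taylor _ _ (hull_segment x t01 ab) (vx a).
  have -> : tnth x a + t *: (tnth x b - tnth x a) - tnth x a = t *: (tnth x b - tnth x a) + 0.
    by rewrite addr0 addrC addKr.
  by rewrite (derive_comb _ _ _ dFp) derive0 addr0.
have scale_le (t a : R) (k : R) : 0 <= t <= 1 -> `|a| <= k -> `|t * a| <= k.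
  move=> /andP[t0 t1] ak; rewrite normrM ger0_norm//.
  by apply: le_trans ak; rewrite ler_piMl.
split=> //.
- by move=> y /dF[].
- by move=> y xy; apply: le_trans CC; exact: toy.
- by move=> y xy; apply: le_trans CC; exact: toy.
- move=> u v y u01 v01 xy; have [_ _ dFy] := dF y xy.
  have -> : tnth x 1 - tnth x 0 + v *: (tnth x 3 - tnth x 1) - u *: (tnth x 2 - tnth x 0) =
      v *: (tnth x 3 - tnth x 1) + ((- u) *: (tnth x 2 - tnth x 0) + (tnth x 1 - tnth x 0)).
    by rewrite scaleNr [in RHS]addrA [in RHS]addrC [in RHS]addrA.
  rewrite !derive_comb//.
  rewrite mulNr; apply: (cross_bound (scale_le _ _ _ v01 (toy y _ _ xy e2p))
    (scale_le _ _ _ u01 (toy y _ _ xy e1p)) (Grad y 1 0 xy) (Taylor _ _ (vx 1) (vx 0))).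
  + by rewrite -absP.
  + by rewrite -absN.
  + by apply: le_trans (small_quad _ q6); rewrite le_eqVlt; apply/orP; left; apply/eqP; ring.
- move=> u u01; apply: (positive_near (seg 0 2 u u01 isT) (scale_le _ _ _ u01 e1p)) quad_lt.
  by rewrite -absP.
- move=> v v01; rewrite -oppr_gt0; have := seg 1 3 v v01 isT.
  have v13 := scale_le _ _ _ v01 e2p; rewrite -normrN in v13.
  rewrite -[X in X <= _ -> _]normrN 2!opprD => s13.
  by apply: (positive_near s13 v13) quad_lt; rewrite -absN.
- move=> a b t a02 b13 t01 Fz.
  have ab : a != b by case/orP: a02 => /eqP ->; case/orP: b13 => /eqP ->.
  have Fa : 0 < F (tnth x a) by case/orP: a02 => /eqP ->.
  have Fb : F (tnth x b) < 0 by case/orP: b13 => /eqP ->.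
  have s1 := seg a b t t01 ab; rewrite Fz sub0r in s1.
  have s2 := scale_le t _ _ t01 (Taylor _ _ (vx b) (vx a)).
  have s3 := scale_le t _ _ t01 (F_close a b).
  have key : `|F (tnth x a) * (1 - 2 * t)| <= (2 * CT + Ca) * h ^+ 2.
    rewrite (_ : (2 * CT + Ca) * _ = 2 * (CT * h ^+ 2) + Ca * h ^+ 2); last by ring.
    apply: half_bound s1 s2 _.
    by rewrite absP// absN// in s3.
  have {key} key : c1 * h * `|1 - 2 * t| <= (2 * CT + Ca) * h ^+ 2.
    by apply: le_trans key; rewrite normrM ler_wpM2r.
  apply: (@le_trans _ _ ((2 * CT + Ca) / c1 * h)); last exact: ler_wpM2r.
  rewrite mulrAC ler_pdivlMr// -(ler_pM2r h_gt0).
  by rewrite -[X in _ <= X]mulrA -hhE -mulrA mulrC.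
- move=> mu mu0 i; have reg_i := shape_regular_bary_perm xT reg mu0 i.
  have dle : 2 * c1 * h <= (C0 + CT) * diam (hull T).
    have e01 : enorm (tnth x 0 - tnth x 1) <= diam (hull T).
      by rewrite -xTh; exact: enorm_le_diam.
    have Tle := T2 _ _ (small _ _ (vx 0) xp) (small _ _ (vx 1) xp).
    have DNle := derive_le_grad (tnth x 0 - tnth x 1) dFp.
    have NDle : N * enorm (tnth x 0 - tnth x 1) <= C0 * diam (hull T).
      by apply: ler_pM => //; [exact: ltW|exact: enorm_ge0].
    have CTle : CT * h * `|tnth x 0 - tnth x 1| <= CT * diam (hull T).
      rewrite -mulrA ler_wpM2l//; apply: le_trans e01.
      apply: le_trans (norm_le_enorm _); rewrite ler_piMl//.
    rewrite -[2 * c1 * h]mulrA [(C0 + CT) * _]mulrDl.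
    apply: (gap_bound _ _ Tle DNle); [by rewrite -absP|by rewrite -absN|exact: lerD].
  have : `|mu i| * (2 * c1 * h) <= (C0 + CT) * (`|kappa| * enorm (\sum_i mu i *: tnth x i)).
    apply: le_trans (ler_wpM2l (normr_ge0 _) dle) _.
    by rewrite mulrCA; apply: ler_wpM2l; [exact: C0CT|exact: reg_i].
  set V := enorm _ => key; have V0 : 0 <= V by exact: enorm_ge0.
  apply: (@le_trans _ _ (`|kappa| * (C0 + CT) / (2 * c1) * V)).
    rewrite mulrAC (ler_pdivlMr _ _ c1_2).
    have -> : `|mu i| * h * (2 * c1) = `|mu i| * (2 * c1 * h) by ring.
    by apply: le_trans key _; rewrite mulrCA mulrA.
  exact: ler_wpM2r.
Qed.

End CutCells.

(** * The split triangles *)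

Lemma pair_weight_half (R : realType) (a b : 'I_4) (t : R) :
  ((a == 0) || (a == 2)) (+) ((b == 0) || (b == 2)) ->
  (if 0 == a then 1 - t else if 0 == b then t else 0) +
      (if 2 == a then 1 - t else if 2 == b then t else 0) - 1 / 2 =
  (if (a == 0) || (a == 2) then 1 else - 1) * ((1 - 2 * t) / 2).
Proof.
by case: a => -[|[|[|[|//]]]] a4; case: b => -[|[|[|[|//]]]] b4 //= _; field.
Qed.

Section SplitTriangles.
Context {R : realType}.
Local Notation pt := 'rV[R]_3.
Variables (U K : set pt) (F : pt -> R) (c C h : R) (x : 4.-tuple pt).
Hypothesis xcut : cut_cell F K c C h x.
Hypothesis KU : K `<=` U.
Hypothesis F_diff : forall y, K y -> differentiable F y.
Hypothesis Ch : C * h <= 1 / 2.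

(** The last condition is the midpoint property of a cut edge: exactly one end of
the edge has index 0 or 2. *)
Definition vertex_weights (k : 'I_4 -> R) (P : pt) : Prop :=
  [/\ forall a, 0 <= k a, \sum_a k a = 1, P = \sum_a k a *: tnth x a &
      `|k 0 + k 2 - 1 / 2| <= C * h].

Lemma vertex_sign a : if (a == 0) || (a == 2) then 0 < F (tnth x a) else F (tnth x a) < 0.
Proof.
have z01 : 0 <= (0 : R) <= 1 by rewrite lexx ler01. have o01 : 0 <= (1 : R) <= 1 by rewrite lexx ler01.
have := cc_pos xcut z01; have := cc_pos xcut o01; have := cc_neg xcut z01; have := cc_neg xcut o01.
rewrite !scale0r !scale1r !addr0 !subrKC => F3 F1 F2 F0.
case: a => -[|[|[|[|//]]]] a4 /=.
- by rewrite (_ : Ordinal a4 = 0)//; exact: val_inj.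
- by rewrite (_ : Ordinal a4 = 1)//; exact: val_inj.
- by rewrite (_ : Ordinal a4 = 2)//; exact: val_inj.
- by rewrite (_ : Ordinal a4 = 3)//; exact: val_inj.
Qed.

Lemma sum_pair (V : lmodType R) (a b : 'I_4) (s t : R) (f : 'I_4 -> V) : a != b ->
  \sum_k (if k == a then s else if k == b then t else 0) *: f k = s *: f a + t *: f b.
Proof.
move=> ab; have ba : b != a by rewrite eq_sym.
rewrite (bigD1 a)//= eqxx (bigD1 b)//= (negbTE ba) eqxx.
by rewrite big1 ?addr0// => k /andP[/negbTE -> /negbTE ->]; rewrite scale0r.
Qed.

Lemma edge_zeroP a b : ((a == 0) || (a == 2)) (+) ((b == 0) || (b == 2)) ->
  exists t : R, [/\ 1 / 4 <= t <= 3 / 4, F (edge_zero U F x a b) = 0 &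
    vertex_weights (fun k => if k == a then 1 - t else if k == b then t else 0)
      (edge_zero U F x a b)].
Proof.
move=> ab.
have ab_ne : a != b by apply: contraTneq ab => ->; rewrite addbb.
have seg_diff a' b' : a' != b' -> forall t : R, 0 <= t <= 1 ->
    differentiable F (tnth x a' + t *: (tnth x b' - tnth x a')).
  move=> ab' t t01; apply: F_diff; apply: (cc_sub xcut); exact: hull_segment.
have flip (t : R) : tnth x a + t *: (tnth x b - tnth x a) =
    tnth x b + (1 - t) *: (tnth x a - tnth x b).
  by apply/rowP => i; rewrite !mxE; ring.
have flip01 (t : R) : 0 <= t <= 1 -> 0 <= 1 - t <= 1 by move=> /andP[? ?]; apply/andP; split; lra.
have zero_exists : hull [:: tnth x a; tnth x b] `&` level_set U F !=set0.
  suff [t t01 Ft] : exists2 t : R, 0 <= t <= 1 & F (tnth x a + t *: (tnth x b - tnth x a)) = 0.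
    exists (tnth x a + t *: (tnth x b - tnth x a)); split; first by apply/hull_pairP; exists t.
    by split=> //; apply: KU; apply: (cc_sub xcut); exact: hull_segment.
  have sa := vertex_sign a; have sb := vertex_sign b; move: ab sa sb.
  case: ifP => _; case: ifP => _ //= _ Fa Fb.
    have [t /andP[t0 t1] Ft] := segment_zero (seg_diff a b ab_ne) Fa Fb.
    by exists t => //; rewrite !ltW.
  rewrite eq_sym in ab_ne; have [t /andP[t0 t1] Ft] := segment_zero (seg_diff b a ab_ne) Fb Fa.
  exists (1 - t); first by rewrite flip01// !ltW.
  by rewrite flip subKr.
have := xgetPex 0 zero_exists; rewrite -/(edge_zero U F x a b).
move=> [/hull_pairP[t t01 zE] [_ Fz]].
have half : `|1 - 2 * t| <= C * h.
  move: ab; case: (boolP ((a == 0) || (a == 2))) => [a02|a13]; last move=> /= b02.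
    move=> /= b13; apply: (cc_half xcut (b := b) a02) => //; last by rewrite -zE.
    by move: b13; clear; case: b => -[|[|[|[|//]]]].
  rewrite (_ : 1 - 2 * t = - (1 - 2 * (1 - t))); last by ring.
  rewrite normrN; apply: (cc_half xcut (b := a) b02); last by rewrite -flip -zE.
    by move: a13; clear; case: a => -[|[|[|[|//]]]].
  exact: flip01.
exists t; split=> //.
  by have := le_trans half Ch; rewrite ler_norml => /andP[? ?]; apply/andP; split; lra.
have /andP[t0 t1] := t01; split=> [k|||].
- by case: ifP => _; [rewrite subr_ge0|case: ifP].
- have := sum_pair (1 - t) t (fun=> 1 : R^o) ab_ne; rewrite /GRing.scale/=.
  by under eq_bigr do rewrite mulr1; rewrite !mulr1 subrK.
- by rewrite sum_pair// zE scalerBl scale1r scalerBr addrAC -addrA.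
- rewrite (pair_weight_half t ab).
  rewrite normrM (_ : `|if _ then _ else _| = 1); last by case: ifP; rewrite ?normrN normr1.
  rewrite mul1r normrM [`|2^-1|]ger0_norm//.
  by have := normr_ge0 (1 - 2 * t); lra.
Qed.

(** In either split triangle, two of the four vertices of the tetrahedron each enter
the weights of only one vertex of the triangle, with weight at least 1/4.  The
coefficients of these two triangle vertices can be read off mu, and the third
follows since the coefficients sum to 0. *)
Lemma two_weights_bound (mu : 'I_4 -> R) (a b : 'I_4) (p q r s t : R) : a != b ->
  1 / 4 <= s -> 1 / 4 <= t -> p + q + r = 0 -> mu a = p * s -> mu b = q * t ->
  [/\ `|p| <= 4 * \sum_i `|mu i|, `|q| <= 4 * \sum_i `|mu i| & `|r| <= 4 * \sum_i `|mu i|].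
Proof.
move=> ab s4 t4 pqr mua mub.
have le_sum : `|mu a| + `|mu b| <= \sum_i `|mu i|.
  rewrite (bigD1 a)//= (bigD1 b)/=; last by rewrite eq_sym.
  by rewrite addrA lerDl sumr_ge0.
have p4 : `|p| <= 4 * `|mu a|.
  rewrite mua normrM (ger0_norm (le_trans _ s4))//.
  by have := normr_ge0 p => p0; rewrite mulrCA ler_peMr//; lra.
have q4 : `|q| <= 4 * `|mu b|.
  rewrite mub normrM (ger0_norm (le_trans _ t4))//.
  by have := normr_ge0 q => q0; rewrite mulrCA ler_peMr//; lra.
have r4 : `|r| <= `|p| + `|q|.
  have -> : r = - (p + q) by move: pqr; lra.
  by rewrite normrN; exact: ler_normD.
have := normr_ge0 (mu a); have := normr_ge0 (mu b) => ? ?.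
by split; lra.
Qed.

Lemma split_triangle_weights (t : 3.-tuple pt) : t \in split_triangles U F x ->
  exists k : 'I_3 -> 'I_4 -> R, (forall i, vertex_weights (k i) (tnth t i)) /\
   forall e : 'I_3 -> R, \sum_i e i = 0 ->
     forall i, `|e i| <= 4 * \sum_a `|\sum_i e i * k i a|.
Proof.
pose pw (a b : 'I_4) (t : R) (k : 'I_4) := if k == a then 1 - t else if k == b then t else 0.
rewrite !inE => /orP[/eqP ->|/eqP ->].
- have [s [/andP[s1 s2] _ ws]] := @edge_zeroP 0 1 isT.
  have [p [/andP[p1 p2] _ wp]] := @edge_zeroP 1 2 isT.
  have [r [/andP[r1 r2] _ wr]] := @edge_zeroP 3 0 isT.
  exists (fun i : 'I_3 => nth (pw 0 0 0) [:: pw 0 1 s; pw 1 2 p; pw 3 0 r] i).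
  split=> [|e e0]; first by case=> -[|[|[|//]]] i3; [exact: ws|exact: wp|exact: wr].
  rewrite 2!big_ord_recl big_ord1 in e0.
  have [||||b1 b2 b0] := @two_weights_bound (fun a => \sum_i e i *
      nth (pw 0 0 0) [:: pw 0 1 s; pw 1 2 p; pw 3 0 r] i a) 2 3
      (e (lift ord0 ord0)) (e (lift ord0 (lift ord0 ord0))) (e ord0) p (1 - r) isT p1.
  + by lra.
  + by move: e0; lra.
  + by rewrite 2!big_ord_recl big_ord1 /pw/= !mulr0 add0r addr0.
  + by rewrite 2!big_ord_recl big_ord1 /pw/= !mulr0 !add0r.
  by case=> -[|[|[|//]]] i3; [move: b0|move: b1|move: b2]; congr (`|e _| <= _); exact: val_inj.
have [p [/andP[p1 p2] _ wp]] := @edge_zeroP 1 2 isT.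
have [s [/andP[s1 s2] _ ws]] := @edge_zeroP 2 3 isT.
have [r [/andP[r1 r2] _ wr]] := @edge_zeroP 3 0 isT.
exists (fun i : 'I_3 => nth (pw 0 0 0) [:: pw 1 2 p; pw 2 3 s; pw 3 0 r] i).
split=> [|e e0]; first by case=> -[|[|[|//]]] i3; [exact: wp|exact: ws|exact: wr].
rewrite 2!big_ord_recl big_ord1 in e0.
have [|||||b0 b2 b1] := @two_weights_bound (fun a => \sum_i e i *
    nth (pw 0 0 0) [:: pw 1 2 p; pw 2 3 s; pw 3 0 r] i a) 1 0
    (e ord0) (e (lift ord0 (lift ord0 ord0))) (e (lift ord0 ord0)) (1 - p) r isT.
- by lra.
- exact: r1.
- by move: e0; lra.
- by rewrite 2!big_ord_recl big_ord1 /pw/= !mulr0 !addr0.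
- by rewrite 2!big_ord_recl big_ord1 /pw/= !mulr0 !add0r.
by case=> -[|[|[|//]]] i3; [move: b0|move: b1|move: b2]; congr (`|e _| <= _); exact: val_inj.
Qed.

End SplitTriangles.

(** * The cut map *)

Lemma convex_unit (R : realType) (a b t : R) : 0 <= a <= 1 -> 0 <= b <= 1 -> 0 <= t <= 1 ->
  0 <= a + t * (b - a) <= 1.
Proof.
move=> /andP[a0 a1] /andP[b0 b1] /andP[t0 t1].
have s0 : 0 <= 1 - t by rewrite subr_ge0.
have := mulr_ge0 s0 a0; have := mulr_ge0 t0 b0.
have b1' : 0 <= 1 - b by lra. have a1' : 0 <= 1 - a by lra.
have := mulr_ge0 s0 a1'; have := mulr_ge0 t0 b1'.
by move=> ? ? ? ?; apply/andP; split; lra.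
Qed.

Section CutMap.
Context {R : realType}.
Local Notation pt := 'rV[R]_3.
Variables (U K : set pt) (F : pt -> R) (c C h : R) (x : 4.-tuple pt).
Hypothesis xcut : cut_cell F K c C h x.
Hypothesis c_gt0 : 0 < c.
Hypothesis KU : K `<=` U.
Hypothesis F_diff : forall y, K y -> differentiable F y.

Let h_gt0 : 0 < h := cc_h_gt0 xcut.

(** The matrix of the vertices is invertible because [cc_bary] excludes nontrivial
affine relations between them. *)
Lemma baryE (l : 'I_4 -> R) : \sum_a l a = 1 ->
  bary x (\sum_a l a *: tnth x a) = \row_a l a.
Proof.
move=> l1; rewrite /bary; set A : 'M[R]_(1 + 3) := \matrix_(i < 4) _.
have rowA (k : 'I_4 -> R) : (\row_a k a : 'rV[R]_(1 + 3)) *m A =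
    row_mx (\sum_a k a)%:M (\sum_a k a *: tnth x a).
  rewrite mulmx_sum_row; apply/rowP => j; rewrite summxE [RHS]mxE.
  case: splitP => j' jE.
    rewrite (ord1 j') mxE eqxx mulr1n; apply: eq_bigr => a _.
    rewrite mxE mxE rowK mxE; case: splitP => [k0 _|k0 k0E].
      by rewrite (ord1 k0) mxE mulr1.
    by move: (ltn_ord j'); rewrite -jE k0E.
  rewrite summxE; apply: eq_bigr => a _.
  rewrite mxE mxE rowK mxE; case: splitP => [k0 k0E|k0 k0E].
    by move: (ltn_ord k0); rewrite -k0E jE.
  rewrite [RHS]mxE; congr (_ * tnth x a 0 _).
  by apply: val_inj; apply: (@addnI 1); rewrite -k0E jE.
have Aunit : A \in unitmx.
  rewrite -row_free_unit -kermx_eq0; apply/rowV0P => v /sub_kermxP vA.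
  have vE : v = \row_a v 0 a by apply/rowP => a; rewrite mxE.
  rewrite vE rowA -row_mx0 in vA; have [v1 v2] := eq_row_mx vA.
  have s0 : \sum_a v 0 a = 0.
    by move/matrixP: v1 => /(_ 0 0); rewrite !mxE eqxx mulr1n.
  apply/rowP => a; rewrite [RHS]mxE; apply/eqP; rewrite -normr_le0.
  have := cc_bary xcut s0 a; rewrite v2 enorm0 mulr0.
  by rewrite pmulr_lle0.
have -> : row_mx (1 : 'rV_1) (\sum_a l a *: tnth x a) = (\row_a l a) *m A.
  by rewrite rowA l1.
by rewrite mulmxK.
Qed.

Lemma cut_mapE (l : 'I_4 -> R) : \sum_a l a = 1 ->
  cut_map U F x (\sum_a l a *: tnth x a) =
  cut_point U F x (l 2 / (l 0 + l 2)) (l 3 / (l 1 + l 3)).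
Proof. by move=> l1; rewrite /cut_map baryE// !mxE. Qed.

Lemma cut_point_atE u v w : cut_point_at x u v w =
  tnth x 0 + u *: (tnth x 2 - tnth x 0) +
  w *: (tnth x 1 - tnth x 0 + v *: (tnth x 3 - tnth x 1) - u *: (tnth x 2 - tnth x 0)).
Proof. by apply/rowP => i; rewrite /cut_point_at !mxE; ring. Qed.

Lemma hull_cut_point u v w : 0 <= u <= 1 -> 0 <= v <= 1 -> 0 <= w <= 1 ->
  hull x (cut_point_at x u v w).
Proof.
move=> /andP[u0 u1] /andP[v0 v1] /andP[w0 w1]; apply/hull_tupleP.
exists (tnth [tuple (1 - w) * (1 - u); w * (1 - v); (1 - w) * u; w * v]); split.
- by case=> -[|[|[|[|//]]]] a4; rewrite (tnth_nth 0)/= mulr_ge0// subr_ge0.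
- by rewrite !big_ord_recl big_ord0 !(tnth_nth 0)/=; ring.
- rewrite !big_ord_recl big_ord0 !(tnth_nth 0)/= /cut_point_at !(tnth_nth 0)/=.
  by apply/rowP => i; rewrite !mxE; ring.
Qed.

Lemma cut_point_diff u v w : 0 <= u <= 1 -> 0 <= v <= 1 -> 0 <= w <= 1 ->
  differentiable F (cut_point_at x u v w).
Proof. by move=> u01 v01 w01; apply/F_diff/(cc_sub xcut)/hull_cut_point. Qed.

Lemma cut_weightP u v : 0 <= u <= 1 -> 0 <= v <= 1 ->
  0 < cut_weight U F x u v < 1 /\
  level_set U F (cut_point_at x u v (cut_weight U F x u v)).
Proof.
move=> u01 v01.
pose M := tnth x 0 + u *: (tnth x 2 - tnth x 0).
pose N := tnth x 1 + v *: (tnth x 3 - tnth x 1).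
have MN t : M + t *: (N - M) = cut_point_at x u v t.
  by apply/rowP => i; rewrite /cut_point_at !mxE; ring.
have [t|t t01 Ft] := segment_zero _ (cc_pos xcut u01) (cc_neg xcut v01).
  by rewrite MN; exact: cut_point_diff.
apply: (@xgetPex _ 0 [set w : R | 0 < w < 1 /\ level_set U F (cut_point_at x u v w)]).
have /andP[t0 t1] := t01.
exists t; split=> //; rewrite -MN; split=> //; apply/KU/(cc_sub xcut).
by rewrite MN; apply: hull_cut_point; rewrite // !ltW.
Qed.

(** The difference w y - w z times the slope of F along N - M, which is at least
c h in absolute value, is the change of F (M + w z (N - M)) from z to y: this
is the Lipschitz bound that the implicit function lemma asks for. *)
Lemma cut_weight_differentiable d (u v : 'rV[R]_d -> R) z :
  (\forall y \near z, 0 <= u y <= 1 /\ 0 <= v y <= 1) ->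
  differentiable u z -> differentiable v z ->
  differentiable (fun y => cut_weight U F x (u y) (v y)) z.
Proof.
move=> uv01 du dv; pose w y := cut_weight U F x (u y) (v y).
have [uz vz] := nbhs_singleton uv01; have [wz [Uz Fz]] := cut_weightP uz vz.
pose P y := tnth x 0 + u y *: (tnth x 2 - tnth x 0).
pose b y := tnth x 1 - tnth x 0 + v y *: (tnth x 3 - tnth x 1) - u y *: (tnth x 2 - tnth x 0).
have dP : differentiable P z.
  apply: (@differentiableD _ _ _ (cst (tnth x 0)) (fun y => u y *: _)) => //.
  exact: differentiableZl.
have db : differentiable b z.
  apply: (@differentiableB _ _ _ (fun y => _ + v y *: _) (fun y => u y *: _)).
    apply: (@differentiableD _ _ _ (cst _) (fun y => v y *: _)) => //.
    exact: differentiableZl.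
  exact: differentiableZl.
have wz01 : 0 <= w z <= 1 by case/andP: wz => *; rewrite !ltW.
have dFz : differentiable F (P z + w z *: b z).
  by rewrite -cut_point_atE; exact: cut_point_diff.
have cross y q : 0 <= u y <= 1 -> 0 <= v y <= 1 -> hull x q -> 'D_(b y) F q <= - (c * h).
  by move=> *; exact: (cc_cross xcut).
have zero : \forall y \near z, F (P y + w y *: b y) = F (P z + w z *: b z).
  apply: filterS uv01 => y [uy vy]; have [_ [_ Fy]] := cut_weightP uy vy.
  by rewrite -!cut_point_atE Fz Fy.
have dG : differentiable (F \o (fun y => P y + w z *: b y)) z.
  apply: differentiable_comp; last exact: dFz.
  by apply: differentiableD dP _; exact: differentiableZ.
have [L L0 G_lip] := differentiable_lipschitz dG.
have ch : 0 < c * h by exact: mulr_gt0.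
apply: (implicit_weight_differentiable (L := L / (c * h)) dP db dFz zero); last first.
  rewrite -deriveE// lt_eqF//; apply: le_lt_trans (cross z _ uz vz _) _.
    by rewrite -cut_point_atE; exact: hull_cut_point.
  by rewrite oppr_lt0.
apply: filterS3 uv01 zero G_lip => y [uy vy] Fy /= Gy.
have [wy _] := cut_weightP uy vy.
have wy01 : 0 <= w y <= 1 by case/andP: wy => *; rewrite !ltW.
have [t t01 FE] : exists2 t : R, 0 <= t <= 1 &
    F (P y + w y *: b y) - F (P y + w z *: b y) =
    'D_((w y - w z) *: b y) F (P y + (w z + t * (w y - w z)) *: b y).
  have seg t : P y + w z *: b y + t *: (P y + w y *: b y - (P y + w z *: b y)) =
      P y + (w z + t * (w y - w z)) *: b y.
    by apply/rowP => i; rewrite !mxE; ring.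
  have dir : P y + w y *: b y - (P y + w z *: b y) = (w y - w z) *: b y.
    by rewrite opprD addrACA subrr add0r scalerBl.
  have [t t01 E] := @mean_value R 3 F (P y + w z *: b y) (P y + w y *: b y)
    (fun t t01 => ltac:(by rewrite seg -cut_point_atE; apply: cut_point_diff => //; exact: convex_unit)).
  by exists t; [exact: t01|rewrite -seg -dir; exact: E].
move: FE; set q := P y + (w z + _) *: b y.
have hq : hull x q.
  by rewrite /q -cut_point_atE; apply: hull_cut_point => //; exact: convex_unit.
have dFq : differentiable F q by exact/F_diff/(cc_sub xcut).
have DE : 'D_((w y - w z) *: b y) F q = (w y - w z) * 'D_(b y) F q.
  by rewrite -[X in 'D_X F q]addr0 (derive_comb _ _ _ dFq) derive0 addr0.
move=> FE; rewrite DE in FE.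
have Dq : c * h <= `|'D_(b y) F q|.
  by rewrite -normrN (le_trans _ (ler_norm _))// lerNr; exact: cross.
rewrite mulrAC ler_pdivlMr//; apply: le_trans Gy.
by rewrite /= -Fy [X in _ <= X]distrC FE normrM ler_wpM2l.
Qed.

End CutMap.

(** * Coordinates along a split triangle *)

Lemma affine_map_hull (R : realType) (k : 3.-tuple 'rV[R]_3) xi :
  ref_triangle xi -> hull k (affine_map k xi).
Proof.
move=> [x0 x1 x01]; apply/hull_tupleP.
exists (tnth [tuple 1 - xi 0 0 - xi 0 1; xi 0 0; xi 0 1]); split.
- by case=> -[|[|[|//]]] a3; rewrite (tnth_nth 0)//=; lra.
- by rewrite !big_ord_recl big_ord0 !(tnth_nth 0)/=; ring.
- rewrite !big_ord_recl big_ord0 /affine_map !(tnth_nth 0)/=.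
  by apply/rowP => i; rewrite !mxE; ring.
Qed.

Section ChartLift.
Context {R : realType}.
Implicit Types (G : set 'rV[R]_3) (V : set 'rV[R]_2) (g : 'rV[R]_2 -> 'rV[R]_3).

(** A chart is open onto its image, so s is the continuous inverse of g
applied to the continuous Y. *)
Lemma chart_lift_continuous d G k V g (s : 'rV[R]_d -> 'rV[R]_2)
    (Y : 'rV[R]_d -> 'rV[R]_3) z : local_chart k G V g ->
  {for z, continuous Y} -> (\forall y \near z, V (s y) /\ g (s y) = Y y) ->
  {for z, continuous s}.
Proof.
move=> [Vopen _ ginj gopen] Yc near_s P; rewrite nbhsE => -[W [Wopen Ws] WP].
have [Vz gz] := nbhs_singleton near_s.
have [W2 W2open W2E] := gopen _ (openI Wopen Vopen) (@subIsetr _ W V).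
have W2z : W2 (Y z).
  have : (g @` (W `&` V)) (Y z) by exists (s z).
  by rewrite W2E => -[].
have Y_near : \forall y \near z, W2 (Y y) by apply: Yc; exact: open_nbhs_nbhs.
have [V3 _ V3E] := gopen _ Vopen (fun _ => id).
apply: filterS2 near_s Y_near => y [Vy gy] W2y; apply: WP.
have GY : G (Y y).
  have : (g @` V) (Y y) by exists (s y).
  by rewrite V3E => -[].
have : (g @` (W `&` V)) (Y y) by rewrite W2E.
move=> [v [Wv Vv] gv]; suff -> : s y = v by [].
by apply: ginj; rewrite ?inE// gv.
Qed.

Lemma chart_norm_injective V g B z (v : 'rV[R]_2) : differentiable g z ->
  (forall v, enorm v <= B * enorm ('D_v g z)) ->
  `|v| <= `|B| * 3%:R * `|'d g z v|.
Proof.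
move=> dg gB; apply: le_trans (norm_le_enorm v) _; apply: le_trans (gB v) _.
rewrite deriveE//; apply: (@le_trans _ _ (`|B| * enorm ('d g z v))).
  by rewrite ler_wpM2r ?ler_norm ?enorm_ge0.
by rewrite -mulrA ler_wpM2l// enorm_le_norm.
Qed.

End ChartLift.

Section CutCoordinates.
Context {R : realType} {I : Type}.
Local Notation pt := 'rV[R]_3.
Variables (U K : set pt) (F : pt -> R) (c C : R) (m : nat) (B CQ : R).
Hypothesis c_gt0 : 0 < c.
Hypothesis C_ge0 : 0 <= C.
Hypothesis KU : K `<=` U.
Hypothesis F_tame : tame (fun _ : I => K) m.+1 (fun _ _ => 1) (fun _ => F).
Hypothesis F_diff : forall y, K y -> differentiable F y.
Variables (h : I -> R) (x : I -> 4.-tuple pt) (k : I -> 3.-tuple pt).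
Variables (kap : I -> 'I_3 -> 'I_4 -> R).
Variables (V : I -> set 'rV[R]_2) (g : I -> 'rV[R]_2 -> pt) (s : I -> pt -> 'rV[R]_2).
Variables (q : I -> 'rV[R]_2) (Q : I -> 'M[R]_2).
Hypothesis xcut : forall i, cut_cell F K c C (h i) (x i).
Hypothesis Ch : forall i, C * h i <= 1 / 4.
Hypothesis kapP : forall i j, vertex_weights C (h i) (x i) (kap i j) (tnth (k i) j).
Hypothesis QB : forall i a b, `|Q i a b| <= CQ.
Hypothesis charts : forall i, [/\ local_chart m.+1 (level_set U F) (V i) (g i),
  forall (a : 'I_2 -> nat) z, (\sum_j a j <= m.+1)%N -> V i z ->
     enorm (mderiv a (g i) z) <= B &
  forall z v, V i z -> enorm v <= B * enorm ('D_v (g i) z)].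
Hypothesis sP : forall i X, hull (k i) X ->
  V i (s i X) /\ cut_map U F (x i) X = g i (s i X).

(** Parametrisations of the triangle: the reference triangle after an affine map
z -> q + z Q with bounded Q.  The reference and the scaled physical coordinates
are both of this form. *)
Definition param_domain i := [set z | ref_triangle (q i + z *m Q i)]°.
Definition lifted i z := s i (affine_map (k i) (q i + z *m Q i)).

Let O := param_domain.
Let Oopen i : open (O i). Proof. exact: open_interior. Qed.
Let h_gt0 i : 0 < h i := cc_h_gt0 (xcut i).
Let h_le1 i : h i <= 1 := cc_h_le1 (xcut i).
Let one2 : lift ord0 ord0 = 1 :> 'I_2. Proof. exact: val_inj. Qed.

Let xi i z : 'rV[R]_2 := q i + z *m Q i.
Let L0 i a := kap i 0 a + (q i 0 0 * (kap i 1 a - kap i 0 a) + q i 0 1 * (kap i 2 a - kap i 0 a)).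
Let L i e a := Q i e 0 * (kap i 1 a - kap i 0 a) + Q i e 1 * (kap i 2 a - kap i 0 a).
Let lam a i (z : 'rV[R]_2) := L0 i a + \sum_e z 0 e * L i e a.

Let xiE i z b : xi i z 0 b = q i 0 b + (z 0 0 * Q i 0 b + z 0 1 * Q i 1 b).
Proof. by rewrite !mxE big_ord_recl big_ord1 one2. Qed.

Let lamE a i z : lam a i z = (1 - xi i z 0 0 - xi i z 0 1) * kap i 0 a +
  xi i z 0 0 * kap i 1 a + xi i z 0 1 * kap i 2 a.
Proof. by rewrite /lam big_ord_recl big_ord1 one2 !xiE /L0 /L; ring. Qed.

Let OP i z : O i z -> ref_triangle (xi i z). Proof. exact: interior_subset. Qed.

Let big4 (W : nmodType) (f : 'I_4 -> W) : \sum_j f j = f 0 + f 1 + f 2 + f 3.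
Proof.
rewrite 3!big_ord_recl big_ord1 !addrA; congr (_ + f _ + f _ + f _); exact: val_inj.
Qed.

Let lam_sum i z : \sum_a lam a i z = 1.
Proof.
under eq_bigr do rewrite lamE; rewrite !big_split/= -!mulr_sumr.
have [_ -> _ _] := kapP i 0; have [_ -> _ _] := kapP i 1; have [_ -> _ _] := kapP i 2.
by ring.
Qed.

Let XE i z : affine_map (k i) (xi i z) = \sum_a lam a i z *: tnth (x i) a.
Proof.
under eq_bigr do rewrite lamE 2!scalerDl -!scalerA.
rewrite !big_split/= -!scaler_sumr.
have [_ _ <- _] := kapP i 0; have [_ _ <- _] := kapP i 1; have [_ _ <- _] := kapP i 2.
by rewrite /affine_map; apply/rowP => j; rewrite !mxE; ring.
Qed.

Let kap01 i j a : 0 <= kap i j a <= 1.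
Proof.
have [k0 k1 _ _] := kapP i j; rewrite k0 -k1 (bigD1 a)//= lerDl.
by apply: sumr_ge0.
Qed.

Let mix01 i z (f : 'I_3 -> R) (lo hi : R) : O i z -> (forall j, lo <= f j <= hi) ->
  lo <= (1 - xi i z 0 0 - xi i z 0 1) * f 0 + xi i z 0 0 * f 1 + xi i z 0 1 * f 2 <= hi.
Proof.
move=> /OP[]; move: (xi i z 0 0) (xi i z 0 1) => a b a0 b0 ab fj.
have c0 : 0 <= 1 - a - b by lra.
have /andP[l0 u0] := fj 0; have /andP[l1 u1] := fj 1; have /andP[l2 u2] := fj 2.
have := ler_wpM2l c0 l0; have := ler_wpM2l c0 u0.
have := ler_wpM2l a0 l1; have := ler_wpM2l a0 u1.
have := ler_wpM2l b0 l2; have := ler_wpM2l b0 u2.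
by move=> *; apply/andP; split; lra.
Qed.

Let lam01 a i z : O i z -> 0 <= lam a i z <= 1.
Proof. by move=> Oz; rewrite lamE; apply: (mix01 (f := fun j => kap i j a) Oz). Qed.

Let half_sum i j : 1 / 4 <= kap i j 0 + kap i j 2 <= 3 / 4 /\
  kap i j 1 + kap i j 3 = 1 - (kap i j 0 + kap i j 2).
Proof.
have [_ k1 _ kh] := kapP i j; have := le_trans kh (Ch i).
rewrite big4 in k1; rewrite ler_norml => /andP[? ?].
by split; [apply/andP; split; lra|lra].
Qed.

Let sig a b i (z : 'rV[R]_2) : (L0 i a + L0 i b) + \sum_e z 0 e * (L i e a + L i e b) =
  lam a i z + lam b i z.
Proof.
rewrite /lam; under eq_bigr do rewrite mulrDr.
by rewrite big_split/= addrACA.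
Qed.

Let sig02 i z : O i z -> 1 / 4 <= lam 0 i z + lam 2 i z <= 3 / 4.
Proof.
move=> Oz.
have -> : lam 0 i z + lam 2 i z = (1 - xi i z 0 0 - xi i z 0 1) * (kap i 0 0 + kap i 0 2) +
    xi i z 0 0 * (kap i 1 0 + kap i 1 2) + xi i z 0 1 * (kap i 2 0 + kap i 2 2).
  by rewrite !lamE; ring.
exact: (mix01 (f := fun j => kap i j 0 + kap i j 2) Oz (fun j => (half_sum i j).1)).
Qed.

Let sig13 i z : O i z -> 1 / 4 <= lam 1 i z + lam 3 i z <= 3 / 4.
Proof.
move=> Oz; have /andP[? ?] := sig02 Oz; have := lam_sum i z; rewrite big4 => ?.
by apply/andP; split; lra.
Qed.

Let kap_close i j j' : `|(kap i j 0 + kap i j 2) - (kap i j' 0 + kap i j' 2)| <= 2 * (C * h i).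
Proof.
have [_ _ _ k1] := kapP i j; have [_ _ _ k2] := kapP i j'.
by move: k1 k2; rewrite !ler_norml => /andP[? ?] /andP[? ?]; apply/andP; split; lra.
Qed.


(** A common bound for the slopes of the barycentric coordinates, those of their
sums divided by h, and the derivatives of F along the edges. *)
Let C' := C + 2 * `|CQ| + 4 * `|CQ| * C.

Let C'E : `|CQ| + `|CQ| <= C' /\ C <= C'.
Proof.
have CQ0 := normr_ge0 CQ; have p0 : 0 <= 4 * `|CQ| * C by rewrite !mulr_ge0.
by have C0 := C_ge0; rewrite /C'; split; lra.
Qed.

Let L_le i e a : `|L i e a| <= C'.
Proof.
apply: (@le_trans _ _ (`|CQ| + `|CQ|)); last first.
  exact: C'E.1.
have kk j : `|kap i j a - kap i 0 a| <= 1.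
  have /andP[? ?] := kap01 i j a; have /andP[? ?] := kap01 i 0 a.
  by rewrite ler_norml; apply/andP; split; lra.
have QC b : `|Q i e b| <= `|CQ| by exact: le_trans (QB i e b) (ler_norm _).
apply: le_trans (ler_normD _ _) _; rewrite !normrM.
by apply: lerD; rewrite -[X in _ <= X]mulr1; apply: ler_pM.
Qed.

Let L02 i e : `|L i e 0 + L i e 2| <= C' * h i.
Proof.
have -> : L i e 0 + L i e 2 =
    Q i e 0 * ((kap i 1 0 + kap i 1 2) - (kap i 0 0 + kap i 0 2)) +
    Q i e 1 * ((kap i 2 0 + kap i 2 2) - (kap i 0 0 + kap i 0 2)) by rewrite /L; ring.
have QC b : `|Q i e b| <= `|CQ| by exact: le_trans (QB i e b) (ler_norm _).
apply: (@le_trans _ _ (`|CQ| * (2 * (C * h i)) + `|CQ| * (2 * (C * h i)))).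
  apply: le_trans (ler_normD _ _) _; rewrite !normrM.
  by apply: lerD; apply: ler_pM => //; exact: kap_close.
have : 0 <= (C + 2 * `|CQ|) * h i by rewrite mulr_ge0 ?(ltW (h_gt0 i))// addr_ge0// mulr_ge0.
by rewrite /C'; lra.
Qed.

Let L13 i e : `|L i e 1 + L i e 3| <= C' * h i.
Proof.
suff -> : L i e 1 + L i e 3 = - (L i e 0 + L i e 2) by rewrite normrN; exact: L02.
have s1 := (half_sum i 0).2; have s2 := (half_sum i 1).2; have s3 := (half_sum i 2).2.
rewrite /L.
have -> : Q i e 0 * (kap i 1 1 - kap i 0 1) + Q i e 1 * (kap i 2 1 - kap i 0 1) +
    (Q i e 0 * (kap i 1 3 - kap i 0 3) + Q i e 1 * (kap i 2 3 - kap i 0 3)) =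
    Q i e 0 * ((kap i 1 1 + kap i 1 3) - (kap i 0 1 + kap i 0 3)) +
    Q i e 1 * ((kap i 2 1 + kap i 2 3) - (kap i 0 1 + kap i 0 3)) by ring.
by rewrite s1 s2 s3; ring.
Qed.

Let c' := Num.min c (1 / 4).
Let c'_gt0 : 0 < c'. Proof. by rewrite lt_min c_gt0 divr_gt0. Qed.

Let sigE02 i z : O i z ->
  c' <= (L0 i 0 + L0 i 2) + \sum_e z 0 e * (L i e 0 + L i e 2) <= 1.
Proof.
move=> Oz; rewrite sig; have /andP[l u] := sig02 Oz; apply/andP; split; last lra.
by apply: le_trans l; rewrite /c' ge_min lexx orbT.
Qed.

Let sigE13 i z : O i z ->
  c' <= (L0 i 1 + L0 i 3) + \sum_e z 0 e * (L i e 1 + L i e 3) <= 1.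
Proof.
move=> Oz; rewrite sig; have /andP[l u] := sig13 Oz; apply/andP; split; last lra.
by apply: le_trans l; rewrite /c' ge_min lexx orbT.
Qed.

Let u i (z : 'rV[R]_2) := lam 2 i z / ((L0 i 0 + L0 i 2) + \sum_e z 0 e * (L i e 0 + L i e 2)).
Let v i (z : 'rV[R]_2) := lam 3 i z / ((L0 i 1 + L0 i 3) + \sum_e z 0 e * (L i e 1 + L i e 3)).
Let w i (z : 'rV[R]_2) := cut_weight U F (x i) (u i z) (v i z).

Let u01 i z : O i z -> 0 <= u i z <= 1.
Proof.
move=> Oz; rewrite /u sig; have /andP[l r] := sig02 Oz.
have /andP[l0 _] := lam01 0 Oz; have /andP[l2 _] := lam01 2 Oz.
have s0 : 0 < lam 0 i z + lam 2 i z by lra.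
by rewrite divr_ge0 ?(ltW s0)//= ler_pdivrMr// mul1r lerDr.
Qed.

Let v01 i z : O i z -> 0 <= v i z <= 1.
Proof.
move=> Oz; rewrite /v sig; have /andP[l r] := sig13 Oz.
have /andP[l0 _] := lam01 1 Oz; have /andP[l2 _] := lam01 3 Oz.
have s0 : 0 < lam 1 i z + lam 3 i z by lra.
by rewrite divr_ge0 ?(ltW s0)//= ler_pdivrMr// mul1r lerDr.
Qed.

Let u_diff i z : O i z -> differentiable (u i) z.
Proof.
by have [_ + _] := ratio_ord h_gt0 h_le1 Oopen c'_gt0 (lam01 2) sigE02
  (fun i e => L_le i e 2) L02 0; exact.
Qed.

Let v_diff i z : O i z -> differentiable (v i) z.
Proof.
by have [_ + _] := ratio_ord h_gt0 h_le1 Oopen c'_gt0 (lam01 3) sigE13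
  (fun i e => L_le i e 3) L13 0; exact.
Qed.

Let wP i z (Oz : O i z) := cut_weightP (xcut i) KU F_diff (u01 Oz) (v01 Oz).

Let w01 i z : O i z -> 0 <= w i z <= 1.
Proof. by move=> Oz; have [/andP[w0 w1] _] := wP Oz; rewrite !ltW. Qed.

Let w_diff i z : O i z -> differentiable (w i) z.
Proof.
move=> Oz; apply: (cut_weight_differentiable (xcut i) c_gt0 KU F_diff).
- by apply: (near_open Oopen Oz) => y Oy; split; [exact: u01|exact: v01].
- exact: u_diff.
- exact: v_diff.
Qed.

Let Y i (z : 'rV[R]_2) : pt := tnth (x i) 0 + u i z *: (tnth (x i) 2 - tnth (x i) 0) +
  w i z *: (tnth (x i) 1 - tnth (x i) 0 + v i z *: (tnth (x i) 3 - tnth (x i) 1)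
    - u i z *: (tnth (x i) 2 - tnth (x i) 0)).

Let YE i z : Y i z = cut_point_at (x i) (u i z) (v i z) (w i z).
Proof. by rewrite cut_point_atE. Qed.

Let Yhull i z : O i z -> hull (x i) (Y i z).
Proof. by move=> Oz; rewrite YE; apply: hull_cut_point; [exact: u01|exact: v01|exact: w01]. Qed.

Let YK i z : O i z -> K (Y i z).
Proof. by move=> Oz; apply: (cc_sub (xcut i)); exact: Yhull. Qed.

Let FY i z : O i z -> F (Y i z) = 0.
Proof. by move=> Oz; rewrite YE; have [_ [_]] := wP Oz. Qed.

Let vertex_diff i a a' : `|tnth (x i) a - tnth (x i) a'| <= h i.
Proof. by apply: (cc_diam (xcut i)); exact: hull_vertex. Qed.

Let C_C' i : C * h i ^+ 2 <= C' * h i ^+ 2.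
Proof.
rewrite ler_wpM2r ?sqr_ge0//.
exact: C'E.2.
Qed.

Let FE1 i z : O i z -> `|'D_(tnth (x i) 2 - tnth (x i) 0) F (Y i z)| <= C' * h i ^+ 2.
Proof. by move=> Oz; apply: le_trans (C_C' i); apply: (cc_edge02 (xcut i)); exact: Yhull. Qed.

Let FE2 i z : O i z -> `|'D_(tnth (x i) 3 - tnth (x i) 1) F (Y i z)| <= C' * h i ^+ 2.
Proof. by move=> Oz; apply: le_trans (C_C' i); apply: (cc_edge13 (xcut i)); exact: Yhull. Qed.

Let FQ i z : O i z -> 'D_(tnth (x i) 1 - tnth (x i) 0 + v i z *: (tnth (x i) 3 - tnth (x i) 1)
    - u i z *: (tnth (x i) 2 - tnth (x i) 0)) F (Y i z) <= - (c' * h i).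
Proof.
move=> Oz; apply: le_trans (cc_cross (xcut i) (u01 Oz) (v01 Oz) (Yhull Oz)) _.
by rewrite lerN2 ler_wpM2r ?(ltW (h_gt0 i))// /c' ge_min lexx.
Qed.

Let Y_incr k' j : (k' <= m.+1)%N -> tame_incr O k' (half_order h 1) (fun i z => Y i z 0 j).
Proof.
move=> kN.
exact (@cut_point_incr R I 2 h O h_gt0 h_le1 Oopen L0 L x w F K C' c' c'_gt0
  lam01 sigE02 sigE13 L_le L02 L13 vertex_diff w01 w_diff YK FY FE1 FE2 FQ
  m F_tame k' j kN).
Qed.

Let lift_eq i z : O i z -> V i (lifted i z) /\ g i (lifted i z) = Y i z.
Proof.
move=> Oz; have [Vs sE] := sP (affine_map_hull (k i) (OP Oz)).
split=> //; rewrite /lifted -/(xi i z) -sE XE (cut_mapE U (xcut i) (lam_sum i z)).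
by rewrite YE /w /u /v !sig.
Qed.

Let lift_diff i z : O i z -> differentiable (lifted i) z.
Proof.
move=> Oz; have [chart_i _ g_inj] := charts i.
have near_lift : \forall y \near z, V i (lifted i y) /\ g i (lifted i y) = Y i y.
  by apply: (near_open Oopen Oz) => y; exact: lift_eq.
have dY : differentiable (Y i) z.
  apply/differentiable_coords => j; have := @Y_incr 1 j isT.
  by rewrite ord_incrE => -[dY _]; exact: dY.
have sc := chart_lift_continuous chart_i (differentiable_continuous dY) near_lift.
have [Vz _] := lift_eq Oz.
have dg : differentiable (g i) (lifted i z).
  by case: chart_i => _ [dg _] _ _; exact: dg.
apply: (implicit_chart_differentiable sc dY dg (B := `|B| * 3%:R)).
  by apply: filterS near_lift => y [].
by move=> t; apply: (chart_norm_injective (V i)) => // t'; exact: g_inj.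
Qed.

Lemma cut_coordinates_incr k' c0 : (k' <= m.+1)%N ->
  tame_incr param_domain k' (half_order h 1) (fun i z => lifted i z 0 c0).
Proof.
have Vopen i : open (V i) by have [[]] := charts i.
apply: (@chart_coordinates_incr R I 2 h O V h_gt0 h_le1 Oopen g lifted Y B m).
- by move=> i z /lift_eq[].
- exact: lift_diff.
- by move=> i z /lift_eq[].
- apply: (chart_tame Vopen (B := B)) => i; first by have [[]] := charts i.
  by have [_ gB _] := charts i; exact: gB.
- by move=> i y t Vy; have [_ _] := charts i; exact.
- exact: Y_incr.
Qed.

End CutCoordinates.

(** * Rescaling and Cartesian frames *)

Section Rescaling.
Context {R : realType} {I : Type} {d : nat}.

Lemma differentiable_scale (f : 'rV[R]_d -> R) (t : R) z v : differentiable f (t *: z) ->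
  differentiable (fun y => f (t *: y)) z /\
  'D_v (fun y => f (t *: y)) z = t * 'D_v f (t *: z).
Proof.
move=> df.
have ds : differentiable (fun y : 'rV[R]_d => t *: y) z by apply: differentiableZ.
have dfs : differentiable (f \o (fun y : 'rV[R]_d => t *: y)) z by exact: differentiable_comp.
split=> //; have -> : 'D_v (fun y => f (t *: y)) z = 'D_v (f \o (fun y => t *: y)) z by [].
rewrite deriveE// diff_comp//= -deriveE//.
have -> : 'd (fun y : 'rV[R]_d => t *: y) z v = t *: v.
  by rewrite (_ : (fun y => t *: y) = t \*: id)// diffZ// diff_val.
by rewrite !deriveE// linearZ.
Qed.

Lemma tame_rescale (O O' : I -> set 'rV[R]_d) (t : I -> R) k om (f : I -> 'rV[R]_d -> R) :
  (forall i, open (O' i)) -> (forall n i, 0 <= om n i) ->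
  (forall i z, O' i z -> O i (t i *: z)) ->
  tame O k om f -> tame O' k (fun n i => om n i * `|t i| ^+ n) (fun i z => f i (t i *: z)).
Proof.
move=> O'open; elim: k om f => [|k IHk] om f om0 O'O tf.
all: have [C bC] := tame_bounded tf.
  by split=> //; exists C => i z /O'O Oz; rewrite expr0 mulr1; exact: bC.
split; first by exists C => i z /O'O Oz; rewrite expr0 mulr1; exact: bC.
have df i z (Oz : O' i z) e := @differentiable_scale (f i) (t i) z e
  (tame_differentiable tf (O'O _ _ Oz)).
split=> [i z Oz|e]; first exact: (df i z Oz 0).1.
have om0' n i : 0 <= (om \o succn) n i by exact: om0.
have := IHk _ _ om0' O'O (tame_partial e tf).
move=> H; have om0'' n i : 0 <= (om \o succn) n i * `|t i| ^+ n by rewrite mulr_ge0// exprn_ge0.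
apply: (tame_ext O'open) (tameZ O'open (c := t) (C := 1) om0'' _ H) => [i z Oz|n i].
  by rewrite (df i z Oz _).2.
by rewrite mul1r /= exprS mulrCA.
Qed.

Lemma tame_incr_rescale (O O' : I -> set 'rV[R]_d) (t : I -> R) k om (f : I -> 'rV[R]_d -> R) :
  (forall i, open (O' i)) -> (forall n i, 0 <= om n i) ->
  (forall i z, O' i z -> O i (t i *: z)) ->
  tame_incr O k om f ->
  tame_incr O' k (fun n i => om n i * `|t i| ^+ n) (fun i z => f i (t i *: z)).
Proof.
move=> O'open om0 O'O; case: k => [//|k] [df pf].
have ds i z (Oz : O' i z) e := @differentiable_scale (f i) (t i) z e (df _ _ (O'O _ _ Oz)).
split=> [i z Oz|e]; first exact: (ds i z Oz 0).1.
have om0' n i : 0 <= (om \o succn) n i by exact: om0.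
have H := tame_rescale O'open om0' O'O (pf e).
have om0'' n i : 0 <= (om \o succn) n i * `|t i| ^+ n by rewrite mulr_ge0// exprn_ge0.
apply: (tame_ext O'open) (tameZ O'open (c := t) (C := 1) om0'' _ H) => [i z Oz|n i].
  by rewrite (ds i z Oz _).2.
by rewrite mul1r /= exprS mulrCA.
Qed.

Lemma Ck_sub (W : normedModType R) n (O O' : set 'rV[R]_d) (f : 'rV[R]_d -> W) :
  O' `<=` O -> Ck n O f -> Ck n O' f.
Proof.
move=> sub; elim: n f => [|n IHn] f /=; first by move=> cf z /sub; exact: cf.
by move=> [df Df]; split=> [z /sub|v]; [exact: df|exact/IHn/Df].
Qed.

End Rescaling.

Section Frames.
Context {R : realType}.
Local Notation pt := 'rV[R]_3.
Variables (k : 3.-tuple pt) (N h : R).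
Hypothesis h_gt0 : 0 < h.
Hypothesis kfree : forall e : 'I_3 -> R, \sum_i e i = 0 -> forall i,
  `|e i| * h <= N * enorm (\sum_i e i *: tnth k i).

Lemma affine_map_tuple (xi : 'rV[R]_2) : affine_map k xi =
  \sum_i tnth [tuple 1 - xi 0 0 - xi 0 1; xi 0 0; xi 0 1] i *: tnth k i.
Proof.
rewrite 2!big_ord_recl big_ord1 /affine_map !(tnth_nth 0)/=.
by apply/rowP => i; rewrite !mxE; ring.
Qed.

Lemma bary_unique (l l' : 'I_3 -> R) : \sum_i l i = 1 -> \sum_i l' i = 1 ->
  \sum_i l i *: tnth k i = \sum_i l' i *: tnth k i -> forall i, l i = l' i.
Proof.
move=> l1 l'1 E i; apply/eqP; rewrite -subr_eq0 -normr_le0.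
have s0 : \sum_i (l i - l' i) = 0 by rewrite sumrB l1 l'1 subrr.
have := kfree s0 i; under eq_bigr do rewrite scalerBl.
by rewrite sumrB E subrr enorm0 mulr0 pmulr_lle0.
Qed.

Lemma hull_affine_map xi : hull k (affine_map k xi) -> ref_triangle xi.
Proof.
rewrite affine_map_tuple => /hull_tupleP[l [l0 l1 E]].
set m := tnth _ in E.
have m1 : \sum_i m i = 1 by rewrite 2!big_ord_recl big_ord1 /m !(tnth_nth 0)/=; ring.
have ml := bary_unique m1 l1 E.
have m0 i : 0 <= m i by rewrite ml.
have := m0 ord0; have := m0 (lift ord0 ord0); have := m0 (lift ord0 (lift ord0 ord0)).
by rewrite /m !(tnth_nth 0)/= => ? ? ?; split=> //; lra.
Qed.

(** The matrix Q collects the coordinates of the frame vectors in the edges of the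
triangle; as these vectors have length 1, nondegeneracy of the triangle bounds Q
by a multiple of 1/h. *)
Lemma frame_param (o : pt) (E : 'M[R]_(2, 3)) : cartesian_frame k o E ->
  exists (q : 'rV[R]_2) (Q : 'M[R]_2), (forall a b, `|Q a b| * h <= N) /\
    forall z, plane_point o E z = affine_map k (q + z *m Q).
Proof.
move=> [EE inplane].
have aff_param y : aff k y -> exists xi : 'rV[R]_2, y = affine_map k xi.
  move=> /aff_tupleP[l [l1 ->]]; exists (\row_b l (lift ord0 b)).
  move: l1; rewrite affine_map_tuple 2!big_ord_recl big_ord1 => l1.
  rewrite 2!big_ord_recl big_ord1 2![in RHS]big_ord_recl big_ord1 !(tnth_nth 0)/= !mxE.
  rewrite -l1; congr (_ *: _ + (l _ *: _ + l _ *: _)); try exact: val_inj.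
  have -> : lift ord0 (0 : 'I_2) = lift ord0 ord0 :> 'I_3 by exact: val_inj.
  have -> : lift ord0 (1 : 'I_2) = lift ord0 (lift ord0 ord0) :> 'I_3 by exact: val_inj.
  by ring.
have [q qE] := aff_param _ (inplane 0).
have /choice[p pE] : forall a : 'I_2, exists xi, plane_point o E (delta_mx 0 a) = affine_map k xi.
  by move=> a; apply: aff_param; exact: inplane.
pose Q : 'M[R]_2 := \matrix_a (p a - q).
have map_diff xi xi' : affine_map k xi' - affine_map k xi =
    (xi' - xi) 0 0 *: (tnth k 1 - tnth k 0) + (xi' - xi) 0 1 *: (tnth k 2 - tnth k 0).
  by rewrite /affine_map; apply/rowP => i; rewrite !mxE; ring.
have rowE a : row a E = (Q a 0) *: (tnth k 1 - tnth k 0) + (Q a 1) *: (tnth k 2 - tnth k 0).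
  have -> : Q a 0 = (p a - q) 0 0 by rewrite mxE.
  have -> : Q a 1 = (p a - q) 0 1 by rewrite mxE.
  rewrite -map_diff -pE -qE /plane_point mul0mx addr0 rowE.
  by rewrite [X in X - _]addrC addrK.
exists q, Q; split=> [a b|z].
  pose e := tnth [tuple - (Q a 0 + Q a 1); Q a 0; Q a 1].
  have e0 : \sum_i e i = 0 by rewrite 2!big_ord_recl big_ord1 /e !(tnth_nth 0)/=; ring.
  have eE : \sum_i e i *: tnth k i = row a E.
    rewrite rowE 2!big_ord_recl big_ord1 /e !(tnth_nth 0)/=.
    by apply/rowP => i; rewrite !mxE; ring.
  have norm1 : enorm (row a E) = 1.
    have : (E *m E^T) a a = 1 by rewrite EE mxE eqxx.
    rewrite mxE /enorm => E1; rewrite -[RHS]sqrtr1 -E1; congr Num.sqrt.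
    by apply: eq_bigr => i _; rewrite !mxE expr2.
  have := kfree e0; rewrite eE norm1 mulr1 => bound.
  case: b => -[|[|//]] b2; [have := bound 1|have := bound 2]; rewrite /e (tnth_nth 0)/=;
    congr (`|Q a _| * _ <= _); exact: val_inj.
have -> : plane_point o E z = plane_point o E 0 + z *m E by rewrite /plane_point mul0mx addr0.
rewrite qE; apply/esym/eqP; rewrite [X in _ == X]addrC -subr_eq map_diff; apply/eqP.
rewrite [q + _]addrC addrK (mulmx_sum_row z Q) (mulmx_sum_row z E).
have l1 : lift ord0 ord0 = 1 :> 'I_2 by exact: val_inj.
rewrite !big_ord_recl !big_ord0 l1 !addr0 !rowE.
by apply/rowP => i; rewrite !mxE; ring.
Qed.

End Frames.

(** * The family of all configurations *)

Lemma Ck_le (R : realType) d (W : normedModType R) k l (O : set 'rV[R]_d)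
    (f : 'rV[R]_d -> W) : (k <= l)%N -> Ck l O f -> Ck k O f.
Proof.
elim: k l f => [|k IHk] [|l] f //=.
  by move=> _ [df _] z Oz; apply: differentiable_continuous; exact: df.
by move=> kl [df Df]; split=> // v; exact: IHk (Df v).
Qed.

Section Configurations.
Context {R : realType}.
Local Notation pt := 'rV[R]_3.
Variables (U K : set pt) (F : pt -> R) (c C CQ : R).
Variable A : set (set 'rV[R]_2 * ('rV[R]_2 -> pt)).

(** All data on which the constant must not depend. *)
Record configuration := Configuration {
  cf_h : R;
  cf_x : 4.-tuple pt;
  cf_k : 3.-tuple pt;
  cf_weights : 'I_3 -> 'I_4 -> R;
  cf_V : set 'rV[R]_2;
  cf_g : 'rV[R]_2 -> pt;
  cf_s : pt -> 'rV[R]_2;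
  cf_q : 'rV[R]_2;
  cf_Q : 'M[R]_2;
  cf_cut : cut_cell F K c C cf_h cf_x;
  cf_small : C * cf_h <= 1 / 4;
  cf_weightsP : forall j, vertex_weights C cf_h cf_x (cf_weights j) (tnth cf_k j);
  cf_Q_le : forall a b, `|cf_Q a b| <= CQ;
  cf_chart : A (cf_V, cf_g);
  cf_lift : forall X, hull cf_k X -> cf_V (cf_s X) /\ cut_map U F cf_x X = cf_g (cf_s X) }.

Definition cf_domain (i : configuration) : set 'rV[R]_2 := param_domain cf_q cf_Q i.
Definition cf_map (i : configuration) : 'rV[R]_2 -> 'rV[R]_2 := lifted cf_k cf_s cf_q cf_Q i.

Variable m : nat.
Hypothesis c_gt0 : 0 < c.
Hypothesis C_ge0 : 0 <= C.
Hypothesis KU : K `<=` U.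
Hypothesis cK : compact K.
Hypothesis CF : Ck m.+2 U F.
Hypothesis charts : uniform_charts m.+2 (level_set U F) A.

Let F_diff y : K y -> differentiable F y.
Proof. by case: CF => dF _ /KU; exact: dF. Qed.

Lemma configuration_incr k e : (k <= m.+1)%N ->
  tame_incr cf_domain k (half_order cf_h 1) (fun i z => cf_map i z 0 e).
Proof.
have [B chartsB] := charts.
apply: (@cut_coordinates_incr _ _ U K F c C m B CQ c_gt0 C_ge0 KU _ F_diff cf_h cf_x cf_k
  cf_weights cf_V cf_g cf_s cf_q cf_Q cf_cut cf_small cf_weightsP cf_Q_le _ cf_lift).
- by apply: (Ck_compact_tame configuration cK KU); exact: Ck_le CF.
- move=> i; have [[Vo Cg ginj gopen] gB g_inj] := chartsB _ _ (cf_chart i).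
  split=> //; first by split=> //; exact: Ck_le Cg.
  by move=> a z am; apply: gB; exact: leq_trans am _.
Qed.

Lemma cf_domain_open i : open (cf_domain i). Proof. exact: open_interior. Qed.

Lemma cf_h_gt0 i : 0 < cf_h i. Proof. exact: cc_h_gt0 (cf_cut i). Qed.

(** Physical coordinates are h times the parameter, which keeps the matrix Q of the
configuration bounded. *)
Definition scaled_domain i : set 'rV[R]_2 := [set z | cf_domain i ((cf_h i)^-1 *: z)].

Lemma scaled_domain_open i : open (scaled_domain i).
Proof.
have := @cf_domain_open i; apply: open_comp => z _.
by apply: differentiable_continuous; apply: differentiableZ.
Qed.

Lemma configuration_smooth n i : (n <= m)%N ->
  Ck n (cf_domain i) (cf_map i) /\
  Ck n (scaled_domain i) (fun z => cf_map i ((cf_h i)^-1 *: z)).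
Proof.
move=> nm; have om0 p q i' : 0 <= half_order cf_h p q i' by apply: half_order_ge0; exact: cf_h_gt0.
have incr e := @configuration_incr n.+1 e nm.
split; first exact: (tame_Ck (@cf_domain_open) i (om0 1) incr).
have incr' e := tame_incr_rescale (t := fun i => (cf_h i)^-1) (@scaled_domain_open) (om0 1)
  (fun i z Oz => Oz) (incr e).
apply: (tame_Ck (@scaled_domain_open) i _ incr') => q i'.
by rewrite mulr_ge0// exprn_ge0.
Qed.

Lemma configuration_mderiv n : (0 < n <= m)%N -> exists D : R, forall i a z,
  (\sum_j a j)%N = n ->
  (cf_domain i z -> enorm (mderiv a (cf_map i) z) <= D * cf_h i ^+ (n./2).+1) /\
  (scaled_domain i z -> enorm (mderiv a (fun z => cf_map i ((cf_h i)^-1 *: z)) z)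
     <= D * cf_h i ^- (n.-1)./2).
Proof.
move=> /andP[n0 nm].
have om0 p q i' : 0 <= half_order cf_h p q i' by apply: half_order_ge0; exact: cf_h_gt0.
have nm' : (n <= m.+1)%N by exact: leqW.
have incr e := configuration_incr e nm'.
have incr' e := tame_incr_rescale (t := fun i => (cf_h i)^-1) (@scaled_domain_open) (om0 1)
  (fun i z Oz => Oz) (incr e).
have om0' q i : 0 <= half_order cf_h 1 q i * `|(cf_h i)^-1| ^+ q by rewrite mulr_ge0// exprn_ge0.
have [D1 bD1] := mderiv_bounded (@cf_domain_open) (om0 1) n0 incr.
have [D2 bD2] := mderiv_bounded (@scaled_domain_open) om0' n0 incr'.
exists (`|D1| + `|D2|) => i a z an; split=> Oz.
  apply: le_trans (bD1 i a z an Oz) _; rewrite /half_order addn1.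
  apply: ler_wpM2r; first by rewrite exprn_ge0// ltW// cf_h_gt0.
  by rewrite (le_trans (ler_norm _))// lerDl.
apply: le_trans (bD2 i a z an Oz) _.
have h0 := cf_h_gt0 i.
have -> : half_order cf_h 1 n i * `|(cf_h i)^-1| ^+ n = cf_h i ^- (n.-1)./2.
  rewrite /half_order addn1 gtr0_norm ?invr_gt0// exprVn.
  have nE : (n = (n./2).+1 + (n.-1)./2)%N by lia.
  have -> : uphalf n.+1 = (n./2).+1 by rewrite uphalfE.
  rewrite {2}nE exprD invfM mulrA divff ?mul1r// expf_neq0// gt_eqF//.
apply: ler_wpM2r; first by rewrite invr_ge0 exprn_ge0// ltW.
by rewrite (le_trans (ler_norm _))// lerDr.
Qed.

End Configurations.

(** * The estimate *)

(** The nondegeneracy of the triangle, with a constant that does not see the order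
in which its vertices are listed. *)
Lemma split_triangle_permuted (R : realType) (U K : set 'rV[R]_3) (F : 'rV[R]_3 -> R)
    (c C h : R) (x : 4.-tuple 'rV[R]_3) (k k' : 3.-tuple 'rV[R]_3) :
  cut_cell F K c C h x -> K `<=` U -> (forall y, K y -> differentiable F y) ->
  C * h <= 1 / 2 -> 0 <= C -> k' \in split_triangles U F x -> perm_eq k k' ->
  exists2 w : 'I_3 -> 'I_4 -> R, forall i, vertex_weights C h x (w i) (tnth k i) &
   forall e : 'I_3 -> R, \sum_i e i = 0 ->
     forall i, `|e i| * h <= 16 * C * enorm (\sum_i e i *: tnth k i).
Proof.
move=> xcut KU dF Ch C0 k'_in /tuple_permP[p kE].
have {}kE i : tnth k i = tnth k' (p i).
  have -> : k = [tuple tnth k' (p i) | i < 3] by exact: val_inj.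
  by rewrite tnth_mktuple.
have [w [wP w_free]] := split_triangle_weights xcut KU dF Ch k'_in.
have wE i : vertex_weights C h x (w (p i)) (tnth k i) by rewrite kE.
exists (fun i => w (p i)) => // e e0 i.
have e0' : \sum_j e (p^-1 j)%g = 0.
  by rewrite -[RHS]e0 [RHS](reindex_inj (@perm_inj _ p^-1%g)).
pose mu a := \sum_i e i * w (p i) a.
have muE a : mu a = \sum_j e (p^-1 j)%g * w j a.
  by rewrite [RHS](reindex_inj (@perm_inj _ p)); apply: eq_bigr => j _; rewrite permK.
have mu0 : \sum_a mu a = 0.
  rewrite /mu exchange_big/= -[RHS]e0; apply: eq_bigr => j _.
  by rewrite -mulr_sumr; have [_ -> _ _] := wE j; rewrite mulr1.
have VE : \sum_i e i *: tnth k i = \sum_a mu a *: tnth x a.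
  rewrite /mu; under [RHS]eq_bigr do rewrite scaler_suml.
  rewrite [RHS]exchange_big/=; apply: eq_bigr => j _.
  have [_ _ {1}-> _] := wE j; rewrite scaler_sumr.
  by apply: eq_bigr => a _; rewrite scalerA.
have h0 := cc_h_gt0 xcut.
have := w_free _ e0' (p i); rewrite permK => bound.
apply: le_trans (ler_wpM2r (ltW h0) bound) _; rewrite VE.
set V := enorm _.
have : (\sum_a `|mu a|) * h <= 4 * (C * V).
  rewrite mulr_suml; apply: (@le_trans _ _ (\sum_(a < 4) C * V)).
    by apply: ler_sum => a _; exact: (cc_bary xcut mu0).
  by rewrite sumr_const card_ord mulr_natl.
under [X in 4 * X * h <= _]eq_bigr do rewrite -muE.
by move=> ?; lra.
Qed.

Theorem theorem4p6 (R : realType) (m : nat) (U : set 'rV[R]_3)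
    (F : 'rV[R]_3 -> R) (J : Type) (Th : J -> seq (4.-tuple 'rV[R]_3)) :
  polyhedral_domain U ->
  Ck m.+2 U F ->
  closed_level_surface U F ->
  (forall j, tetrahedral_mesh U (Th j)) ->
  admissible U F Th ->
  tubular_offset_shell U F Th ->
  exists2 h0 : R, 0 < h0 &
  forall n : nat, (1 <= n <= m)%N ->
  forall A : set (set 'rV[R]_2 * ('rV[R]_2 -> 'rV[R]_3)),
  uniform_charts m.+2 (level_set U F) A ->
  exists C : R,
  forall (j : J) (T x : 4.-tuple 'rV[R]_3) (K : 3.-tuple 'rV[R]_3)
    (V : set 'rV[R]_2) (g : 'rV[R]_2 -> 'rV[R]_3) (s : 'rV[R]_3 -> 'rV[R]_2),
  let h := mesh_size (Th j) in
  h <= h0 ->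
  T \in Th j -> is_cut U F T ->
  perm_eq x T ->
  0 < F (tnth x 0) -> 0 < F (tnth x 2) ->
  F (tnth x 1) < 0 -> F (tnth x 3) < 0 ->
  (exists2 K', K' \in split_triangles U F x & perm_eq K K') ->
  A (V, g) ->
  (forall X, hull K X -> V (s X) /\ cut_map U F x X = g (s X)) ->
  (Ck n (ref_triangle)° (s \o affine_map K) /\
   forall (a : 'I_2 -> nat) (xi : 'rV[R]_2),
     (\sum_i a i)%N = n -> (ref_triangle)° xi ->
     enorm (mderiv a (s \o affine_map K) xi) <= C * h ^+ (n./2).+1) /\
  (forall (o : 'rV[R]_3) (E : 'M[R]_(2, 3)), cartesian_frame K o E ->
   Ck n (plane_point o E @^-1` hull K)° (s \o plane_point o E) /\
   forall (a : 'I_2 -> nat) (z : 'rV[R]_2),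
     (\sum_i a i)%N = n -> (plane_point o E @^-1` hull K)° z ->
     enorm (mderiv a (s \o plane_point o E) z) <= C * h ^- (n.-1)./2).
Proof.
move=> _ CF surf _ adm _.
have [K [rho [c0 [C0 [CT [data cK KU]]]]]] := surface_dataP (Ck_le (k := 2) (isT : 2 <= m.+2)%N CF) surf.
have [_ _ G0 _] := surf.
have [h0 [c [C [h0_gt0 c_gt0 C_ge0 cells]]]] := admissible_cut_cell G0 data adm.
have F_diff y : K y -> differentiable F y by case: CF => dF _ /KU; exact: dF.
have C1_gt0 : 0 < 4 * (C + 1) by lra.
exists (Num.min h0 (1 / (4 * (C + 1)))); first by rewrite lt_min h0_gt0 divr_gt0.
move=> n n1m A chartsA.
have [D bD] := @configuration_mderiv R U K F c C (1 + 16 * C) A m c_gt0 C_ge0 KU cK CF chartsA n n1m.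
have /andP[n1 nm] := n1m.
exists D => j T x k V g s h; rewrite le_min => /andP[hh0 hC].
move=> Tin Tcut xT F0 F2 F1 F3 [k' k'_in kk'] AVg sP.
have xcut : cut_cell F K c C h x by exact: cells hh0 Tin Tcut xT F0 F2 F1 F3.
have h_gt0 := cc_h_gt0 xcut.
have Ch : C * h <= 1 / 4.
  move: hC; rewrite ler_pdivlMr// => hC; lra.
have Ch2 : C * h <= 1 / 2 by lra.
have [w wP k_free] := split_triangle_permuted xcut KU F_diff Ch2 C_ge0 k'_in kk'.
have N0 : 0 <= 16 * C by rewrite mulr_ge0.
split.
  have Q_le a b : `|(1 : 'M[R]_2) a b| <= 1 + 16 * C.
    by rewrite mxE; case: eqP => _; rewrite ?normr1 ?normr0; lra.
  pose i := Configuration 0 xcut Ch wP Q_le AVg sP.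
  have domE : cf_domain i = (ref_triangle)°.
    rewrite /cf_domain /param_domain; congr (_°); apply/funext => z /=.
    by rewrite add0r mulmx1.
  have mapE : cf_map i = s \o affine_map k.
    by apply/funext => z; rewrite /cf_map /lifted /= add0r mulmx1.
  rewrite -domE -mapE; split.
    exact: (@configuration_smooth R U K F c C (1 + 16 * C) A m c_gt0 C_ge0 KU cK CF chartsA n i nm).1.
  by move=> a xi an xi_in; exact: (bD i a xi an).1.
move=> o E frame.
have [q [Q [Q_le QE]]] := frame_param k_free frame.
have hQ_le a b : `|(h *: Q) a b| <= 1 + 16 * C.
  by rewrite mxE normrM gtr0_norm// mulrC; apply: le_trans (Q_le a b) _; lra.
pose i := Configuration q xcut Ch wP hQ_le AVg sP.
have unscale z : q + (h^-1 *: z) *m (h *: Q) = q + z *m Q.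
  by rewrite -scalemxAl -scalemxAr scalerA mulVf ?gt_eqF// scale1r.
have mapE : (fun z => cf_map i ((cf_h i)^-1 *: z)) = s \o plane_point o E.
  by apply/funext => z; rewrite /cf_map /lifted /= unscale QE.
have dom_sub : (plane_point o E @^-1` hull k)° `<=` scaled_domain (i : configuration _ _ _ _ _ _ _).
  move=> z z_in; rewrite /scaled_domain /= /cf_domain /param_domain /=.
  have scale_cont : continuous (fun y : 'rV[R]_2 => h *: y).
    by move=> y; apply: differentiable_continuous; exact: differentiableZ.
  have pre_open : open ((fun y : 'rV[R]_2 => h *: y) @^-1` (plane_point o E @^-1` hull k)°).
    by apply: open_comp (open_interior _) => y _; exact: scale_cont.
  rewrite /interior; apply: filterS (open_nbhs_nbhs (conj pre_open _)).
    move=> y /interior_subset /=; rewrite QE => /(hull_affine_map h_gt0 k_free).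
    by rewrite -scalemxAr -scalemxAl.
  by rewrite /= scalerA divff ?gt_eqF// scale1r.
rewrite -mapE; split.
  apply: Ck_sub dom_sub _.
  exact: (@configuration_smooth R U K F c C (1 + 16 * C) A m c_gt0 C_ge0 KU cK CF chartsA n i nm).2.
by move=> a z an z_in; apply: (bD i a z an).2; exact: dom_sub.
Qed.
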